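(* Let $\Gamma$ be a countably infinite discrete group which is not virtually cyclic. If $f\in\mathbb{Z}\Gamma$ satisfies $$\{v\in\ell^2(\Gamma,\mathbb{R}): v\cdot f=0\}=\{0\},$$ then the principal algebraic action $\alpha_f$ of $\Gamma$ on $X_f$ is ergodic with respect to the normalized Haar measure of $X_f$.
   Context: $\mathbb{Z}\Gamma$ is the integral group ring of $\Gamma$. For $v\in\ell^2(\Gamma,\mathbb{R})$ and $f=\sum_\gamma f_\gamma\cdot\gamma\in\mathbb{Z}\Gamma$, the convolution $v\cdot f\in\ell^2(\Gamma,\mathbb{R})$ is $(v\cdot f)_\gamma=\sum_{\gamma'\in\Gamma}v_{\gamma'}f_{\gamma'^{-1}\gamma}$ (right multiplication by $f$). Let $\mathbb{T}=\mathbb{R}/\mathbb{Z}$. On $\mathbb{T}^\Gamma$ define $(\lambda^\gamma x)_{\gamma'}=x_{\gamma^{-1}\gamma'}$ and $(\rho^\gamma x)_{\gamma'}=x_{\gamma'\gamma}$, and $\rho^f=\sum_\gamma f_\gamma\rho^\gamma$. Set $X_f=\ker\rho^f\subset\mathbb{T}^\Gamma$ (the Pontryagin dual of $\mathbb{Z}\Gamma/\mathbb{Z}\Gamma f$); the principal algebraic $\Gamma$-action $\alpha_f$ is the restriction of $\lambda$ to $X_f$. A group is virtually cyclic if it has a cyclic subgroup of finite index. *)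

(* Defs.v *)
From HB Require Import structures.
From mathcomp Require Import all_boot all_order all_algebra.
From mathcomp Require Import all_classical all_reals all_analysis.
Set Implicit Arguments. Unset Strict Implicit. Unset Printing Implicit Defensive.
Import Order.TTheory GRing.Theory Num.Theory.
Local Open Scope classical_set_scope.
Local Open Scope ring_scope.

Record group_law (G : Type) := GroupLaw {
  gmul : G -> G -> G;
  ginv : G -> G;
  gone : G;
  gmulA : forall x y z, gmul x (gmul y z) = gmul (gmul x y) z;
  gmul1g : forall x, gmul gone x = x;
  gmulVg : forall x, gmul (ginv x) x = gone }.

(* The carrier of T^G (points represented as functions G -> R with values
   in the fundamental domain [0,1) of T = R/Z, see torus_pt below). *)
Definition torus_sp (G : Type) (R : realType) := G -> R.
HB.instance Definition _ G R := gen_eqMixin (torus_sp G R).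
HB.instance Definition _ G R := gen_choiceMixin (torus_sp G R).
HB.instance Definition _ G (R : realType) :=
  isPointed.Build (torus_sp G R) (fun=> 0%R).

Section Defs.
Variables (G : countType) (L : group_law G) (R : realType).

Local Notation gm := (gmul L).
Local Notation gi := (ginv L).

Fixpoint gpown (g : G) (n : nat) : G :=
  if n is n'.+1 then gm g (gpown g n') else gone L.
Definition gpowz (g : G) (z : int) : G :=
  match z with Posz n => gpown g n | Negz n => gi (gpown g n.+1) end.

Definition virtually_cyclic : Prop :=
  exists g : G, exists s : seq G,
    forall x : G, exists2 t, t \in s & exists z : int, x = gm t (gpowz g z).

Definition support (f : G -> int) : set G := [set g | f g != 0%R].
Definition in_group_ring (f : G -> int) : Prop := finite_set (support f).

Definition in_l2 (v : G -> R) : Prop :=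
  (\esum_(g in [set: G]) (((v g) ^+ 2)%:E) < +oo)%E.

Definition gconv (v : G -> R) (f : G -> int) : G -> R := fun g =>
  (\sum_(g' \in [set g' | f (gm (gi g') g) != 0%R]) v g' * (f (gm (gi g') g))%:~R)%R.

(* The torus T = R/Z, represented by the fundamental domain [0,1);
   a point of T^G is a function G -> R with values in [0,1). *)
Definition tfrac (r : R) : R := r - (Num.floor r)%:~R.
Definition torus_pt (x : G -> R) : Prop := forall g, 0 <= x g < 1.
Definition tadd (x y : G -> R) : G -> R := fun g => tfrac (x g + y g).

Definition lambda (g : G) (x : G -> R) : G -> R := fun g' => x (gm (gi g) g').
Definition rho (g : G) (x : G -> R) : G -> R := fun g' => x (gm g' g).
Definition rho_f (f : G -> int) (x : G -> R) : G -> R := fun g' =>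
  tfrac (\sum_(g \in support f) (f g)%:~R * rho g x g')%R.

Definition Xf (f : G -> int) : set (G -> R) :=
  [set x | torus_pt x /\ rho_f f x = (fun=> 0)].

Definition cylinders : set (set (torus_sp G R)) :=
  [set A | exists g (B : set R), measurable B /\ A = (fun x : torus_sp G R => x g) @^-1` B].

Local Notation TorusSpace := (g_sigma_algebraType cylinders).

Definition is_haar_Xf (f : G -> int) (mu : probability TorusSpace R) : Prop :=
  mu (Xf f : set TorusSpace) = 1%E /\
  forall y, Xf f y -> forall A : set TorusSpace, measurable A ->
    mu ((fun x => tadd x y) @^-1` A) = mu A.

Definition ergodic_alpha (f : G -> int) (mu : probability TorusSpace R) : Prop :=
  forall A : set TorusSpace, measurable A -> A `<=` Xf f ->
    (forall g x, Xf f x -> (A (lambda g x) <-> A x)) ->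
    mu A = 0%E \/ mu A = 1%E.

End Defs.

Notation TorusSpace G R := (g_sigma_algebraType (@cylinders G R)).

(* Main.v *)
(* Fourier analysis on X_f reduces ergodicity to the assertion that an element h of
   Z[Gamma] whose class in Z[Gamma]/Z[Gamma]f has a finite Gamma-orbit lies in Z[Gamma]f.
   If Delta is the stabiliser of that class, then (delta - 1) h = c(delta) f defines a
   1-cocycle c : Delta -> Z[Gamma], and it is enough that c is a coboundary on some
   infinite subgroup of Delta.
   - If some finitely generated subgroup of Delta is not virtually cyclic, restrict c to
     it. Injectivity of f on l^2 puts c in the closure of the l^2-coboundaries. A
     potential b of c which is not almost constant yields an almost invariant set whose
     translates are nested; a ping-pong argument on it produces a spectral gap, and with
     a spectral gap that closure consists of coboundaries.
   - If all finitely generated subgroups of Delta are virtually cyclic and Delta has an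
     element t of infinite order, <t> is commensurated and has infinite index, which
     forces the limits of the potential at both ends of every coset to agree.
   - Otherwise Delta is locally finite, the support of f generates a finite group, and f
     divides a nonzero integer. *)
Require Import Defs.
From HB Require Import structures.
From mathcomp Require Import all_boot all_order all_algebra.
From mathcomp Require Import all_classical all_reals all_analysis measurable_realfun.
From mathcomp Require Import ring lra zify.
Set Implicit Arguments. Unset Strict Implicit. Unset Printing Implicit Defensive.
Import Order.TTheory GRing.Theory Num.Theory.
Import numFieldNormedType.Exports.
Local Open Scope classical_set_scope.
Local Open Scope ring_scope.


(** * Sums of finitely supported functions *)

(** Since [f] is only injective on l^2, division by [f] may be unbounded, and the cocycle cannot
    simply be divided. The hypothesis is used by orthogonality instead: the residual left by
    approximating the cocycle with coboundaries is turned into an l^2 vector that [f] annihilates.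
    This gives approximations by coboundaries of finitely supported functions, whose potentials need
    not converge. The spectral gap replaces a structure theory of groups with several ends. Two
    disjoint translates inside [U], together with one translate that covers the group along with
    [U], are incompatible with an invariant mean, and the counting behind this gives an explicit
    inequality. Integrality finishes the argument: a jump of an integer-valued potential has size at
    least 1, which a fixed small error already contradicts. On the measure side, real cosines with a
    phase replace complex characters, and one uniqueness theorem for Fourier coefficients serves
    both the invariance of the measure and ergodicity. *)

Lemma finite_set_seqP (T : choiceType) (A : set T) :
  finite_set A <-> exists2 s : seq T, uniq s & forall x, A x -> x \in s.
Proof.
split=> [/finite_seqP[s ->]|[s _ sA]].
  by exists (undup s); [exact: undup_uniq|move=> x /=; rewrite mem_undup].
by apply: (@sub_finite_set _ _ [set` s]) => // x /sA.
Qed.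

Lemma infinite_avoid (T : Type) (A B : set T) :
  infinite_set A -> finite_set B -> exists2 x, A x & ~ B x.
Proof.
move=> Ainf Bfin; apply: contrapT => nex; apply: Ainf.
apply: sub_finite_set Bfin => x Ax.
by apply: contrapT => Bx; apply: nex; exists x.
Qed.

Definition fsupp (T : choiceType) (V : nmodType) (F : T -> V) :=
  finite_set [set x | F x != 0].

Notation fsum F := (\sum_(x \in [set: _]) F x).

Section FiniteSupport.
Variables (T : choiceType) (V : nzRingType).
Implicit Types F G : T -> V.

Lemma fsuppP F : fsupp F <-> exists2 s : seq T, uniq s & forall x, x \notin s -> F x = 0.
Proof.
rewrite /fsupp finite_set_seqP; split=> -[s us sF]; exists s => // x.
  by move=> xs; apply/eqP; apply: contraNT xs => /sF.
by apply: contraNT => /sF ->.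
Qed.

Lemma fsuppS (W : nmodType) F (H : T -> W) :
  fsupp F -> (forall x, F x = 0 -> H x = 0) -> fsupp H.
Proof.
move=> fF FH; apply: sub_finite_set fF => x /=.
by apply: contraNN => /eqP /FH ->.
Qed.

Lemma fsuppD F G : fsupp F -> fsupp G -> fsupp (fun x => F x + G x).
Proof.
move=> fF fG; apply: (@sub_finite_set _ _ ([set x | F x != 0] `|` [set x | G x != 0])).
  move=> x /= FG; have [F0|] := eqVneq (F x) 0; last by left.
  by right; move: FG; rewrite F0 add0r.
by rewrite finite_setU.
Qed.

Lemma fsuppB F G : fsupp F -> fsupp G -> fsupp (fun x => F x - G x).
Proof.
move=> fF fG; apply: fsuppD => //.
by apply: fsuppS fG _ => x ->; rewrite oppr0.
Qed.

Lemma fsuppMl F G : fsupp F -> fsupp (fun x => F x * G x).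
Proof. by move=> fF; apply: fsuppS fF _ => x ->; rewrite mul0r. Qed.

Lemma fsuppMr F G : fsupp G -> fsupp (fun x => F x * G x).
Proof. by move=> fF; apply: fsuppS fF _ => x ->; rewrite mulr0. Qed.

Lemma fsupp_comp (T' : choiceType) (p : T' -> T) F :
  injective p -> fsupp F -> fsupp (fun x => F (p x)).
Proof.
move=> pI; apply: (@finite_preimage _ _ [set x | F x != 0] p).
by move=> x y _ _; exact: pI.
Qed.

Lemma fsum_seq F (s : seq T) : uniq s -> (forall x, x \notin s -> F x = 0) ->
  fsum F = \sum_(x <- s) F x.
Proof.
move=> us sF; rewrite (fsbig_seq _ _ us); apply/esym.
apply: fsbig_widen => // x /= [_ /negP xs]; exact: sF.
Qed.

Lemma fsumD F G : fsupp F -> fsupp G ->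
  fsum (fun x => F x + G x) = fsum F + fsum G.
Proof.
move=> /fsuppP[s us sF] /fsuppP[t ut tG].
have ust := undup_uniq (s ++ t).
have H x : x \notin undup (s ++ t) -> F x = 0 /\ G x = 0.
  by rewrite mem_undup mem_cat negb_or => /andP[/sF-> /tG->].
rewrite !(fsum_seq ust) ?big_split// => x /H[]//.
by move=> -> ->; rewrite addr0.
Qed.

Lemma fsumZl a F : fsupp F -> fsum (fun x => a * F x) = a * fsum F.
Proof.
move=> /fsuppP[s us sF]; rewrite !(fsum_seq us)// ?mulr_sumr//.
by move=> x /sF->; rewrite mulr0.
Qed.

Lemma fsumZr a F : fsupp F -> fsum (fun x => F x * a) = fsum F * a.
Proof.
move=> /fsuppP[s us sF]; rewrite !(fsum_seq us)// ?mulr_suml//.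
by move=> x /sF->; rewrite mul0r.
Qed.

Lemma fsumB F G : fsupp F -> fsupp G ->
  fsum (fun x => F x - G x) = fsum F - fsum G.
Proof.
move=> fF fG; rewrite -[- fsum G]mulN1r -fsumZl// -fsumD//.
  by apply: eq_fsbigr => x _; rewrite mulN1r.
exact: fsuppMr.
Qed.

Lemma fsum0 : fsum (fun _ : T => 0 : V) = 0.
Proof. by rewrite fsbig1. Qed.

Lemma eq_fsum F G : (forall x, F x = G x) -> fsum F = fsum G.
Proof. by move=> FG; apply: eq_fsbigr => x _. Qed.

Lemma fsum1 F (x0 : T) : (forall x, x != x0 -> F x = 0) -> fsum F = F x0.
Proof.
move=> F0; rewrite (@fsum_seq _ [:: x0]) ?big_seq1// => x.
by rewrite inE => /F0.
Qed.

Lemma fsum_reindex (T' : choiceType) (p : T' -> T) (q : T -> T') F :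
  cancel p q -> cancel q p -> fsum (fun x => F (p x)) = fsum F.
Proof.
by move=> pK qK; apply/esym/(@reindex_fsbigT _ _ _ _ _ p F)/(Bijective pK qK).
Qed.

End FiniteSupport.

Lemma exchange_fsum (T T' : choiceType) (V : nzRingType) (F : T -> T' -> V) (A : set T) (B : set T') :
  finite_set A -> finite_set B ->
  (forall x y, F x y != 0 -> A x /\ B y) ->
  fsum (fun x => fsum (fun y => F x y)) = fsum (fun y => fsum (fun x => F x y)).
Proof.
move=> /finite_set_seqP[s us sA] /finite_set_seqP[t ut tB] FAB.
have H x y : (x \notin s) || (y \notin t) -> F x y = 0.
  move=> xy; apply/eqP; apply: contraTT xy => /FAB[/sA-> /tB->]//.
rewrite (fsum_seq us); last first.
  by move=> x xs; rewrite fsbig1// => y _; rewrite H// xs.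
rewrite (fsum_seq ut); last first.
  by move=> y yt; rewrite fsbig1// => x _; rewrite H// yt orbT.
rewrite (eq_bigr (fun x => \sum_(y <- t) F x y)); last first.
  by move=> x _; rewrite (fsum_seq ut)// => y yt; rewrite H// yt orbT.
rewrite exchange_big/=; apply: eq_bigr => y _.
by rewrite (fsum_seq us)// => x xs; rewrite H// xs.
Qed.

Lemma fsum_ge0 (T : choiceType) (R : numDomainType) (F : T -> R) :
  (forall x, 0 <= F x) -> 0 <= fsum F.
Proof. by move=> F0; apply: fsumr_ge0. Qed.

Lemma ler_fsum (T : choiceType) (R : numDomainType) (F G : T -> R) :
  fsupp F -> fsupp G -> (forall x, F x <= G x) -> fsum F <= fsum G.
Proof.
move=> fF fG FG; rewrite -subr_ge0 -fsumB//.
by apply: fsum_ge0 => x; rewrite subr_ge0.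
Qed.

Lemma ler_sum_fsum (T : choiceType) (R : numDomainType) (F : T -> R) (s : seq T) :
  uniq s -> fsupp F -> (forall x, 0 <= F x) -> \sum_(x <- s) F x <= fsum F.
Proof.
move=> us fF F0.
pose G x := if x \in s then F x else 0.
have fG : fsupp G by apply: fsuppS fF _ => x; rewrite /G => ->; rewrite if_same.
have -> : \sum_(x <- s) F x = fsum G.
  rewrite (fsum_seq us); last by move=> x /negPf; rewrite /G => ->.
  by rewrite big_seq [RHS]big_seq; apply: eq_bigr => x; rewrite /G => ->.
by apply: ler_fsum => // x; rewrite /G; case: ifP.
Qed.

(** * Almost invariant sets in finitely generated groups *)

Local Open Scope group_scope.

Definition almost_invariant (K : groupType) (U : K -> bool) :=
  forall g, finite_set [set x | U (x * g) != U x].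

Definition generates (K : groupType) (S : seq K) :=
  forall Y : set K, (exists x, Y x) ->
    (forall x s, Y x -> s \in S -> Y (x * s)) -> forall x, Y x.

(** These are the [g] whose translate of [U] separates [x] from [y]. In the variable [z = g^-1 * x]
    the condition says that [U] changes between [z] and [z * (x^-1 * y)]. *)
Lemma finite_separating (K : groupType) (U : K -> bool) x y :
  almost_invariant U -> finite_set [set g | U (g^-1 * x) != U (g^-1 * y)].
Proof.
move=> aU; rewrite (_ : [set g | _] =
    (fun g => g^-1 * x) @^-1` [set z | U (z * (x^-1 * y)) != U z]).
  by apply: finite_preimage => [g h _ _ /mulIg /invg_inj|].
by apply/seteqP; split=> g /=; rewrite mulgA mulgK eq_sym.
Qed.

(* Off the finite set [X], one of the translates of [U] and its complement by [g] is
   contained in [U] or in its complement; which of the four inclusions holds is read off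
   from whether [g] and [g^-1] lie in [U]. *)
Definition nested_off (K : groupType) (U : K -> bool) (X : set K) :=
  [/\ finite_set X, forall g, X g -> X g^-1 &
      forall g, ~ X g -> forall x, U (g^-1 * x) = U g^-1 \/ U x = U g].

Section Balls.
Variables (K : groupType) (S : seq K).

Fixpoint ball n : seq K :=
  if n is n'.+1 then ball n' ++ [seq x * s | x <- ball n', s <- S] else [:: 1].

Lemma ball_subS n x : x \in ball n -> x \in ball n.+1.
Proof. by rewrite /= mem_cat => ->. Qed.

Lemma ball_sub m n x : (m <= n)%N -> x \in ball m -> x \in ball n.
Proof.
by move=> /subnK <-; elim: (n - m)%N => //= k IH /IH; apply: ball_subS.
Qed.

Lemma ball_mul n x s : x \in ball n -> s \in S -> x * s \in ball n.+1.
Proof.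
by move=> xn sS /=; rewrite mem_cat; apply/orP; right; apply/allpairsP; exists (x, s).
Qed.

Lemma ball_cover (A : set K) : generates S -> finite_set A ->
  exists n, forall x, A x -> x \in ball n.
Proof.
move=> genS /finite_set_seqP[s _ sA].
have all_ball x : exists n, x \in ball n.
  apply: (genS [set x | exists n, x \in ball n]).
    by exists 1, 0%N; rewrite /= inE.
  by move=> y t [n yn] tS; exists n.+1; apply: ball_mul.
suff [n ns] : exists n, {subset s <= ball n} by exists n => x /sA /ns.
elim: s {sA} => [|x s [n ns]]; first by exists 0%N.
have [m xm] := all_ball x; exists (maxn m n) => y.
rewrite inE => /orP[/eqP->|/ns]; apply: ball_sub; lia.
Qed.

Lemma ball_same_side (U : K -> bool) g n :
  (forall e s, e \in ball n -> s \in S -> U (g * e * s) = U (g * e)) ->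
  forall e, e \in ball n -> U (g * e) = U g.
Proof.
elim: n => [|n IH] H e; first by rewrite inE => /eqP->; rewrite mulg1.
rewrite /= mem_cat => /orP[|/allpairsP[[x s] /= [xn sS ->]]].
  by apply: IH => x s xn; apply: H; apply: ball_subS.
rewrite mulgA H//; last exact: ball_subS.
by apply: IH xn => x' s' xn'; apply: H; apply: ball_subS.
Qed.

(** The boundary of [U] is finite, so it lies in a ball. If [g] is far away, the ball around [g]
    misses this boundary, so [U] is constant there, and likewise for [g^-1]. Boundaries of [U] and
    of its translate by [g] are then too far apart to cross. *)
Lemma ex_nested_off (U : K -> bool) : generates S -> almost_invariant U ->
  exists X, nested_off U X.
Proof.
move=> genS aU.
pose B := [set x | exists2 s, s \in S & U (x * s) != U x].
have finB : finite_set B.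
  have -> : B = \bigcup_(s in [set` S]) [set x | U (x * s) != U x].
    by apply/seteqP; split=> [x [s sS sU]|x [s sS sU]]; exists s.
  by apply: bigcup_finite => // s _; exact: aU.
have [n Bn] := ball_cover genS finB.
pose E := [set` ball n].
pose X0 := \bigcup_(e in E) [set g | B (g * e)].
have finX0 : finite_set X0.
  apply: bigcup_finite; first exact: finite_seq.
  by move=> e _; apply: (@finite_preimage _ _ B) => // x y _ _; apply: mulIg.
pose X : set K := X0 `|` ((fun g : K => g^-1) @` X0).
exists X; split.
- by rewrite finite_setU; split => //; exact: finite_image.
- move=> g [gX|[h hX <-]]; last by left; rewrite invgK.
  by right; exists g.
have side g : ~ X0 g -> forall e, e \in ball n -> U (g * e) = U g.
  move=> gX; apply: ball_same_side => e s en sS; apply: contrapT => Us.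
  by apply: gX; exists e => //; exists s => //; apply/eqP.
move=> g gX x.
have gX0 : ~ X0 g by move=> h; apply: gX; left.
have gVX0 : ~ X0 g^-1 by move=> h; apply: gX; right; exists g^-1 => //; rewrite invgK.
apply: contrapT => /not_orP[Ugx Ux].
(* A generator step out of [Y] would cross one of the two boundaries, near which the other condition
   of [Y] or its own fails by [side]. So a nonempty [Y] is the whole group, although it misses
   [g]. *)
pose Y := [set x | U (g^-1 * x) <> U g^-1 /\ U x <> U g].
have := genS Y (ex_intro _ x (conj Ugx Ux)) _ g.
suff H : forall x s, Y x -> s \in S -> Y (x * s) by move=> /(_ H) [].
move=> y s [Ugy Uy] sS; split.
  have [->//|neq] := eqVneq (U (g^-1 * (y * s))) (U (g^-1 * y)).
  have : g^-1 * y \in ball n by apply: Bn; exists s; rewrite // -mulgA.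
  by move=> /(side g gX0); rewrite mulVKg.
have [->//|neq] := eqVneq (U (y * s)) (U y).
have : y \in ball n by apply: Bn; exists s.
by move=> /(side _ gVX0).
Qed.

End Balls.

Definition vcyclic (K : groupType) := exists (c : K) (D : set K),
  finite_set D /\ forall x, exists m n d, D d /\ x = c ^- m * c ^+ n * d.

(** An invariant mean would give [U] mass 0 here, because two disjoint translates fit into [U];
    [covering] would give it mass at least 1/2. Together they express a paradoxical
    decomposition. *)
Definition paired (K : groupType) (U : K -> bool) := exists g1 g2 : K, forall x,
  [/\ U (g1^-1 * x) -> U x, U (g2^-1 * x) -> U x &
      ~ (U (g1^-1 * x) /\ U (g2^-1 * x))].

Definition covering (K : groupType) (U : K -> bool) :=
  exists g : K, forall x, U (g^-1 * x) \/ U x.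

Section Translation.
Variables (K : groupType) (U : K -> bool) (X : set K).
Hypotheses (aU : almost_invariant U) (nX : nested_off U X).
Hypotheses (Uinf : infinite_set [set x | U x]) (Ucinf : infinite_set [set x | ~~ U x]).

(** For such a [c], nestedness says that [c] maps [U] into itself. If [g1] and its inverse lie in
    [U], while [g2] and its inverse lie outside, then the product [g1 * g2] works: nestedness for
    [g1] puts it in [U], and nestedness for [g2] keeps its inverse out. *)
Lemma ex_translation : exists c, [/\ ~ X c, U c & ~~ U c^-1].
Proof.
have [finX XV N] := nX.
have [g1 /= Ug1 Xg1] := infinite_avoid Uinf finX.
have [Ug1V|] := boolP (U g1^-1); last by exists g1.
have finX' : finite_set (X `|` (fun g => g1 * g) @^-1` X).
  rewrite finite_setU; split => //; apply: finite_preimage => //.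
  by move=> x y _ _; apply: mulgI.
have [g2 /= Ug2 /not_orP[Xg2 Xg12]] := infinite_avoid Ucinf finX'.
have [Ug2V|Ug2V] := boolP (U g2^-1).
  by exists g2^-1; rewrite invgK; split => // /XV; rewrite invgK.
exists (g1 * g2); split => //.
  have := N _ Xg1 (g1 * g2); rewrite mulKg Ug1V Ug1 (negbTE Ug2).
  by case.
have := N _ Xg2 g1^-1; rewrite -invgM (negbTE Ug2) (negbTE Ug2V) Ug1V.
by case=> // ->.
Qed.

End Translation.

Section Axis.
Variables (K : groupType) (U : K -> bool) (c : K).
Hypothesis aU : almost_invariant U.
Hypotheses (Uc : U c) (UcV : ~~ U c^-1).
Hypothesis cU : forall x, U (c^-1 * x) -> U x.

Lemma axis_sub m n x : (m <= n)%N -> U (c ^- n * x) -> U (c ^- m * x).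
Proof.
move=> /subnK <-; elim: (n - m)%N => //= k IH.
by rewrite addSn expgSr invgM -mulgA => /cU.
Qed.

Lemma axis_strict : exists2 x, U x & ~~ U (c^-1 * x).
Proof.
have [U1|U1] := boolP (U 1); first by exists 1 => //; rewrite mulg1.
by exists c => //; rewrite mulVg.
Qed.

Lemma axis_inj : injective (fun n => c ^+ n).
Proof.
have [x Ux Ucx] := axis_strict.
have lt m n : (m < n)%N -> c ^+ m <> c ^+ n.
  move=> mn E; have Un : U (c ^- n * (c ^+ m * x)) by rewrite -E mulKg.
  by have := axis_sub mn Un; rewrite expgSr invgM -mulgA mulKg; apply/negP.
move=> m n E; have [/lt//|/lt H|//] := ltngtP m n.
by have := H (esym E).
Qed.

(** Otherwise all the translates of [U] by the distinct powers [c ^+ n] contain [x]. None of them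
    contains [c^-1], so infinitely many translates would separate these two points. *)
Lemma axis_leaves x : exists n, ~~ U (c ^- n * x).
Proof.
apply: contrapT => /forallNP H.
have Ux n : U (c ^- n * x) by apply/negPn/negP/H.
have Uy n : ~~ U (c ^- n * c^-1).
  rewrite -invgM -expgS; apply: contra UcV => Un.
  by have := @axis_sub 1 n.+1 1 isT; rewrite !mulg1; apply.
suff : finite_set [set: nat] by exact: infinite_nat.
have := finite_separating x c^-1 aU.
move=> /(@finite_preimage _ _ _ (fun n => c ^+ n)) fin.
apply: sub_finite_set (fin (fun m n _ _ => @axis_inj m n)) => n _ /=.
by rewrite Ux (negbTE (Uy n)).
Qed.



(** The difference of [U] and its translate by [c] is a fundamental domain for the powers of [c]:
    move [x] into [U], then move it forward until just before it leaves [U]. *)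
Lemma vcyclic_axis :
  (forall x, exists n, U (c ^+ n * x)) ->
  finite_set [set x | U x && ~~ U (c^-1 * x)] -> vcyclic K.
Proof.
move=> enters finD; exists c, [set x | U x && ~~ U (c^-1 * x)]; split=> // x.
have [m Um] := enters x.
have [] := ex_minnP (axis_leaves (c ^+ m * x)); case=> [|n].
  by rewrite invg1 mul1g Um.
move=> Un minn; exists m, n, (c ^- n * (c ^+ m * x)); split; last first.
  by rewrite mulgA mulgK mulKg.
apply/andP; split; last by rewrite mulgA -invgM -expgSr.
by apply/negPn/negP => /minn; rewrite ltnn.
Qed.

End Axis.

Lemma nested_offC (K : groupType) (U : K -> bool) X :
  nested_off U X -> nested_off (fun x => ~~ U x) X.
Proof.
move=> [fX XV N]; split=> // g gX x.
by case: (N g gX x) => ->; [left|right].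
Qed.

Lemma almost_invariantC (K : groupType) (U : K -> bool) :
  almost_invariant U -> almost_invariant (fun x => ~~ U x).
Proof.
move=> aU g; rewrite (_ : [set x | _] = [set x | U (x * g) != U x]) //.
by apply/seteqP; split=> x /=; case: (U x); case: (U (x * g)).
Qed.

(** If the difference of [U] and [c U] is infinite, it contains an element [g] far from everything
    relevant. The translate [g U], or its complement, then fits between [c U] and [U], which yields
    the second of two disjoint translates. *)
Lemma paired_or_vcyclic (K : groupType) (U : K -> bool) (X : set K) :
  almost_invariant U -> nested_off U X ->
  infinite_set [set x | U x] -> infinite_set [set x | ~~ U x] ->
  [\/ vcyclic K, paired U | paired (fun x => ~~ U x)].
Proof.
move=> aU nX Uinf Ucinf.
have [finX XV N] := nX.
have [c [Xc Uc UcV]] := ex_translation nX Uinf Ucinf.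
have cU x : U (c^-1 * x) -> U x.
  by have [->|->//] := N _ Xc x; rewrite (negbTE UcV).
have [finD|infD] := pselect (finite_set [set x | U x && ~~ U (c^-1 * x)]).
  apply: Or31; apply: (vcyclic_axis aU Uc UcV cU) finD => x.
  have [||||n] := @axis_leaves K (fun x => ~~ U x) c^-1 _ _ _ _ x.
  - exact: almost_invariantC.
  - exact: UcV.
  - by rewrite invgK Uc.
  - by move=> y; rewrite invgK; apply: contra => Uy; apply: cU; rewrite mulKg.
  by rewrite negbK -expVgn invgK => Un; exists n.
have [x0 Ux0 Ucx0] := axis_strict Uc UcV.
(* Avoiding this set makes both [g] and [c^-1 * g] nested, and keeps [g U] from separating [c * c]
   and [c^-1]. The last condition reconciles the two nestings in [E]. *)
have finX' : finite_set (X `|` (fun g => c^-1 * g) @^-1` X `|`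
   [set g | U (g^-1 * (c * c)) != U (g^-1 * c^-1)]).
  rewrite !finite_setU; split; last exact: finite_separating.
  split => //; apply: finite_preimage => //.
  by move=> x y _ _; apply: mulgI.
have [g /andP[Ug Ucg] /not_orP[/not_orP[Xg Xcg] /negP/negPn/eqP Sg]] :=
  infinite_avoid infD finX'.
have N1 := N _ Xg; have N2 := N _ Xcg.
have E : U g^-1 = U (g^-1 * c).
  have := N1 c^-1; rewrite Ug (negbTE UcV) => -[<-|//].
  have := N2 c; rewrite Uc (negbTE Ucg) invgM invgK => -[<-|//].
  by rewrite -mulgA Sg.
have N2' x : U (g^-1 * x) = U g^-1 \/ ~~ U (c^-1 * x).
  have := N2 (c^-1 * x); rewrite (negbTE Ucg) invgM invgK -mulgA mulVKg -E.
  by case=> [->|->]; [left|right].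
(* If [g^-1] is in [U], the complement of [g U] lies in [U] and avoids [c U]; shifting by [c^-1]
   gives disjoint translates of the complement of [U]. Otherwise [g U] itself lies in [U] and avoids
   [c U]. *)
case UgV: (U g^-1); rewrite UgV in N1 N2'.
  apply: Or33; exists c^-1, (c^-1 * g) => x; rewrite invgK; split.
  - by apply: contra => Ux; apply: cU; rewrite mulKg.
  - rewrite invgM invgK => Ugx; apply/negP => Ux.
    by have := N2' (c * x); rewrite mulKg mulgA (negbTE Ugx) Ux => -[].
  rewrite invgM invgK => -[/negbTE Ucx Ugx].
  by have := N1 (c * x); rewrite mulgA (negbTE Ugx) Ucx Ug => -[].
apply: Or32; exists c, g => x; split.
- exact: cU.
- by have := N1 x; rewrite Ug => -[->|->].
- by case=> Ucx Ugx; have := N2' x; rewrite Ugx Ucx => -[].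
Qed.

Local Open Scope ring_scope.

(** * Drift and translates that cover the group *)

Section Drift.
Variables (K : groupType) (U : K -> bool).
Hypothesis aU : almost_invariant U.

Let sep (p q x : K) : int := (U (x^-1 * p)%g)%:R - (U (x^-1 * q)%g)%:R.

Let fsupp_sep p q : fsupp (sep p q).
Proof.
apply: sub_finite_set (finite_separating p q aU) => x /=.
by apply: contra => /eqP E; rewrite /sep E subrr.
Qed.

(* The cocycle [g |-> 1_(g U^-1) - 1_(U^-1)] has finitely supported values; its
   augmentation is a homomorphism to the integers. *)
Definition drift (g : K) : int :=
  fsum (fun x : K => (U (x^-1 * g)%g)%:R - (U (x^-1 * 1)%g)%:R : int).

Lemma drift_sep p q : fsum (sep p q) = drift p - drift q.
Proof.
rewrite -fsumB; [|exact: fsupp_sep..].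
by apply: eq_fsum => x; rewrite /sep; lia.
Qed.

Lemma driftM g h : drift (g * h)%g = drift g + drift h.
Proof.
have -> : drift h = fsum (sep (g * h)%g g).
  rewrite -(@fsum_reindex _ _ _ (fun x => g * x)%g (fun x => g^-1 * x)%g).
  - apply: eq_fsum => x; rewrite /sep invgM -!mulgA mulKg mulVg.
    by rewrite mulg1.
  - by move=> x; rewrite mulKg.
  - by move=> x; rewrite mulVKg.
by rewrite drift_sep; lia.
Qed.

Lemma drift1 : drift 1%g = 0.
Proof. by have := driftM 1 1; rewrite mulg1; lia. Qed.

Lemma driftV g : drift g^-1%g = - drift g.
Proof. by have := driftM g g^-1%g; rewrite mulgV drift1; lia. Qed.

Lemma driftX g n : drift (g ^+ n)%g = drift g *+ n.
Proof.
by elim: n => [|n IH]; [exact: drift1|rewrite expgS driftM IH mulrS].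
Qed.

(* [k ^+ n] crosses the nested translates [k ^+ j U], [j <= n], always in the same
   direction, so the drift of [k ^+ n] grows linearly. *)
Lemma drift_gt0 (X : set K) k : nested_off U X ->
  (forall g, ~ X g -> ~~ (U g && U g^-1%g)) ->
  ~ X k -> U k -> ~~ U k^-1%g -> 0 < drift k.
Proof.
move=> [finX XV N] lam Xk Uk UkV.
have kU x : U (k^-1 * x)%g -> U x.
  by have [->|->//] := N _ Xk x; rewrite (negbTE UkV).
have [a Ua _] := axis_strict Uk UkV.
pose y := k^-1%g.
have Uy n : ~~ U (k ^- n * y)%g.
  apply: contra UkV => Un; have := axis_sub kU (leq0n n) Un.
  by rewrite expg0 invg1 mul1g.
have finC : finite_set (X `|` [set g | U (g^-1 * y)%g != U (g^-1 * a)%g]).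
  by rewrite finite_setU; split => //; exact: finite_separating.
have /finite_set_seqP[s us sC] := finC.
rewrite ltNge; apply/negP => dk.
(* Crossing [n.+1] translates with at most [size s] exceptions forces a drift of at least
   [n.+1 - size s], which exceeds what the end points [a] and [y] contribute when [drift k <= 0]. *)
pose n := (size s + `|drift a| + `|drift y|)%N.
pose P := [seq (k ^+ j)%g | j <- iota 0 n.+1].
have uP : uniq P by rewrite map_inj_uniq ?iota_uniq//; exact: axis_inj Uk UkV kU.
pose ka := (k ^+ n * a)%g.
(* Translates by the powers in [P] contain [ka] and not [y]. A translate crossed in the opposite
   direction contains [y] and not [ka]; nestedness, with [lam], confines it to the exceptional set
   [s]. *)
have lb x : (x \in P)%:R - (x \in s)%:R <= sep ka y x.
  have [/mapP[j]|xP] := boolP (x \in P).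
    rewrite mem_iota => jn ->.
    rewrite /sep (negbTE (Uy j)) /ka (_ : n = j + (n - j))%N; last by lia.
    rewrite expgnDr -mulgA mulKg.
    have -> : U (k ^+ (n - j) * a)%g.
      have /(_ ((k ^+ (n - j) * a)%g)) := axis_sub kU (leq0n (n - j)).
      by rewrite mulKg expg0 invg1 mul1g; apply.
    case: (x \in s); rewrite ?subr0 ?subrr; lia.
  have [xs|xs] := boolP (x \in s); first by rewrite /sep; case: (U _); case: (U _).
  suff : U (x^-1 * y)%g -> U (x^-1 * ka)%g by rewrite /sep; case: (U _) => [->|_]//; case: (U _).
  move=> Uxy; apply: contraNT xs => Uxka; apply: sC.
  apply: contrapT => /not_orP[Xx /negP/negPn/eqP Sx].
  have := N _ Xx y; rewrite (negbTE UkV) Uxy.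
  case UxV: (U x^-1%g); [move=> _|case=> // Ux].
    move: (lam _ Xx); rewrite UxV andbT => Ux.
    have Uka : U ka.
      have /(_ ka) := axis_sub kU (leq0n n).
      by rewrite {1}/ka mulKg expg0 invg1 mul1g; apply.
    have := N _ Xx ka; rewrite UxV Uka (negbTE Uxka) => -[]// E.
    by rewrite -E in Ux.
  by have := N _ Xx a; rewrite -Sx Uxy UxV Ua -Ux => -[].
have fin_in (t : seq K) : fsupp (fun x => (x \in t)%:R : int).
  apply: (@sub_finite_set _ _ [set` t]) => // z /=.
  by case: (z \in t).
have sum_in (t : seq K) : uniq t -> fsum (fun x => (x \in t)%:R : int) = (size t)%:R.
  move=> ut; rewrite (fsum_seq ut); last by move=> x /negbTE ->.
  rewrite big_seq (eq_bigr (fun=> 1)); last by move=> x ->.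
  by rewrite -big_seq big_const_seq count_predT iter_addr addr0.
have := ler_fsum (fsuppB (fin_in P) (fin_in s)) (fsupp_sep ka y) lb.
rewrite fsumB// !sum_in// drift_sep size_map size_iota driftM driftX.
have : drift k *+ n <= 0 by rewrite mulrn_wle0.
have : n%:Z = (size s)%:Z + `|drift a|%:Z + `|drift y|%:Z by rewrite /n !PoszD.
rewrite !natz intS => ->.
have [d ->] : {d : int | drift k *+ n = d} by eexists.
have [da ->] : {d : int | drift a = d} by eexists.
have [dy ->] : {d : int | drift y = d} by eexists.
by move: (size s) => m; clear; lia.
Qed.

(** A nested [g] with both [g] and [g^-1] in [U] already gives a covering. If there is none,
    elements of drift 0 must lie in the finite set [X], but the free semigroup generated by the two
    translations of [paired] provides too many of them. *)
Lemma ex_covering (X : set K) : nested_off U X ->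
  infinite_set [set x | U x] -> paired U -> covering U.
Proof.
move=> nX Uinf [g1 [g2 P]].
have [finX XV N] := nX.
have [[g [Xg Ug UgV]]|nex] := pselect (exists g, [/\ ~ X g, U g & U g^-1%g]).
  by exists g => x; have := N _ Xg x; rewrite Ug UgV.
exfalso.
have lam g : ~ X g -> ~~ (U g && U g^-1%g).
  by move=> Xg; apply/negP => /andP[Ug UgV]; apply: nex; exists g.
have [a /= Ua _] := infinite_avoid Uinf (finite_set0 K).
have g1U x : U x -> U (g1 * x)%g by case: (P (g1 * x)%g) => + _ _; rewrite mulKg.
have g2U x : U x -> U (g2 * x)%g by case: (P (g2 * x)%g) => _ + _; rewrite mulKg.
have g1nU n x : U x -> U (g1 ^+ n * x)%g.
  by elim: n x => [|n IH] x Ux; rewrite ?mul1g// expgS -mulgA; apply/g1U/IH.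
have /finite_set_seqP[s us sX] := finX.
pose n := size s.
(* Words with the same letters have the same drift, so the quotients [w j / w 0] have
   drift 0; by [drift_gt0] they are confined to [X]. *)
pose w i := (g1 ^+ i * g2 * g1 ^+ (n - i))%g.
have wU i x : U x -> U (w i * x)%g.
  by move=> Ux; rewrite /w -!mulgA; apply/g1nU/g2U/g1nU.
have drift_w i : (i <= n)%N -> drift (w i) = drift g1 *+ n + drift g2.
  move=> ile; rewrite /w !driftM !driftX addrAC -mulrnDr subnKC//.
(* After cancelling [g1 ^+ i], one word starts with [g2] and the other with [g1], so they send [a]
   into disjoint translates of [U]. *)
have w_lt i j : (i < j <= n)%N -> w i <> w j.
  move=> /andP[ij jn]; rewrite /w -{1}(subnKC ij) addSnnS expgnDr -!mulgA.
  move=> /mulgI E.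
  have [_ _ +] := P (g2 * (g1 ^+ (n - i) * a))%g; apply; split; last first.
    by rewrite mulKg; apply: g1nU.
  rewrite (mulgA g2) E expgS -!mulgA mulKg; apply/g1nU/g2U.
  exact: g1nU.
have w_inj : {in iota 0 n.+1 &, injective w}.
  move=> i j; rewrite !mem_iota /= !add0n !ltnS => ile jle E.
  have [lt|lt|//] := ltngtP i j.
    by case: (@w_lt i j) => //; rewrite lt.
  by case: (@w_lt j i) => //; rewrite lt.
have wX j : (j <= n)%N -> X (w j * (w 0%N)^-1)%g.
  move=> jn; set k := (_ * _)%g; apply: contrapT => Xk.
  have dk : drift k = 0 by rewrite /k driftM driftV !drift_w// subrr.
  have Xk' : ~ X k^-1%g by move=> /XV; rewrite invgK.
  have := lam _ Xk; case Uk: (U k); case UkV: (U k^-1%g) => // _.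
  - by have := drift_gt0 nX lam Xk Uk; rewrite dk UkV => /(_ isT).
  - by have := drift_gt0 nX lam Xk' UkV; rewrite driftV dk invgK Uk => /(_ isT).
  have := N _ Xk (w j * a)%g; rewrite Uk UkV wU//.
  by rewrite /k invgM invgK -mulgA mulKg wU// => -[].
have : (n.+1 <= size s)%N.
  rewrite -(size_iota 0 n.+1) -(size_map (fun j => w j * (w 0%N)^-1)%g).
  apply: uniq_leq_size.
    rewrite map_inj_in_uniq ?iota_uniq// => i j iin jin /mulIg; exact: w_inj.
  by move=> x /mapP[j]; rewrite mem_iota /= => jn ->; apply/sX/wX; lia.
by rewrite ltnn.
Qed.

End Drift.

(** * Approximation by finitely supported functions *)

(** Translation [h (g * x)] is a right action of the group on functions, which accounts for the
    order of factors in the cocycle identity [c (s * t) x = c s (t * x) + c t x] below. *)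
Definition gdiff (K : groupType) (V : zmodType) (g : K) (h : K -> V) (x : K) : V :=
  h (g * x)%g - h x.

Lemma fsupp_gdiff (K : groupType) (V : nzRingType) (g : K) (h : K -> V) :
  fsupp h -> fsupp (gdiff g h).
Proof. by move=> fh; apply: fsuppB => //; apply: fsupp_comp fh; exact: mulgI. Qed.

Definition sqnorm (T : choiceType) (R : nzRingType) (u : T -> R) : R :=
  fsum (fun x => u x ^+ 2).

Lemma fsupp_sqr (T : choiceType) (R : nzRingType) (u : T -> R) :
  fsupp u -> fsupp (fun x => u x ^+ 2).
Proof. by move=> fu; apply: fsuppS fu _ => x ->; rewrite expr0n. Qed.

(** * Spectral gap and integer potentials *)

Section Gap.
Variables (K : groupType) (R : realFieldType) (U : K -> bool).

(** Let [m] weigh sets by [u ^+ 2]. Pairing gives [m U <= 10 (d g1 + d g2) + N / 5], and covering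
    gives [N <= 2 m U + 10 d g3 + N / 10]. Altogether half of [N] is absorbed, which leaves the
    constant 40. *)
Lemma paired_covering_gap : paired U -> covering U ->
  exists g1 g2 g3 : K, forall u : K -> R, fsupp u ->
  sqnorm u <= 40 * (sqnorm (gdiff g1 u) + sqnorm (gdiff g2 u) + sqnorm (gdiff g3 u)).
Proof.
move=> [g1 [g2 P]] [g3 C]; exists g1, g2, g3 => u fu.
have fu2 := fsupp_sqr fu.
pose m (A : K -> bool) := fsum (fun x => (A x)%:R * u x ^+ 2).
pose N := sqnorm u; pose d g := sqnorm (gdiff g u).
have trans g (F : K -> R) : fsum (fun x => F (g * x)%g) = fsum F.
  apply: (@fsum_reindex _ _ _ _ (fun x => g^-1 * x)%g) => x; first by rewrite mulKg.
  by rewrite mulVKg.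
have fug g : fsupp (fun x => u (g * x)%g) by apply: fsupp_comp fu; exact: mulgI.
(* Pointwise, with p and q the values of [u] at [g * x] and [x], |p^2 - q^2| is at most 10 (p - q)^2
   + (p + q)^2 / 40, and the last term is at most (p^2 + q^2) / 20. *)
have move_m g : `|m (fun x => U (g^-1 * x)%g) - m U| <= 10 * d g + N / 10.
  have -> : m (fun x => U (g^-1 * x)%g) = fsum (fun x => (U x)%:R * u (g * x)%g ^+ 2).
    by rewrite /m -(trans g); apply: eq_fsum => x; rewrite mulKg.
  have f1 : fsupp (fun x => (U x)%:R * u (g * x)%g ^+ 2).
    by apply: fsuppMr; exact: fsupp_sqr.
  have f2 : fsupp (fun x => (U x)%:R * u x ^+ 2) by exact: fsuppMr.
  have f3 : fsupp (fun x => 10 * gdiff g u x ^+ 2).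
    by apply/fsuppMr/fsupp_sqr/fsupp_gdiff.
  have f4 : fsupp (fun x => (u (g * x)%g ^+ 2 + u x ^+ 2) * 20^-1).
    by apply: fsuppMl; apply: fsuppD => //; exact: fsupp_sqr.
  have -> : 10 * d g + N / 10 =
      fsum (fun x => 10 * gdiff g u x ^+ 2 + (u (g * x)%g ^+ 2 + u x ^+ 2) * 20^-1).
    rewrite fsumD// fsumZl; last exact/fsupp_sqr/fsupp_gdiff.
    rewrite fsumZr; last by apply: fsuppD => //; exact: fsupp_sqr.
    rewrite fsumD//; last exact: fsupp_sqr.
    rewrite (trans g (fun x => u x ^+ 2)) -/(sqnorm u) -/N /d /sqnorm.
    by lra.
  rewrite -fsumB//.
  have pt x : `|(U x)%:R * u (g * x)%g ^+ 2 - (U x)%:R * u x ^+ 2| <=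
     10 * gdiff g u x ^+ 2 + (u (g * x)%g ^+ 2 + u x ^+ 2) * 20^-1.
    rewrite /gdiff; move: (u (g * x)%g) (u x) => p q.
    have := sqr_ge0 (p - q - (p + q) / 20); have := sqr_ge0 (p - q + (p + q) / 20).
    have := sqr_ge0 (p - q); have := sqr_ge0 p; have := sqr_ge0 q.
    rewrite ler_norml; case: (U x); rewrite ?mul1r ?mul0r => *; apply/andP; split; lra.
  rewrite ler_norml; apply/andP; split.
    rewrite -subr_ge0 opprK -fsumD; [|exact: fsuppB|exact: fsuppD].
    by apply: fsum_ge0 => x; have := pt x; rewrite ler_norml => /andP[]; lra.
  apply: ler_fsum; [exact: fsuppB|exact: fsuppD|move=> x].
  by have := pt x; rewrite ler_norml => /andP[].
have fm A : fsupp (fun x => (A x)%:R * u x ^+ 2) by exact: fsuppMr.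
have le1 : m (fun x => U (g1^-1 * x)%g) + m (fun x => U (g2^-1 * x)%g) <= m U.
  rewrite -fsumD//; apply: ler_fsum => //; first exact: fsuppD.
  move=> x; have := sqr_ge0 (u x); case: (P x).
  by case: (U (g1^-1 * x)%g); case: (U (g2^-1 * x)%g); case: (U x) => + + + u2 //=;
    rewrite ?mul1r ?mul0r ?addr0 ?add0r//; try (by move/(_ isT)); try (by move=> _ /(_ isT));
    move=> _ _ [].
have le2 : N <= m (fun x => U (g3^-1 * x)%g) + m U.
  rewrite -fsumD//; apply: ler_fsum => //; first exact: fsuppD.
  move=> x; have := sqr_ge0 (u x).
  by case: (C x) => ->; case: (U _); rewrite ?mul1r ?mul0r => *; lra.
have := move_m g1; have := move_m g2; have := move_m g3.
rewrite !ler_norml -/N -!/(d _).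
have d3 : 0 <= d g3 by apply: fsum_ge0 => x; exact: sqr_ge0.
by move=> /andP[? ?] /andP[? ?] /andP[? ?]; lra.
Qed.

End Gap.

(** A level set of a potential that is not almost constant is almost invariant and yields a spectral
    gap. By the gap, approximate potentials [u] are determined up to a small l^2 error, hence nearly
    0 far out, and cannot reproduce an integer jump of [b] there. *)
Lemma dirichlet_const (K : groupType) (R : realFieldType) (S : seq K) (b : K -> int) :
  generates S -> infinite_set [set: K] -> ~ vcyclic K ->
  (forall g, fsupp (gdiff g b)) ->
  (forall (gs : seq K) (e : R), 0 < e -> exists2 u : K -> R, fsupp u &
     forall g, g \in gs -> sqnorm (fun x => (gdiff g b x)%:~R - gdiff g u x) < e) ->
  exists L, finite_set [set x | b x != L].
Proof.
move=> genS Kinf nvc fb app; apply: contrapT => /forallNP nconst.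
(* These are the values that [b] takes where it changes along a generator. Any other value would
   propagate to the whole group, so if all level sets were finite, [K] would be finite. *)
have finS : finite_set (\bigcup_(s in [set` S]) (b @` [set x | gdiff s^-1%g b x != 0])).
  by apply: bigcup_finite => // s _; apply: finite_image; exact: fb.
have [v vinf] : exists v, infinite_set [set x | b x = v].
  apply: contrapT => /forallNP fin; apply: Kinf.
  apply: (@sub_finite_set _ _ (\bigcup_(v in \bigcup_(s in [set` S])
     (b @` [set x | gdiff s^-1%g b x != 0])) [set x | b x = v])).
    move=> x _; exists (b x) => //; apply: contrapT => nb.
    apply: (nconst (b x)).
    suff H y : b y^-1%g = b x.
      by apply: (@sub_finite_set _ _ set0) => // y /=; rewrite -(invgK y) H eqxx.
    apply: (genS [set y | b y^-1%g = b x]); first by exists x^-1%g; rewrite /= invgK.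
    move=> {}y s /= yx sS; rewrite invgM; apply: contrapT => neq.
    apply: nb; exists s => //; exists y^-1%g => //=.
    by rewrite /gdiff subr_eq0; apply/eqP; rewrite yx.
  apply: bigcup_finite => // v _; apply: contrapT; exact: fin.
(* The inverse turns invariance of [b] under left translations into almost invariance under right
   translations. *)
pose U (x : K) := b x^-1%g == v.
have aU : almost_invariant U.
  move=> g; apply: (@sub_finite_set _ _ ((fun x => x^-1%g) @^-1` [set x | gdiff g^-1%g b x != 0])).
    move=> x /=; rewrite /U invgM /gdiff subr_eq0; apply: contra => /eqP ->.
    by [].
  apply: finite_preimage; last exact: fb.
  by move=> x y _ _; apply: invg_inj.
have inv_inf (A : set K) : infinite_set A -> infinite_set ((fun x => x^-1%g) @^-1` A).
  move=> Ainf fin; apply: Ainf.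
  apply: (@sub_finite_set _ _ ((fun x : K => x^-1%g) @` ((fun x => x^-1%g) @^-1` A))).
    by move=> x Ax; exists x^-1%g; rewrite /= ?invgK.
  exact: finite_image.
have Uinf : infinite_set [set x | U x].
  apply: (@sub_infinite_set _ ((fun x => x^-1%g) @^-1` [set x | b x = v])).
    by move=> x /= /eqP.
  exact: inv_inf.
have Ucinf : infinite_set [set x | ~~ U x].
  by apply: (inv_inf [set x | b x != v]) => fin; exact: (nconst v).
have [X nX] := ex_nested_off genS aU.
have [g1 [g2 [g3 gap]]] : exists g1 g2 g3 : K, forall u : K -> R, fsupp u ->
  sqnorm u <= 40 * (sqnorm (gdiff g1 u) + sqnorm (gdiff g2 u) + sqnorm (gdiff g3 u)).
  have [//|pU|pU] := paired_or_vcyclic aU nX Uinf Ucinf.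
    by apply: (paired_covering_gap R pU); exact: (ex_covering aU nX).
  apply: (paired_covering_gap R pU); apply: (ex_covering _ (nested_offC nX)) => //.
  exact: almost_invariantC.
(* The gap bounds the squared norm of [u1 - u2] by 40 times 3 times [4 * e], that is [480 * e], and
   the final contradiction needs [3 * (e + 480 * e + 480 * e) < 1]. *)
pose e : R := 1 / 10000.
have e0 : 0 < e by rewrite /e; lra.
have [u1 fu1 H1] := app [:: g1; g2; g3] e e0.
have vinf' : infinite_set [set x | b x != v] by move=> /nconst.
have [x0 /= bx0 /negP] := infinite_avoid vinf fu1; rewrite negbK => /eqP ux0.
have [y0 /= by0 /negP] := infinite_avoid vinf' fu1; rewrite negbK => /eqP uy0.
(* Translation by [g] carries [x0] to [y0], so [gdiff g b x0] is a nonzero integer. The points were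
   chosen off the support of [u1] before [u2] is taken, so [u2] is small at both. *)
pose g := (y0 * x0^-1)%g.
have [u2 fu2 H2] := app [:: g; g1; g2; g3] e e0.
have fw : fsupp (fun x => u1 x - u2 x) by exact: fsuppB.
have fr (u : K -> R) k : fsupp u -> fsupp (fun x => (gdiff k b x)%:~R - gdiff k u x : R).
  move=> fu; apply: fsuppB; last exact: fsupp_gdiff.
  by apply: fsuppS (fb k) _ => x ->.
have dw k : k \in [:: g1; g2; g3] -> sqnorm (gdiff k (fun x => u1 x - u2 x)) <= 4 * e.
  move=> kin; have := H1 _ kin; have : k \in [:: g; g1; g2; g3] by rewrite inE kin orbT.
  move=> /H2 lt2 lt1; apply: (@le_trans _ _ (2 * (sqnorm (fun x => (gdiff k b x)%:~R - gdiff k u1 x)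
     + sqnorm (fun x => (gdiff k b x)%:~R - gdiff k u2 x)))); last by lra.
  have f1 := fsupp_sqr (fr _ k fu1); have f2 := fsupp_sqr (fr _ k fu2).
  rewrite -fsumD// -fsumZl; last exact: fsuppD.
  apply: ler_fsum; [exact/fsupp_sqr/fsupp_gdiff|by apply: fsuppMr; exact: fsuppD|].
  move=> x; rewrite /gdiff.
  move: (_%:~R) (u1 (k * x)%g) (u1 x) (u2 (k * x)%g) (u2 x) => c p q r s.
  have := sqr_ge0 ((c - (p - q)) + (c - (r - s))); nra.
have := gap _ fw.
have := dw g1; have := dw g2; have := dw g3; rewrite !inE !eqxx ?orbT => /(_ isT) d1 /(_ isT) d2 /(_ isT) d3 le.
have small x : (u1 x - u2 x) ^+ 2 <= 480 * e.
  apply: (@le_trans _ _ (sqnorm (fun x => u1 x - u2 x))); last by lra.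
  have := @ler_sum_fsum _ _ (fun x => (u1 x - u2 x) ^+ 2) [:: x] isT (fsupp_sqr fw).
  by rewrite big_seq1; apply => y; exact: sqr_ge0.
have := H2 g; rewrite inE eqxx => /(_ isT) lt2.
have big : ((gdiff g b x0)%:~R - gdiff g u2 x0) ^+ 2 <= e.
  apply: le_trans (ltW lt2).
  have := @ler_sum_fsum _ _ (fun x => ((gdiff g b x)%:~R - gdiff g u2 x : R) ^+ 2) [:: x0] isT
    (fsupp_sqr (fr _ g fu2)).
  by rewrite big_seq1; apply => y; exact: sqr_ge0.
have sx := small x0; have sy := small y0.
move: big sx sy; rewrite /gdiff /g mulgVK ux0 uy0 bx0 !sub0r !sqrrN /e.
have : 1 <= ((b y0 - v)%:~R : R) ^+ 2.
  rewrite -rmorphXn /= (_ : 1 = 1%:~R)// ler_int.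
  by have : b y0 - v != 0 by [rewrite subr_eq0]; nia.
move: (_%:~R) (u2 x0) (u2 y0) => c p q.
move=> c1 cpq p2 q2.
have : c ^+ 2 <= 3 * ((c - (q - p)) ^+ 2 + q ^+ 2 + p ^+ 2).
  have := sqr_ge0 ((c - (q - p)) - q); have := sqr_ge0 ((c - (q - p)) + p).
  have := sqr_ge0 (p + q); nra.
lra.
Qed.

(** * Least squares and the closure of the coboundaries *)

Lemma discriminant_le (R : realFieldType) (a b c : R) : 0 <= c ->
  (forall t, 0 <= a - 2 * t * b + t ^+ 2 * c) -> b ^+ 2 <= a * c.
Proof.
rewrite le_eqVlt => /predU1P[<-|c0] H.
  have [->|b0] := eqVneq b 0; first by rewrite mulr0 expr0n.
  have := H ((a + 1) / (2 * b)).
  by rewrite mulr0 addr0 (_ : 2 * _ * b = a + 1); [lra|field].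
have := mulr_ge0 (ltW c0) (H (b / c)).
have -> : c * (a - 2 * (b / c) * b + (b / c) ^+ 2 * c) = a * c - b ^+ 2.
  by field; rewrite gt_eqF.
by rewrite subr_ge0.
Qed.

Section InnerProduct.
Variables (T : choiceType) (R : realType).
Implicit Types u v w : T -> R.

Definition ip u v : R := fsum (fun x => u x * v x).

Lemma ipC u v : ip u v = ip v u.
Proof. by apply: eq_fsum => x; rewrite mulrC. Qed.

Lemma sqnorm_ge0 u : 0 <= sqnorm u.
Proof. by apply: fsum_ge0 => x; exact: sqr_ge0. Qed.

Lemma ipBl u v w : fsupp u -> fsupp v -> ip (fun x => u x - v x) w = ip u w - ip v w.
Proof.
move=> fu fv; rewrite -fsumB; [|exact: fsuppMl..].
by apply: eq_fsum => x; rewrite mulrBl.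
Qed.

Lemma sqnormBZ t u v : fsupp u -> fsupp v ->
  sqnorm (fun x => u x - t * v x) = sqnorm u - 2 * t * ip u v + t ^+ 2 * sqnorm v.
Proof.
move=> fu fv; rewrite /sqnorm /ip.
have fuv : fsupp (fun x => u x * v x) by exact: fsuppMl.
have fu2 := fsupp_sqr fu; have fv2 := fsupp_sqr fv.
rewrite -(fsumZl (2 * t))// -(fsumZl (t ^+ 2))// -fsumB//; last exact: fsuppMr.
rewrite -fsumD//; [|apply: fsuppB => //; exact: fsuppMr|exact: fsuppMr].
by apply: eq_fsum => x; ring.
Qed.

Lemma ip_sqr_le u v : fsupp u -> fsupp v -> ip u v ^+ 2 <= sqnorm u * sqnorm v.
Proof.
move=> fu fv; apply: discriminant_le => [|t]; rewrite -?sqnormBZ//; exact: sqnorm_ge0.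
Qed.

Lemma sqnormB u v : fsupp u -> fsupp v ->
  sqnorm (fun x => u x - v x) = sqnorm u - 2 * ip u v + sqnorm v.
Proof.
move=> fu fv; have := sqnormBZ 1 fu fv; rewrite expr1n mul1r mulr1 => <-.
by apply: eq_fsum => x; rewrite mul1r.
Qed.

Lemma sqnormB_le u v : fsupp u -> fsupp v ->
  sqnorm (fun x => u x - v x) <= 2 * (sqnorm u + sqnorm v).
Proof.
move=> fu fv; rewrite sqnormB//.
have := sqnorm_ge0 (fun x => u x - (-1) * v x); rewrite sqnormBZ//; lra.
Qed.

(* A minimizing sequence for the distance from [c] to [W]; its residuals become
   orthogonal to [W] although the minimum need not be attained. *)
Lemma minimizing_sequence (W : set (T -> R)) (c : T -> R) :
  fsupp c -> W (fun=> 0) ->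
  (forall w w' t, W w -> W w' -> W (fun x => w x - t * w' x)) ->
  (forall w, W w -> fsupp w) ->
  exists w_ : nat -> T -> R, let r n x := c x - w_ n x in
  [/\ forall n, W (w_ n),
      forall n w, W w -> ip w (r n) ^+ 2 <= sqnorm w * n.+1%:R^-1,
      forall m n, (m <= n)%N -> sqnorm (fun x => r m x - r n x) <= 4 * m.+1%:R^-1 &
      forall n, sqnorm (r n) <= sqnorm c + 1].
Proof.
move=> fc W0 Wlin Wf.
pose Q w := sqnorm (fun x => c x - w x).
pose E := [set Q w | w in W].
have E0 : E !=set0 by exists (Q (fun=> 0)); exists (fun=> 0).
have lbE : lbound E 0 by move=> _ [w _ <-]; exact: sqnorm_ge0.
have hE : has_inf E by split => //; exists 0.
pose I := inf E.
have leI w : W w -> I <= Q w by move=> Ww; apply: ge_inf; [exists 0|exists w].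
have approx n : exists w, W w /\ Q w < I + n.+1%:R^-1.
  have n0 : 0 < n.+1%:R^-1 :> R by rewrite invr_gt0.
  by have [_ [w Ww <-] lt] := inf_adherent n0 hE; exists w.
pose w_ n := projT1 (cid (approx n)).
have Ww n : W (w_ n) by case: (projT2 (cid (approx n))).
have Qw n : Q (w_ n) < I + n.+1%:R^-1 by case: (projT2 (cid (approx n))).
have fr n : fsupp (fun x => c x - w_ n x) by apply: fsuppB => //; exact: Wf.
have orth n w : W w -> ip w (fun x => c x - w_ n x) ^+ 2 <= sqnorm w * n.+1%:R^-1.
  move=> ww; have fw := Wf _ ww.
  rewrite ipC mulrC; apply: le_trans (_ : (Q (w_ n) - I) * sqnorm w <= _); last first.
    by apply: ler_wpM2r; [exact: sqnorm_ge0|rewrite lerBlDl; exact: ltW].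
  apply: discriminant_le => [|t]; first exact: sqnorm_ge0.
  (* Moving [w_ n] along [w] cannot go below the infimum, so a quadratic polynomial in [t] is
     nonnegative; its discriminant gives the bound. *)
  have := leI (fun x => w_ n x - (- t) * w x) (Wlin _ _ _ (Ww n) ww).
  rewrite /Q (_ : sqnorm _ = sqnorm (fun x => (c x - w_ n x) - t * w x)); last first.
    by apply: eq_fsum => x; congr (_ ^+ 2); ring.
  by rewrite sqnormBZ//; lra.
exists w_; split => //.
- move=> m n mn; set C := sqnorm _.
  (* The difference of two residuals lies in [W], so its squared norm is a difference of two inner
     products that [orth] makes small. *)
  pose d x := w_ n x - 1 * w_ m x.
  have Wd : W d by exact: Wlin.
  have Cd : C = sqnorm d by apply: eq_fsum => x; rewrite /d; congr (_ ^+ 2); ring.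
  have CE : C = ip d (fun x => c x - w_ m x) - ip d (fun x => c x - w_ n x).
    rewrite ![ip d _]ipC -ipBl// Cd; apply: eq_fsum => x; rewrite /d; ring.
  have := orth m _ Wd; have := orth n _ Wd; rewrite -Cd => h1 h2.
  have C0 : 0 <= C by exact: sqnorm_ge0.
  have nm : n.+1%:R^-1 <= m.+1%:R^-1 :> R.
    by rewrite lef_pV2 ?posrE ?ltr0n// ler_nat.
  have [->|Cn] := eqVneq C 0; first by rewrite mulr_ge0// invr_ge0.
  have Cp : 0 < C by rewrite lt_neqAle eq_sym Cn.
  rewrite -(ler_pM2l Cp).
  have : C * C <= 2 * (C * n.+1%:R^-1 + C * m.+1%:R^-1).
    apply: le_trans (_ : 2 * (ip d (fun x => c x - w_ n x) ^+ 2
      + ip d (fun x => c x - w_ m x) ^+ 2) <= _); last first.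
      by rewrite ler_pM2l//; apply: lerD.
    rewrite CE; move: (ip d _) (ip d _) => p q.
    by have := sqr_ge0 (p + q); rewrite -subr_ge0 => ?; rewrite -subr_ge0; nra.
  have : C * n.+1%:R^-1 <= C * m.+1%:R^-1 by rewrite ler_pM2l.
  by move: (n.+1%:R^-1) (m.+1%:R^-1) => p q; lra.
- move=> n; apply: le_trans (ltW (Qw n)) _; apply: lerD.
    apply: le_trans (leI _ W0) _; rewrite le_eqVlt; apply/orP; left; apply/eqP.
    by apply: eq_fsum => x; rewrite subr0.
  by rewrite invf_le1// ler1n.
Qed.

End InnerProduct.

(** Right multiplication by [f], summed over the second factor: the sum is finite for arbitrary [v]
    once [f] has finite support. *)
Definition conv (G : groupType) (V : nzRingType) (v f : G -> V) (g : G) : V :=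
  fsum (fun k => v (g * k^-1)%g * f k).

Section Convolution.
Variables (G : groupType) (V : nzRingType).
Implicit Types v w f : G -> V.

Lemma convB v w f g : fsupp f ->
  conv (fun x => v x - w x) f g = conv v f g - conv w f g.
Proof.
move=> ff; rewrite -fsumB; [|exact: fsuppMr..].
by apply: eq_fsum => x; rewrite mulrBl.
Qed.

Lemma conv_gdiff v f s g : fsupp f -> conv (gdiff s v) f g = gdiff s (conv v f) g.
Proof.
move=> ff; rewrite convB//; congr (_ - _).
by rewrite /conv; apply: eq_fsum => x; rewrite mulgA.
Qed.

Lemma fsupp_conv v f : fsupp v -> fsupp f -> fsupp (conv v f).
Proof.
move=> fv ff.
pose A := \bigcup_(k in [set k | f k != 0]) ((fun x => x * k)%g @` [set x | v x != 0]).
have finA : finite_set A by apply: bigcup_finite => // k _; exact: finite_image.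
apply: sub_finite_set finA => g /= vfg; apply: contrapT => Ag.
case/eqP: vfg; apply: etrans (fsum0 G V); apply: eq_fsum => k.
have [->|fk] := eqVneq (f k) 0; first by rewrite mulr0.
have [->|vk] := eqVneq (v (g * k^-1)%g) 0; first by rewrite mul0r.
by case: Ag; exists k => //; exists (g * k^-1)%g; rewrite //= mulgVK.
Qed.

End Convolution.

Lemma conv_intr (G : groupType) (V : nzRingType) (a f : G -> int) g : fsupp f ->
  conv (fun x => (a x)%:~R : V) (fun x => (f x)%:~R) g = (conv a f g)%:~R.
Proof.
move=> /fsuppP[s us sf]; rewrite /conv !(fsum_seq us).
- by rewrite rmorph_sum; apply: eq_bigr => x _; rewrite rmorphM.
- by move=> x /sf ->; rewrite mulr0.
- by move=> x /sf ->; rewrite mulr0.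
Qed.

Lemma ex_small_ratio (R : realType) (M e : R) : 0 < e -> exists m, M * m.+1%:R^-1 < e.
Proof.
move=> e0; exists (Num.bound (M / e)).
have := archi_boundP (normr_ge0 (M / e)); set m := Num.bound _ => h.
have b : M / e < (Num.bound (M / e)).+1%:R.
  have [Me|Me] := leP 0 (M / e).
    by apply: lt_le_trans (archi_boundP Me) _; rewrite ler_nat.
  by apply: lt_le_trans Me _.
by rewrite ltr_pdivrMr ?ltr0n// mulrC -ltr_pdivrMr.
Qed.

Lemma ltr_norm_of_sqr (R : realDomainType) (a e : R) : 0 < e -> a ^+ 2 < e ^+ 2 -> `|a| < e.
Proof. by move=> e0 h; rewrite ltr_norml; apply/andP; split; nra. Qed.

Lemma cvg_of_sqr_cauchy (R : realType) (a : nat -> R) M :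
  (forall m n, (m <= n)%N -> (a m - a n) ^+ 2 <= M * m.+1%:R^-1) ->
  cvg (a @ \oo).
Proof.
move=> H; apply/cauchy_cvgP/cauchy_exP => e e0.
have [m mM] := ex_small_ratio M (exprn_gt0 2 e0).
exists (a m); exists m => // n /= mn; rewrite /ball/=.
exact: ltr_norm_of_sqr (le_lt_trans (H _ _ mn) mM).
Qed.

Lemma sqr_small_cvg0 (R : realType) (a : nat -> R) M :
  (forall n, a n ^+ 2 <= M * n.+1%:R^-1) -> a @ \oo --> (0 : R).
Proof.
move=> H; have M0 : 0 <= M by have := le_trans (sqr_ge0 _) (H 0%N); rewrite invr1 mulr1.
apply/cvgrPdist_lt => e e0.
have [m mM] := ex_small_ratio M (exprn_gt0 2 e0).
exists m => // n /= mn; rewrite sub0r normrN.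
apply: ltr_norm_of_sqr => //; apply: le_lt_trans (H _) (le_lt_trans _ mM); apply: ler_wpM2l => //.
by rewrite lef_pV2 ?posrE ?ltr0n// ler_nat.
Qed.

Definition l2_injective (G : groupType) (R : numDomainType) (f : G -> R) :=
  forall v : G -> R,
    (exists C, forall s, uniq s -> \sum_(x <- s) v x ^+ 2 <= C) ->
    (forall g, conv v f g = 0) -> forall x, v x = 0.

Section Family.
Variables (G : groupType) (R : realType) (gs : seq G).
Implicit Types F : G -> G -> R.

(** Packs the values at the finitely many [g] in [gs] into one vector, so that a single potential is
    fitted to all of them at once. *)
Definition family F (p : G * G) : R := if p.1 \in gs then F p.1 p.2 else 0.

Lemma fsupp_family F : (forall g, g \in gs -> fsupp (F g)) -> fsupp (family F).
Proof.
move=> fF; pose A := \bigcup_(g in [set` gs]) ((fun x => (g, x)) @` [set x | F g x != 0]).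
have : finite_set A.
  by apply: bigcup_finite => // g ggs; apply: finite_image; exact: fF.
apply: sub_finite_set => -[g x] /=; rewrite /family /=; case: ifP; last by rewrite eqxx.
by move=> ggs Fx; exists g => //; exists x.
Qed.

Lemma sqnorm_family F g : (forall g, g \in gs -> fsupp (F g)) -> g \in gs ->
  sqnorm (F g) <= sqnorm (family F).
Proof.
move=> fF ggs; have /fsuppP[s us sF] := fF _ ggs.
rewrite /sqnorm (fsum_seq us); last by move=> x /sF ->; rewrite expr0n.
have := @ler_sum_fsum _ _ (fun p => family F p ^+ 2) [seq (g, x) | x <- s] _
  (fsupp_sqr (fsupp_family fF)) (fun p => sqr_ge0 _).
rewrite big_map map_inj_uniq; last by move=> x y [].
move=> /(_ us); rewrite (eq_bigr (fun x => F g x ^+ 2))// => x _.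
by rewrite /family /= ggs.
Qed.

Lemma fsum_shift (F : G * G -> R) x : fsum (fun p => F (p.1, p.2 * x)%g) = fsum F.
Proof.
apply: (@fsum_reindex _ _ _ (fun p => (p.1, p.2 * x)%g) (fun p => (p.1, p.2 * x^-1)%g)).
  by move=> [g y]; rewrite /= mulgK.
by move=> [g y]; rewrite /= mulgVK.
Qed.

End Family.

Section Approximation.
Variables (G : groupType) (R : realType) (f h : G -> R).
Hypotheses (ff : fsupp f) (fh : fsupp h) (finj : l2_injective f).
Variables (gs : seq G) (c : G -> G -> R).
Hypothesis fc : forall g, g \in gs -> fsupp (c g).
Hypothesis ch : forall g, g \in gs -> forall x, conv (c g) f x = gdiff g h x.

Let C := family gs c.
Let d (u : G -> R) := family gs (fun g => gdiff g u).

Let fd u : fsupp u -> fsupp (d u).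
Proof. by move=> fu; apply: fsupp_family => g _; exact: fsupp_gdiff. Qed.

Let fC : fsupp C. Proof. exact: fsupp_family. Qed.

Let shift (F : G * G -> R) (x : G) (p : G * G) : R := F (p.1, p.2 * x)%g.

Let fshift F x : fsupp F -> fsupp (shift F x).
Proof.
by move=> fF; apply: fsupp_comp fF => -[a b] [a' b'] [-> /mulIg ->].
Qed.

(** Convolving the correlation of [C] and [r] with [f] replaces each [c s] by its product with [f],
    which is the coboundary of [h]. The result pairs [r] with a coboundary. *)
Lemma conv_ip_shift r g : fsupp r ->
  conv (fun x => ip (shift C x) r) f g = ip (d (fun x => h (x * g)%g)) r.
Proof.
move=> fr; have /finite_set_seqP[sr _ srP] := fr.
rewrite /conv /ip.
transitivity (fsum (fun k => fsum (fun p => shift C (g * k^-1)%g p * r p * f k))).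
  by apply: eq_fsum => k; rewrite fsumZr//; exact: fsuppMr.
rewrite (@exchange_fsum _ _ _ _ [set k | f k != 0] [set p | r p != 0])//; last first.
  move=> k p; rewrite /= => /eqP neq; split; apply/eqP => E; apply: neq.
    by rewrite E mulr0.
  by rewrite E mulr0 mul0r.
apply: eq_fsum => -[s y]; rewrite /shift /C /d /family /=.
case: ifP => sgs; last first.
  by rewrite [RHS]mul0r; apply: etrans (fsum0 G R); apply: eq_fsum => k; rewrite !mul0r.
have := ch sgs (y * g)%g; rewrite /gdiff -mulgA => <-.
rewrite /conv -fsumZr; last exact: fsuppMr.
by apply: eq_fsum => k; rewrite mulgA; ring.
Qed.

(** Correlating with a finitely supported [C] is bounded on l^2: apply Cauchy-Schwarz on [P] for
    each [x], then note that for fixed [p] the points at which [r] is evaluated are distinct. *)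
Lemma sum_ip_shift_le r (s : seq G) (P : seq (G * G)) : fsupp r -> uniq s -> uniq P ->
  (forall p, p \notin P -> C p = 0) ->
  \sum_(x <- s) ip (shift C x) r ^+ 2 <= sqnorm C * ((size P)%:R * sqnorm r).
Proof.
move=> fr us uP PC.
have fr2 := fsupp_sqr fr.
pose q x p := r (p.1, p.2 * x^-1)%g.
have E x : ip (shift C x) r = \sum_(p <- P) C p * q x p.
  rewrite /ip -(fsum_shift _ x^-1) (fsum_seq uP); last first.
    by move=> p pP; rewrite /shift /= mulgVK -surjective_pairing PC// mul0r.
  by apply: eq_bigr => p _; rewrite /shift /= mulgVK -surjective_pairing.
have CS x : ip (shift C x) r ^+ 2 <= sqnorm C * \sum_(p <- P) q x p ^+ 2.
  pose q' p := if p \in P then q x p else 0.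
  have fq' : fsupp q'.
    apply: (@sub_finite_set _ _ [set` P]) => // p /=; rewrite /q'.
    by case: ifP => //; rewrite eqxx.
  have -> : ip (shift C x) r = ip C q'.
    rewrite E /ip (fsum_seq uP); last by move=> p /PC ->; rewrite mul0r.
    by apply: eq_big_seq => p pP; rewrite /q' pP.
  have -> : \sum_(p <- P) q x p ^+ 2 = sqnorm q'.
    rewrite /sqnorm (fsum_seq uP); last by move=> p /negPf; rewrite /q' => ->; rewrite expr0n.
    by apply: eq_big_seq => p pP; rewrite /q' pP.
  exact: ip_sqr_le.
apply: le_trans (_ : \sum_(x <- s) sqnorm C * \sum_(p <- P) q x p ^+ 2 <= _).
  by apply: ler_sum => x _; exact: CS.
rewrite -mulr_sumr; apply: ler_wpM2l; first exact: sqnorm_ge0.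
rewrite exchange_big /=; apply: le_trans (_ : \sum_(p <- P) sqnorm r <= _); last first.
  by rewrite big_const_seq count_predT iter_addr addr0 mulr_natl.
apply: ler_sum => p _.
have up : uniq [seq (p.1, p.2 * x^-1)%g | x <- s].
  by rewrite map_inj_uniq// => x y [/mulgI /invg_inj].
have := ler_sum_fsum up fr2 (fun p => sqr_ge0 _).
by rewrite big_map.
Qed.

(** Let [r n] be the residuals of [C] modulo coboundaries. Their correlations [v n] with [C]
    converge to an l^2 function annihilated by [f], which is therefore 0. At the identity this says
    that the inner product of [C] and [r n] tends to 0, and so does the norm of [r n]. *)
Lemma dirichlet_approx e : 0 < e -> exists2 u : G -> R, fsupp u &
  forall g, g \in gs -> sqnorm (fun x => c g x - gdiff g u x) < e.
Proof.
move=> e0; pose W : set (G * G -> R) := [set d u | u in [set u | fsupp u]].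
have W0 : W (fun=> 0).
  exists (fun=> 0); first by apply: (@sub_finite_set _ _ set0) => // x /=; rewrite eqxx.
  by apply/funext => p; rewrite /d /family /gdiff subrr if_same.
have Wlin w w' t : W w -> W w' -> W (fun x => w x - t * w' x).
  move=> [u fu <-] [u' fu' <-]; exists (fun x => u x - t * u' x).
    by apply: fsuppB => //; exact: fsuppMr.
  apply/funext => p; rewrite /d /family /gdiff; case: ifP => _; ring.
have Wf w : W w -> fsupp w by move=> [u fu <-]; exact: fd.
have [w_ [Ww orth cau bnd]] := minimizing_sequence fC W0 Wlin Wf.
pose r n p := C p - w_ n p; rewrite -/(r _) in cau bnd orth.
have fr n : fsupp (r n) by apply: fsuppB => //; exact: Wf.
pose v n x := ip (shift C x) (r n).
have vcvg x : cvg ((fun n => v n x) @ \oo).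
  apply: (@cvg_of_sqr_cauchy _ _ (sqnorm C * 4)) => m n mn.
  rewrite /v ipC [ip _ (r n)]ipC -ipBl// ipC.
  apply: le_trans (ip_sqr_le (fshift x fC) (fsuppB (fr m) (fr n))) _.
  rewrite /sqnorm (fsum_shift (fun p => C p ^+ 2)) -mulrA.
  by apply: ler_wpM2l; [exact: sqnorm_ge0|exact: cau].
pose vlim x := lim ((fun n => v n x) @ \oo).
have /fsuppP[P uP PC] := fC.
have vlim0 : vlim 1%g = 0.
  apply: finj.
    exists (sqnorm C * ((size P)%:R * (sqnorm C + 1))) => s us.
    have cs : (fun n => \sum_(x <- s) v n x ^+ 2) @ \oo --> \sum_(x <- s) vlim x ^+ 2.
      apply: cvg_big => [|x _]; first exact: add_continuous.
      by rewrite expr2; exact: (cvgM (vcvg x) (vcvg x)).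
    rewrite -(cvg_lim (@Rhausdorff R) cs); apply: limr_le; first by apply/cvg_ex; eexists; exact: cs.
    apply: nearW => n; apply: le_trans (sum_ip_shift_le (fr n) us uP PC) _.
    by apply: ler_wpM2l; [exact: sqnorm_ge0|apply: ler_wpM2l => //; exact: bnd].
  move=> g; have /fsuppP[s us sf] := ff.
  have convE (z : G -> R) : conv z f g = \sum_(k <- s) z (g * k^-1)%g * f k.
    by rewrite /conv (fsum_seq us)// => k /sf ->; rewrite mulr0.
  have c1 : (fun n => conv (v n) f g) @ \oo --> conv vlim f g.
    rewrite convE; under eq_fun do rewrite convE.
    apply: cvg_big => [|k _]; first exact: add_continuous.
    by apply: cvgM; [exact: vcvg|exact: cvg_cst].
  have fhg : fsupp (fun x => h (x * g)%g) by apply: fsupp_comp fh; exact: mulIg.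
  have c0 : (fun n => conv (v n) f g) @ \oo --> (0 : R).
    apply: (@sqr_small_cvg0 _ _ (sqnorm (d (fun x => h (x * g)%g)))) => n.
    rewrite conv_ip_shift//; apply: orth; by exists (fun x => h (x * g)%g).
  exact: (cvg_unique (@Rhausdorff R) c1 c0).
(* A bound for [sqnorm (w_ n)] uniform in [n], as [w_ n] is [C] minus [r n]. *)
pose M := 2 * (sqnorm C + (sqnorm C + 1)).
have e2 : 0 < e / 2 by rewrite divr_gt0.
have [N [N1 N2]] : exists N, `|v N 1%g| < e / 2 /\ M * N.+1%:R^-1 < (e / 2) ^+ 2.
  have [m mM] := ex_small_ratio M (exprn_gt0 2 e2).
  have /cvgrPdist_lt /(_ _ e2)[n _ nv] : (fun n => v n 1%g) @ \oo --> (0 : R).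
    by rewrite -vlim0; exact: vcvg.
  exists (maxn m n); split.
    by have := nv (maxn m n) (leq_maxr _ _); rewrite sub0r normrN.
  apply: le_lt_trans _ mM; apply: ler_wpM2l.
    by have := sqnorm_ge0 C; rewrite /M; lra.
  by rewrite lef_pV2 ?posrE ?ltr0n// ler_nat ltnS leq_maxl.
have [u fu uw] := Ww N.
exists u => // g ggs.
apply: le_lt_trans (_ : sqnorm (r N) < e).
  rewrite (_ : r N = family gs (fun g x => c g x - gdiff g u x)); last first.
    by apply/funext => p; rewrite /r -uw /C /d /family; case: ifP; rewrite ?subr0.
  apply: (@sqnorm_family _ _ _ (fun g x => c g x - gdiff g u x)) => // k kgs.
  by apply: fsuppB; [exact: fc|exact: fsupp_gdiff].
have rE : sqnorm (r N) = v N 1%g - ip (w_ N) (r N).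
  rewrite /v -ipBl; [|exact: fshift|exact: Wf].
  apply: eq_fsum => p; rewrite /shift mulg1 -surjective_pairing expr2.
  by [].
have sw : sqnorm (w_ N) <= M.
  rewrite (_ : sqnorm (w_ N) = sqnorm (fun p => C p - r N p)).
    apply: le_trans (sqnormB_le fC (fr N)) _; rewrite /M.
    by have := bnd N; lra.
  by apply: eq_fsum => p; congr (_ ^+ 2); rewrite /r; ring.
have small : `|ip (w_ N) (r N)| < e / 2.
  apply: ltr_norm_of_sqr => //; apply: le_lt_trans (orth N _ (Ww N)) _.
  by apply: le_lt_trans N2; apply: ler_wpM2r.
rewrite rE; move: N1 small; rewrite !ltr_norml => /andP[? ?] /andP[? ?]; lra.
Qed.

End Approximation.

(** * Integer powers and generated subgroups *)

Local Open Scope group_scope.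

Section Zpow.
Variable G : groupType.
Implicit Types (x y : G) (z : int).

Definition zpow x z : G := match z with Posz n => x ^+ n | Negz n => x ^- n.+1 end.

Lemma zpow_subn x (m n : nat) : zpow x (n%:Z - m%:Z)%R = x ^- m * x ^+ n.
Proof.
have [mn|nm] := leqP m n.
  by rewrite subzn//= -{2}(subnKC mn) expgnDr mulKg.
have -> : (n%:Z - m%:Z)%R = Negz (m - n).-1 by rewrite NegzE; lia.
rewrite /= prednK ?subn_gt0// -[in RHS](subnKC (ltnW nm)) expgnDr invgM.
by rewrite mulgVK.
Qed.

Lemma zpowE x z : exists m n : nat, z = (n%:Z - m%:Z)%R.
Proof.
case: z => n; first by exists 0%N, n; rewrite subr0.
by exists n.+1, 0%N; rewrite NegzE sub0r.
Qed.

Let commXV x m n : x ^- m * x ^+ n = x ^+ n * x ^- m.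
Proof. by apply/esym/commuteV/commuteX/commute_sym/commuteX. Qed.

Lemma zpowD x z z' : zpow x (z + z')%R = zpow x z * zpow x z'.
Proof.
have [m [n ->]] := zpowE x z; have [m' [n' ->]] := zpowE x z'.
rewrite (_ : (_ + _)%R = (n + n')%N%:Z - (m' + m)%N%:Z)%R; last by lia.
rewrite !zpow_subn !expgnDr invgM -!mulgA; congr (_ * _).
by rewrite !mulgA; congr (_ * _); rewrite commXV.
Qed.

Lemma zpowN x z : zpow x (- z)%R = (zpow x z)^-1.
Proof. by apply/esym/mulg1_eq; rewrite -zpowD addrN. Qed.

Lemma zpowM x z z' : zpow x (z * z')%R = zpow (zpow x z) z'.
Proof.
have H n : zpow x (z * n%:Z)%R = zpow x z ^+ n.
  elim: n => [|n IH]; first by rewrite mulr0.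
  by rewrite expgS -IH -zpowD; congr zpow; lia.
case: z' => n; first exact: H.
by rewrite NegzE mulrN !zpowN H.
Qed.

Lemma zpow_conj x y z : zpow (y * x * y^-1) z = y * zpow x z * y^-1.
Proof.
have E w : y * w * y^-1 = w ^ y^-1 by rewrite /conjg invgK mulgA.
by rewrite !E; case: z => n; rewrite /zpow -conjXg// conjVg.
Qed.

Lemma zpow_inj x : (forall n, (0 < n)%N -> x ^+ n != 1) -> injective (zpow x).
Proof.
move=> xinf z z' E; apply/eqP; rewrite -subr_eq0.
have : zpow x (z - z')%R = 1 by rewrite zpowD zpowN E mulgV.
case: (z - z')%R => [[|n]|n] //= E1.
  by have := xinf n.+1 isT; rewrite E1 eqxx.
by have := xinf n.+1 isT; rewrite -invg_eq1 E1 eqxx.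
Qed.

End Zpow.

Lemma vcyclic_zpow (G : groupType) (c : G) (D : set G) : finite_set D ->
  (forall x, exists z d, D d /\ x = zpow c z * d) -> vcyclic G.
Proof.
move=> finD H; exists c, D; split=> // x; have [z [d [Dd ->]]] := H x.
by have [m [n ->]] := zpowE c z; exists m, n, d; rewrite zpow_subn.
Qed.

Lemma finite_vcyclic (G : groupType) : finite_set [set: G] -> vcyclic G.
Proof.
by move=> finG; apply: (vcyclic_zpow (c := 1) finG) => x; exists 0%R, x; rewrite mul1g.
Qed.

(** Two of the powers of [x] have the same remainder in the finite set [D]; their quotient is a
    power of [c]. *)
Lemma vcyclic_power (G : groupType) : vcyclic G ->
  exists c : G, forall x : G, exists k z, (0 < k)%N /\ x ^+ k = zpow c z.
Proof.
move=> [c [D [finD H]]]; exists c => x.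
pose P i d := D d /\ exists z, x ^+ i = zpow c z * d.
have [d Pd] : {d : nat -> G & forall i, P i (d i)}.
  apply: (@choice _ _ P) => i; have [m [n [d [Dd E]]]] := H (x ^+ i).
  by exists d; split => //; exists (n%:Z - m%:Z)%R; rewrite zpow_subn.
have [i [j [ij dij]]] : exists i j, (i < j)%N /\ d i = d j.
  apply: contrapT => nex.
  have dinj : injective d.
    move=> i j E; have [ij|ij|//] := ltngtP i j.
      by case: nex; exists i, j.
    by case: nex; exists j, i.
  apply: infinite_nat; have -> : [set: nat] = d @^-1` D.
    by apply/seteqP; split => i _ //; case: (Pd i).
  by apply: finite_preimage => // ? ? _ _; apply: dinj.
have [_ [z Ei]] := Pd i; have [_ [z' Ej]] := Pd j.
exists (j - i)%N, (z' - z)%R; split; first by rewrite subn_gt0.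
by rewrite expgnFr ?(ltnW ij)// Ei Ej dij invgM mulgA mulgK zpowD zpowN.
Qed.

Lemma vcyclic_torsion_finite (G : groupType) : vcyclic G ->
  (forall x : G, exists2 n, (0 < n)%N & x ^+ n = 1) -> finite_set [set: G].
Proof.
move=> [c [D [finD H]]] tors; have [k k0 ck] := tors c.
have red n : c ^+ n = c ^+ (n %% k).
  by rewrite {1}(divn_eq n k) expgnDr mulnC expgnA ck expg1n mul1g.
pose A := \bigcup_(i in [set` iota 0 k]) ((fun d => c ^+ i * d) @` D).
have finA : finite_set A by apply: bigcup_finite => // i _; exact: finite_image.
apply: sub_finite_set finA => x _; have [m [n [d [Dd ->]]]] := H x.
have -> : c ^- m * c ^+ n = c ^+ (k * m - m + n).
  rewrite expgnDr; congr (_ * _); rewrite expgnFr; last by rewrite leq_pmull.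
  by rewrite expgnA ck expg1n mul1g.
exists ((k * m - m + n) %% k)%N; first by rewrite /= mem_iota ltn_mod.
by exists d => //; rewrite -red.
Qed.

Section Generated.
Variables (G : groupType) (S : seq G).

Definition gen : set G := fun x => forall Y : set G, Y 1 ->
  (forall y s, Y y -> s \in S -> Y (y * s) /\ Y (y * s^-1)) -> Y x.

Lemma gen1 : gen 1. Proof. by []. Qed.

Lemma gen_mul x y : gen x -> gen y -> gen (x * y).
Proof.
move=> gx gy; apply: (gy (fun y => gen (x * y))); first by rewrite mulg1.
move=> z s gxy sS; rewrite !mulgA.
by split=> Y Y1 YS; have [] := YS _ _ (gxy Y Y1 YS) sS.
Qed.

Lemma gen_in s : s \in S -> gen s.
Proof. by move=> sS Y Y1 YS; have [] := YS _ _ Y1 sS; rewrite mul1g. Qed.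

Lemma gen_inV s : s \in S -> gen s^-1.
Proof. by move=> sS Y Y1 YS; have [] := YS _ _ Y1 sS; rewrite !mul1g. Qed.

Lemma gen_inv x : gen x -> gen x^-1.
Proof.
move=> gx; apply: (gx (fun x => gen x^-1)); first by rewrite invg1.
move=> y s gy sS; rewrite !invgM invgK; split; apply: gen_mul => //.
  exact: gen_inV.
exact: gen_in.
Qed.

Definition gen_type := {x : G | `[< gen x >]}.

HB.instance Definition _ := Choice.on gen_type.

Definition gen_one : gen_type := exist _ 1 (asboolT gen1).
Definition gen_mulg (x y : gen_type) : gen_type :=
  exist _ (val x * val y) (asboolT (gen_mul (asboolW (valP x)) (asboolW (valP y)))).
Definition gen_invg (x : gen_type) : gen_type :=
  exist _ (val x)^-1 (asboolT (gen_inv (asboolW (valP x)))).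

Lemma gen_mulgA : associative gen_mulg.
Proof. by move=> x y z; apply: val_inj; rewrite /= mulgA. Qed.
Lemma gen_mul1g : left_id gen_one gen_mulg.
Proof. by move=> x; apply: val_inj; rewrite /= mul1g. Qed.
Lemma gen_mulg1 : right_id gen_one gen_mulg.
Proof. by move=> x; apply: val_inj; rewrite /= mulg1. Qed.
Lemma gen_mulVg : left_inverse gen_one gen_invg gen_mulg.
Proof. by move=> x; apply: val_inj; rewrite /= mulVg. Qed.
Lemma gen_mulgV : right_inverse gen_one gen_invg gen_mulg.
Proof. by move=> x; apply: val_inj; rewrite /= mulgV. Qed.

HB.instance Definition _ := isGroup.Build gen_type
  gen_mulgA gen_mul1g gen_mulg1 gen_mulVg gen_mulgV.

Lemma gen_typeP (x : gen_type) : gen (val x).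
Proof. exact: asboolW (valP x). Qed.

Definition Gen x (gx : gen x) : gen_type := exist _ x (asboolT gx).

Lemma gen_valM (x y : gen_type) : val (x * y) = val x * val y. Proof. by []. Qed.
Lemma gen_valV (x : gen_type) : val x^-1 = (val x)^-1. Proof. by []. Qed.
Lemma gen_valX (x : gen_type) n : val (x ^+ n) = val x ^+ n.
Proof. by elim: n => // n IH; rewrite !expgS gen_valM IH. Qed.
Lemma gen_val_zpow (x : gen_type) z : val (zpow x z) = zpow (val x) z.
Proof. by case: z => n /=; rewrite ?gen_valV gen_valX. Qed.

(** Inverses are listed because [generates] only allows right multiplication by listed elements. *)
Definition gen_seq : seq gen_type := pmap insub (S ++ [seq s^-1 | s <- S]).

Lemma mem_gen_seq (x : gen_type) :
  (x \in gen_seq) = (val x \in S ++ [seq s^-1 | s <- S]).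
Proof. by rewrite mem_pmap_sub. Qed.

Lemma gen_generates : generates gen_seq.
Proof.
move=> Y [x Yx] YS y; rewrite -(mulVKg x y).
have /(_ (fun g => forall k : gen_type, val k = g -> Y (x * k))) := gen_typeP (x^-1 * y).
apply=> //; first by move=> k k1; rewrite (_ : k = 1) ?mulg1//; exact: val_inj.
have step g s (gs : gen s) : val (Gen gs) \in S ++ [seq s^-1 | s <- S] ->
    (forall k : gen_type, val k = g -> Y (x * k)) ->
    forall k : gen_type, val k = g * s -> Y (x * k).
  move=> sS Yg k kE.
  have -> : k = k * (Gen gs)^-1 * Gen gs by rewrite mulgVK.
  rewrite mulgA; apply: YS; last by rewrite mem_gen_seq.
  by apply: Yg; rewrite gen_valM gen_valV kE mulgK.
move=> g s Yg sS; split.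
  by apply: (step _ _ (gen_in sS)) => //; rewrite mem_cat sS.
apply: (step _ _ (gen_inV sS)) => //; rewrite mem_cat; apply/orP; right.
by apply: map_f.
Qed.

End Generated.

(** * Finite orbits modulo a principal left ideal *)

Local Open Scope ring_scope.

Lemma gdiffM (G : groupType) (V : zmodType) (h : G -> V) s t x :
  gdiff (s * t)%g h x = gdiff s h (t * x)%g + gdiff t h x.
Proof. by rewrite /gdiff mulgA addrA subrK. Qed.

Lemma gdiff1 (G : groupType) (V : zmodType) (h : G -> V) x : gdiff 1%g h x = 0.
Proof. by rewrite /gdiff mul1g subrr. Qed.

Lemma gdiffV (G : groupType) (V : zmodType) (h : G -> V) s x :
  gdiff s^-1%g h x = - gdiff s h (s^-1 * x)%g.
Proof. by rewrite /gdiff mulVKg opprB. Qed.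

Lemma fsupp_translates (G : groupType) (V : nmodType) (w : G -> V) (A : set G) x :
  fsupp w -> infinite_set A -> exists2 s, A s & w (s * x)%g = 0.
Proof.
move=> fw Ainf.
have fin : finite_set ((fun s => s * x)%g @^-1` [set y | w y != 0]).
  by apply: finite_preimage => // a b _ _; apply: mulIg.
have [s As /= ws] := infinite_avoid Ainf fin.
by exists s => //; apply/eqP/negPn/negP.
Qed.

Lemma fsupp_invariant0 (G : groupType) (V : nmodType) (w : G -> V) (A : set G) :
  fsupp w -> infinite_set A -> (forall s x, A s -> w (s * x)%g = w x) ->
  forall x, w x = 0.
Proof.
move=> fw Ainf winv x; have [s As ws] := fsupp_translates x fw Ainf.
by rewrite -(winv s x As).
Qed.

Definition ideal (G : groupType) (f : G -> int) : set (G -> int) :=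
  [set h | exists2 a, fsupp a & forall x, conv a f x = h x].

Section Ideal.
Variables (G : groupType) (f : G -> int).
Hypothesis ff : fsupp f.

Lemma ideal0 : ideal f (fun=> 0).
Proof.
exists (fun=> 0); first by apply: (@sub_finite_set _ _ set0) => // x /=; rewrite eqxx.
by move=> x; apply: etrans (fsum0 G _); apply: eq_fsum => k; rewrite mul0r.
Qed.

Lemma idealB h h' : ideal f h -> ideal f h' -> ideal f (fun x => h x - h' x).
Proof.
move=> [a fa ah] [b fb bh]; exists (fun x => a x - b x); first exact: fsuppB.
by move=> x; rewrite convB// ah bh.
Qed.

Lemma idealD h h' : ideal f h -> ideal f h' -> ideal f (fun x => h x + h' x).
Proof.
move=> ih ih'; have := idealB ih (idealB ideal0 ih').
by congr (ideal f _); apply/funext => x; rewrite sub0r opprK.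
Qed.

Lemma ideal_shift h s : ideal f h -> ideal f (fun x => h (s * x)%g).
Proof.
move=> [a fa ah]; exists (fun x => a (s * x)%g).
  by apply: fsupp_comp fa; exact: mulgI.
by move=> x; rewrite -ah; apply: eq_fsum => k; rewrite mulgA.
Qed.

Lemma ideal_shiftE h s : ideal f (fun x => h (s * x)%g) <-> ideal f h.
Proof.
split=> [/(ideal_shift s^-1%g)|]; last exact: ideal_shift.
by congr (ideal f _); apply/funext => x; rewrite mulVKg.
Qed.

Lemma fsupp_ideal h : ideal f h -> fsupp h.
Proof.
by move=> [a fa ah]; rewrite (_ : h = conv a f); [exact: fsupp_conv|apply/funext => x].
Qed.

Definition stab h : set G := [set s | ideal f (gdiff s h)].

Lemma stab1 h : stab h 1%g.
Proof.
by rewrite /stab/= (_ : gdiff _ _ = fun=> 0);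
  [exact: ideal0|apply/funext => x; exact: gdiff1].
Qed.

Lemma stabM h s t : stab h s -> stab h t -> stab h (s * t)%g.
Proof.
move=> hs ht; rewrite /stab/= (_ : gdiff _ _ =
    fun x => gdiff s h (t * x)%g + gdiff t h x); last first.
  by apply/funext => x; exact: gdiffM.
by apply: idealD => //; apply: ideal_shift.
Qed.

Lemma stabV h s : stab h s -> stab h s^-1%g.
Proof.
move=> hs; rewrite /stab/= (_ : gdiff _ _ =
    fun x => 0 - gdiff s h (s^-1 * x)%g); last first.
  by apply/funext => x; rewrite gdiffV sub0r.
by apply: idealB; [exact: ideal0|exact: ideal_shift].
Qed.

Lemma stab_zpow h s z : stab h s -> stab h (zpow s z).
Proof.
move=> hs; have H n : stab h (s ^+ n)%g.
  by elim: n => [|n IH]; [exact: stab1|rewrite expgS; exact: stabM].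
by case: z => n; [exact: H|apply: stabV; exact: H].
Qed.

Lemma gen_stab h (S : seq G) : (forall s, s \in S -> stab h s) ->
  forall x, gen S x -> stab h x.
Proof.
move=> Sst x; apply; first exact: stab1.
move=> y s hy /Sst hs; split; apply: stabM => //; exact: stabV.
Qed.

End Ideal.

Section Core.
Variables (G : groupType) (R : realType) (f h : G -> int).
Hypotheses (ff : fsupp f) (fh : fsupp h).
Let fR : G -> R := fun x => (f x)%:~R.
Hypothesis finj : l2_injective fR.

Let ffR : fsupp fR. Proof. by apply: fsuppS ff _ => x; rewrite /fR => ->. Qed.

Lemma conv_eq0 a : fsupp a -> (forall x, conv a f x = 0) -> forall x, a x = 0.
Proof.
move=> fa af x; apply/eqP; rewrite -(@intr_eq0 R); apply/eqP.
apply: (finj (v := fun x => (a x)%:~R)) => [|g]; last by rewrite conv_intr// af.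
have faR : fsupp (fun x => (a x)%:~R : R) by apply: fsuppS fa _ => y ->.
exists (sqnorm (fun x => (a x)%:~R : R)) => s us.
by apply: ler_sum_fsum => //; [exact: fsupp_sqr|move=> y; exact: sqr_ge0].
Qed.

Lemma ex_cocycle : exists c : G -> G -> int, forall s, stab f h s ->
  fsupp (c s) /\ forall x, conv (c s) f x = gdiff s h x.
Proof.
have H s : exists c, stab f h s -> fsupp c /\ forall x, conv c f x = gdiff s h x.
  have [[a fa ah]|ns] := pselect (stab f h s); first by exists a.
  by exists (fun=> 0).
by have [c cP] := choice H; exists c.
Qed.

Variable c : G -> G -> int.
Hypothesis cP : forall s, stab f h s ->
  fsupp (c s) /\ forall x, conv (c s) f x = gdiff s h x.

Lemma cocycleM s t x : stab f h s -> stab f h t -> c (s * t)%g x = c s (t * x)%g + c t x.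
Proof.
move=> hs ht; have [fs cs] := cP hs; have [ft ct] := cP ht.
have [fst cst] := cP (stabM ff hs ht).
have fs' : fsupp (fun x => c s (t * x)%g) by apply: fsupp_comp fs; exact: mulgI.
apply/eqP; rewrite -subr_eq0 opprD addrA; apply/eqP.
apply: (conv_eq0 (a := fun x => c (s * t)%g x - c s (t * x)%g - c t x)).
  by apply: fsuppB => //; exact: fsuppB.
move=> y; rewrite !convB// cst ct gdiffM -cs.
rewrite (_ : conv (fun x => c s (t * x)%g) f y = conv (c s) f (t * y)%g); first by ring.
by apply: eq_fsum => k; rewrite mulgA.
Qed.

Lemma cocycle1 x : c 1%g x = 0.
Proof.
have := cocycleM x (stab1 f h) (stab1 f h).
by rewrite !mul1g => /eqP; rewrite -subr_eq subrr => /eqP.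
Qed.

(* If [c s x] tends to [L x] as [s] leaves finite subsets of [H], then [- L] is a finitely
   supported potential of [c] on [H]. *)
Lemma ideal_of_limit (H B : set G) : H `<=` stab f h -> H 1%g ->
  (forall s t, H s -> H t -> H (s * t)%g) -> (forall s, H s -> H s^-1%g) ->
  infinite_set H -> finite_set B ->
  (forall x, (forall s, H s -> ~ B (s * x)%g) -> forall s, H s -> c s x = 0) ->
  (forall x, exists L, finite_set [set s | H s /\ c s x != L]) ->
  ideal f h.
Proof.
move=> Hst H1 HM HV Hinf finB cB lim.
have [L LP] := choice lim.
(* Let [s] leave finite sets in the cocycle identity for [c (s * m) x]. *)
have LE m x : H m -> L (m * x)%g = L x - c m x.
  move=> Hm.
  have fin : finite_set ([set s | H s /\ c s (m * x)%g != L (m * x)%g] `|`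
      (fun s => s * m)%g @^-1` [set s | H s /\ c s x != L x]).
    rewrite finite_setU; split; first exact: LP.
    by apply: finite_preimage; [move=> a b _ _; apply: mulIg|exact: LP].
  have [s Hs /not_orP[h1 h2]] := infinite_avoid Hinf fin.
  have {}h1 : c s (m * x)%g = L (m * x)%g by apply/eqP/negPn/negP => h3; apply: h1.
  have {}h2 : c (s * m)%g x = L x.
    by apply/eqP/negPn/negP => h3; apply: h2; split => //; exact: HM.
  by rewrite -h1 -h2 cocycleM; [rewrite addrK|exact: Hst..].
(* If [L x] is nonzero, the orbit of [x] meets [B] at some [y = s * x]. By [LE], [c s^-1 y] differs
   from [L y], which leaves finitely many [s] for each of the finitely many [y]. *)
have fL : fsupp L.
  pose A := \bigcup_(y in B) ((fun s => s * y)%g @` [set s | H s /\ c s y != L y]).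
  have finA : finite_set A.
    by apply: bigcup_finite => // y _; apply: finite_image; exact: LP.
  apply: sub_finite_set finA => x /= Lx.
  have [[s [Hs Bs]]|nex] := pselect (exists s, H s /\ B (s * x)%g); last first.
    have c0 s : H s -> c s x = 0.
      by apply: cB => t Ht Bt; apply: nex; exists t.
    exfalso; apply: Hinf; apply: sub_finite_set (LP x) => s Hs; split => //.
    by rewrite c0// eq_sym.
  exists (s * x)%g => //; exists s^-1%g; last by rewrite mulKg.
  split; first exact: HV.
  have := LE s^-1%g (s * x)%g (HV _ Hs); rewrite mulKg => E.
  by apply: contra Lx => /eqP; rewrite E => ->; rewrite subrr.
pose a x := - L x.
have fa : fsupp a by apply: fsuppS fL _ => x; rewrite /a => ->; rewrite oppr0.
exists a => // x; apply/eqP; rewrite -subr_eq0; apply/eqP.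
(* Both terms have the same differences along [H], so their difference is invariant under an
   infinite set and finitely supported. *)
apply: (fsupp_invariant0 (w := fun x => conv a f x - h x)) Hinf _ x.
  by apply: fsuppB => //; exact: fsupp_conv.
move=> s x Hs; apply/eqP; rewrite -subr_eq0; apply/eqP.
have [_ cs] := cP (Hst _ Hs).
have := conv_gdiff a s x ff; rewrite (_ : conv (gdiff s a) f x = conv (c s) f x).
  by rewrite cs /gdiff; lia.
by apply: eq_fsum => k; rewrite /gdiff /a LE//; ring.
Qed.

(** For a finitely generated subgroup, the union of the supports of [c] on generators and their
    inverses serves as [B]: on an orbit that misses it, the cocycle identity makes all of [c]
    vanish. *)
Lemma ideal_of_generated (S : seq G) : (forall s, s \in S -> stab f h s) ->
  infinite_set (gen S) ->
  (forall x, exists L, finite_set [set s | gen S s /\ c s x != L]) ->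
  ideal f h.
Proof.
move=> Sst Hinf lim; have Hst := gen_stab ff Sst.
pose B := \bigcup_(s in [set` S ++ [seq s^-1 | s <- S]%g]) [set x | c s x != 0].
have Sst' s : s \in S ++ [seq s^-1 | s <- S]%g -> stab f h s.
  rewrite mem_cat => /orP[/Sst//|/mapP[t tS ->]].
  by apply/stabV/Sst.
have finB : finite_set B.
  by apply: bigcup_finite => // s sS; have [] := cP (Sst' _ sS).
refine (ideal_of_limit Hst (@gen1 _ S) (@gen_mul _ S) (@gen_inv _ S) Hinf finB _ lim).
move=> x nB s gs.
suff : gen S s /\ forall t, gen S t -> c s (t * x)%g = 0.
  by move=> [_ /(_ 1%g (@gen1 _ S))]; rewrite mul1g.
have c0 t r : r \in S ++ [seq s^-1 | s <- S]%g -> gen S t -> c r (t * x)%g = 0.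
  move=> rS gt; apply/eqP/negPn/negP => nc.
  by apply: (nB t gt); exists r.
apply: (gs (fun s => gen S s /\ forall t, gen S t -> c s (t * x)%g = 0)).
  by split; [exact: gen1|move=> t _; exact: cocycle1].
move=> y r [gy cy] rS.
have rS' : r \in S ++ [seq s^-1 | s <- S]%g by rewrite mem_cat rS.
have rVS : r^-1%g \in S ++ [seq s^-1 | s <- S]%g.
  by rewrite mem_cat; apply/orP; right; apply: map_f.
have gr := gen_in rS; have grV := gen_inV rS.
split; split; try exact: gen_mul; move=> t gt; rewrite cocycleM; try exact: Hst.
  by rewrite c0// addr0 mulgA cy//; exact: gen_mul.
by rewrite c0// addr0 mulgA cy//; exact: gen_mul.
Qed.

Lemma sqnorm_comp (T T' : choiceType) (p : T' -> T) (F : T -> R) :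
  injective p -> fsupp F -> sqnorm (fun x => F (p x)) <= sqnorm F.
Proof.
move=> pI fF; have /fsuppP[s us sF] := fsupp_comp pI fF.
rewrite /sqnorm (fsum_seq us); last by move=> x /sF ->; rewrite expr0n.
have := @ler_sum_fsum _ _ (fun y => F y ^+ 2) (map p s) _ (fsupp_sqr fF) (fun y => sqr_ge0 _).
by rewrite big_map map_inj_uniq//; apply.
Qed.

(** On the coset of [x0], the function [c (val l) x0] of [l] is a potential of the restricted
    cocycle, and the approximations of the cocycle on [G] restrict to that coset. *)
Lemma ideal_of_non_vcyclic (S : seq G) : (forall s, s \in S -> stab f h s) ->
  ~ vcyclic (gen_type S) -> ideal f h.
Proof.
move=> Sst nvc; have Hst := gen_stab ff Sst.
have Kinf : infinite_set [set: gen_type S] by move=> /finite_vcyclic.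
have val_image (A : set (gen_type S)) : finite_set A -> finite_set (val @` A).
  by move=> fA; exact: finite_image.
apply: (ideal_of_generated Sst).
  move=> fin; apply: Kinf.
  have -> : [set: gen_type S] = val @^-1` gen S.
    by apply/seteqP; split => // x _; exact: gen_typeP.
  by apply: finite_preimage => // x y _ _; apply: val_inj.
move=> x0; pose b (l : gen_type S) := c (val l) x0.
have bE g l : gdiff g b l = c (val g) (val l * x0)%g.
  rewrite /gdiff /b gen_valM cocycleM; try by apply: Hst; exact: gen_typeP.
  by rewrite addrK.
have pI : injective (fun l : gen_type S => val l * x0)%g.
  by move=> l l' /mulIg /val_inj.
have [|||||L finL] := @dirichlet_const (gen_type S) R (gen_seq S) b.
- exact: gen_generates.
- exact: Kinf.
- exact: nvc.
- move=> g; rewrite (_ : gdiff g b = fun l => c (val g) (val l * x0)%g).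
    by apply: fsupp_comp => //; case: (cP (Hst _ (gen_typeP g))).
  by apply/funext => l; exact: bE.
- move=> gs e e0.
  have fcR g : g \in map val gs -> fsupp (fun x => (c g x)%:~R : R).
    move=> /mapP[k _ ->]; have [fk _] := cP (Hst _ (gen_typeP k)).
    by apply: fsuppS fk _ => x ->.
  have fhR : fsupp (fun x => (h x)%:~R : R) by apply: fsuppS fh _ => x ->.
  have [|u fu H] := dirichlet_approx ffR fhR finj (c := fun g x => (c g x)%:~R) fcR _ e0.
    move=> g /mapP[k _ ->] x; have [_ ck] := cP (Hst _ (gen_typeP k)).
    by rewrite conv_intr// ck /gdiff rmorphB.
  exists (fun l => u (val l * x0)%g); first exact: fsupp_comp fu.
  move=> g ggs; apply: le_lt_trans (H (val g) (map_f _ ggs)).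
  have fk := fcR _ (map_f _ ggs).
  have := sqnorm_comp pI (fsuppB fk (fsupp_gdiff (val g) fu)).
  rewrite (_ : sqnorm _ = sqnorm (fun l => (gdiff g b l)%:~R -
     gdiff g (fun l => u (val l * x0)%g) l))//.
  by apply: eq_fsum => l; rewrite bE /gdiff gen_valM mulgA.
exists L; apply: sub_finite_set (val_image _ finL) => s [gs cs].
by exists (Gen gs).
Qed.

Lemma finite_int_bounded (A : set int) : finite_set A ->
  exists N : nat, forall z, A z -> (`|z| < N)%N.
Proof.
move=> /finite_set_seqP[s _ sA]; exists (\max_(z <- s) `|z|%N).+1 => z /sA zs.
by rewrite ltnS; apply: leq_bigmax_seq.
Qed.

Lemma bounded_int_finite (N : nat) : finite_set [set z : int | (`|z| < N)%N].
Proof.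
apply/finite_set_seqP; exists (undup [seq i%:Z - N%:Z | i <- iota 0 (N + N)]).
  exact: undup_uniq.
move=> z /= zN; rewrite mem_undup; apply/mapP; exists (absz (z + N%:Z)).
  by rewrite mem_iota; lia.
by lia.
Qed.

(** In a virtually cyclic group, [t] and its conjugate by [d] both have nontrivial powers in one
    cyclic group, so suitable powers of the two agree. *)
Lemma conj_commensurate t d (S : seq G) : t \in S -> d \in S ->
  vcyclic (gen_type S) -> (forall n, (0 < n)%N -> t ^+ n != 1)%g ->
  exists p q : int, [/\ p != 0, q != 0 &
    forall z, (d * zpow t (p * z) = zpow t (q * z) * d)%g].
Proof.
move=> tS dS vc tinf; have [b bP] := vcyclic_power vc.
pose T := Gen (gen_in tS); pose D := Gen (gen_in dS).
have [k [m [k0 Tm]]] := bP T; have [k' [m' [k0' Tm']]] := bP (D * T * D^-1)%g.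
have Tinf n : (0 < n)%N -> (T ^+ n != 1)%g.
  by move=> /tinf; apply: contra => /eqP /(congr1 val); rewrite gen_valX => /= ->.
have m0 : m != 0 by apply/eqP => m0; have := Tinf k k0; rewrite Tm m0 eqxx.
have m0' : m' != 0.
  apply/eqP => m'0; have := Tinf k' k0'.
  have := zpow_conj T D k'; rewrite /= Tm' m'0 => /esym E.
  have {}E : (D * T ^+ k' = D)%g by rewrite -[RHS]mul1g -(E : _ = 1%g) mulgVK.
  by rewrite -(mulKg D (T ^+ k')%g) E mulVg eqxx.
(* Both powers equal the power of [b] with exponent [m * m']. *)
exists (k'%:Z * m), (k%:Z * m'); split; [by apply: mulf_neq0 => //; rewrite eqz_nat -lt0n..|].
move=> z.
have E : (D * zpow T (k'%:Z * m) * D^-1 = zpow T (k%:Z * m'))%g.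
  rewrite -zpow_conj zpowM /= Tm' -zpowM mulrC.
  by rewrite (zpowM T k%:Z) /= Tm -zpowM.
have := congr1 (fun x => val (zpow x z * D)%g) E.
by rewrite zpow_conj mulgVK -zpowM -zpowM !gen_valM !gen_val_zpow.
Qed.

Lemma ideal_of_infinite_order (r : seq G) (t : G) :
  (forall g, exists2 x, x \in r & stab f h (g * x^-1)%g) -> ~ vcyclic G ->
  (forall S : seq G, (forall s, s \in S -> stab f h s) -> vcyclic (gen_type S)) ->
  stab f h t -> (forall n, (0 < n)%N -> t ^+ n != 1)%g -> ideal f h.
Proof.
move=> rP nvc allvc ht tinf.
have ct z := cP (stab_zpow ff z ht); have [fct _] := cP ht.
have tI := zpow_inj tinf.
have St s : s \in [:: t] -> stab f h s by rewrite inE => /eqP ->.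
have genE s : gen [:: t] s -> exists z, s = zpow t z.
  move=> gs; apply: (gs (fun s => exists z, s = zpow t z)); first by exists 0.
  move=> _ u [z ->]; rewrite inE => /eqP ->; split.
    by exists (z + 1); rewrite zpowD.
  by exists (z - 1); rewrite zpowD zpowN.
have genz z : gen [:: t] (zpow t z).
  have H n : gen [:: t] (t ^+ n)%g.
    by elim: n => [|n IH]; [exact: gen1|rewrite expgS; apply: gen_mul => //; apply: gen_in; rewrite inE].
  by case: z => n; [exact: H|apply: gen_inv; exact: H].
apply: (ideal_of_generated St).
  move=> fin; apply: infinite_nat.
  have := @finite_preimage _ _ _ (fun n : nat => zpow t n%:Z) _ fin.
  rewrite (_ : _ @^-1` _ = setT); last by apply/seteqP; split => // n _; exact: genz.
  by apply => m n _ _ /tI [].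
(* Otherwise every orbit of [t] through a point [d * x0] meets the finite support of [c t]. As the
   stabiliser has finite index, finitely many cosets of the powers of [t] would then cover [G]. *)
have dP : forall x0, exists d, stab f h d /\
    forall z, c t (zpow t z * (d * x0))%g = 0.
  move=> x0; apply: contrapT => nex; apply: nvc.
  pose D := \bigcup_(x in [set` r]) ((fun y => y * x0^-1 * x)%g @` [set y | c t y != 0]).
  have finD : finite_set D.
    by apply: bigcup_finite => // x _; exact: finite_image.
  apply: (vcyclic_zpow (c := t) finD) => g; have [x xr hgx] := rP g.
  have [z cz] : exists z, c t (zpow t z * (g * x^-1 * x0))%g != 0.
    apply: contrapT => nz; apply: nex; exists (g * x^-1)%g; split => // z.
    by apply/eqP/negPn/negP => cz; apply: nz; exists z.
  exists (- z), (zpow t z * (g * x^-1 * x0) * x0^-1 * x)%g; split.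
    by exists x => //; exists (zpow t z * (g * x^-1 * x0))%g.
  by rewrite zpowN -!mulgA mulKg mulVKg mulVg mulg1.
move=> x0; have [d [hd dB]] := dP x0.
have Sd s : s \in [:: t; d] -> stab f h s by rewrite !inE => /orP[]/eqP ->.
have tin : t \in [:: t; d] by rewrite inE eqxx.
have din : d \in [:: t; d] by rewrite !inE eqxx orbT.
have [p [q [p0 q0 pq]]] := conj_commensurate tin din (allvc _ Sd) tinf.
have [fcd _] := cP hd.
pose e z := c (zpow t z) x0.
have estep z : e (z + 1) = c t (zpow t z * x0)%g + e z.
  rewrite /e addrC zpowD cocycleM//; exact: stab_zpow.
have cz0 z : c (zpow t z) (d * x0)%g = 0.
  have step y : c (zpow t (y + 1)) (d * x0)%g = c (zpow t y) (d * x0)%g.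
    rewrite addrC zpowD cocycleM//; last exact: stab_zpow.
    by rewrite dB add0r.
  have H n : c (zpow t n%:Z) (d * x0)%g = 0 /\ c (zpow t (- n%:Z)) (d * x0)%g = 0.
    elim: n => [|n [IH1 IH2]]; first by rewrite oppr0 /= cocycle1.
    split; first by rewrite -addn1 PoszD step.
    by rewrite -IH2 -(step (- n.+1%:Z)); congr (c (zpow t _) _); lia.
  by case: z => n; [have [] := H n|rewrite NegzE; have [] := H n.+1].
(* Evaluate the cocycle at [x0] on both sides of [pq]; its value at [d * x0] vanishes by the choice
   of [d]. For large [z] of either sign only [c d x0] remains. *)
have ep z : e (p * z) = c d x0 - c d (zpow t (p * z) * x0)%g.
  have := congr1 (fun s => c s x0) (pq z); rewrite !cocycleM//; try exact: stab_zpow.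
  by rewrite cz0 /e; lia.
pose Z0 := [set z | c t (zpow t z * x0)%g != 0 \/ c d (zpow t z * x0)%g != 0].
have finZ0 : finite_set Z0.
  have inj : injective (fun z => zpow t z * x0)%g by move=> a b /mulIg /tI.
  rewrite (_ : Z0 = [set z | c t (zpow t z * x0)%g != 0] `|`
                    [set z | c d (zpow t z * x0)%g != 0])//.
  rewrite finite_setU; split.
    by apply: (@finite_preimage _ _ [set y | c t y != 0]) => // a b _ _; exact: inj.
  by apply: (@finite_preimage _ _ [set y | c d y != 0]) => // a b _ _; exact: inj.
have [N NP] := finite_int_bounded finZ0.
have far_t z : (N <= absz z)%N -> c t (zpow t z * x0)%g = 0.
  move=> Nz; apply/eqP/negPn/negP => cz.
  by have := NP z (or_introl cz); lia.
have far_d z : (N <= absz z)%N -> c d (zpow t z * x0)%g = 0.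
  move=> Nz; apply/eqP/negPn/negP => cz.
  by have := NP z (or_intror cz); lia.
have upc n : e (N%:Z + n%:Z) = e N%:Z.
  elim: n => [|n IH]; first by rewrite addr0.
  rewrite -IH -addn1 PoszD addrA estep far_t ?add0r//; lia.
have downc n : e (- N%:Z - n%:Z) = e (- N%:Z).
  elim: n => [|n IH]; first by rewrite subr0.
  rewrite -IH (_ : - N%:Z - n%:Z = - N%:Z - n.+1%:Z + 1); last by lia.
  rewrite estep far_t ?add0r//; lia.
have epN z : (N <= absz (p * z)%R)%N -> e (p * z) = c d x0.
  by move=> Nz; rewrite ep far_d// subr0.
(* Beyond [N] in each direction [e] is constant, and each tail contains a multiple of [p], where
   [epN] gives the value. *)
have far z : (N <= absz z)%N -> e z = c d x0.
  move=> Nz.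
  have [sg sgE] : exists sg, p * sg = (absz p)%:Z.
    by exists (if 0 < p then 1 else -1); case: ifP => pos; lia.
  have pN : (N <= absz p * N)%N by rewrite leq_pmull// absz_gt0.
  have up : e N%:Z = c d x0.
    have E : N%:Z + (absz p * N - N)%N%:Z = p * (sg * N%:Z) by rewrite mulrA sgE; lia.
    by rewrite -(upc (absz p * N - N)%N) E epN// -E; lia.
  have down : e (- N%:Z) = c d x0.
    have E : - N%:Z - (absz p * N - N)%N%:Z = p * (- sg * N%:Z).
      by rewrite mulrA mulrN sgE; lia.
    by rewrite -(downc (absz p * N - N)%N) E epN// -E; lia.
  have [z0|z0] := leP 0 z.
    by rewrite (_ : z = N%:Z + (absz z - N)%N%:Z) ?upc//; lia.
  by rewrite (_ : z = - N%:Z - (absz z - N)%N%:Z) ?downc//; lia.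
exists (c d x0).
apply: sub_finite_set (finite_image (zpow t) (bounded_int_finite N)) => s [/genE[z ->] neq].
exists z => //=; rewrite ltnNge; apply/negP => /far; rewrite /e => E.
by rewrite E eqxx in neq.
Qed.

End Core.

(** * Locally finite stabilisers: division by an integer *)

Lemma convE (G : groupType) (V : nzRingType) (v f : G -> V) g :
  conv v f g = fsum (fun y => v y * f (y^-1 * g)%g).
Proof.
rewrite -(@fsum_reindex _ _ _ (fun k => g * k^-1)%g (fun y => y^-1 * g)%g).
- by apply: eq_fsum => k; rewrite invgM invgK mulgVK.
- by move=> k; rewrite invgM invgK mulgVK.
- by move=> y; rewrite invgM invgK mulVKg.
Qed.

Lemma convA (G : groupType) (V : nzRingType) (a f k : G -> V) g : fsupp f -> fsupp k ->
  conv (conv a f) k g = conv a (conv f k) g.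
Proof.
move=> ff fk; rewrite /conv.
pose A := \bigcup_(j in [set j | k j != 0]) ((fun i => i * j)%g @` [set i | f i != 0]).
have finA : finite_set A by apply: bigcup_finite => // j _; exact: finite_image.
transitivity (fsum (fun j => fsum (fun m => a (g * m^-1)%g * f (m * j^-1)%g * k j))).
  apply: eq_fsum => j; rewrite -fsumZr; last exact: fsuppMr.
  rewrite -[RHS](@fsum_reindex _ _ _ (fun i => i * j)%g (fun m => m * j^-1)%g).
  - by apply: eq_fsum => i; rewrite mulgK invgM mulgA.
  - by move=> i; rewrite mulgK.
  - by move=> i; rewrite mulgVK.
rewrite (@exchange_fsum _ _ _ _ [set j | k j != 0] A)//; last first.
  move=> j m; rewrite /= => neq; have kj : k j != 0.
    by apply: contra neq => /eqP ->; rewrite mulr0.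
  split=> //; exists j => //; exists (m * j^-1)%g; rewrite ?mulgVK//=.
  by apply: contra neq => /eqP ->; rewrite mulr0 mul0r.
apply: eq_fsum => m; rewrite -fsumZl; last exact: fsuppMr.
by apply: eq_fsum => j; rewrite mulrA.
Qed.

Section FiniteSupportGroup.
Variables (G : groupType) (R : realType) (f : G -> int).
Hypothesis ff : fsupp f.
Hypothesis finj : l2_injective (fun x => (f x)%:~R : R).
Variable F : seq G.
Hypotheses (uF : uniq F) (F1 : 1%g \in F).
Hypothesis Fmul : forall y t, y \in F -> f t != 0 ->
  (y * t)%g \in F /\ (y * t^-1)%g \in F.

Let n := size F.
Let x_ (i : 'I_n) : G := tnth (in_tuple F) i.
Let M : 'M[int]_n := \matrix_(i, j) f ((x_ i)^-1 * x_ j)%g.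

Let xF i : x_ i \in F. Proof. exact: mem_tnth. Qed.

Let ord_of y : y \in F -> exists i, y = x_ i.
Proof. by move=> /seq_tnthP[i ->]; exists i. Qed.

Let x_inj : injective x_.
Proof. by have /tuple_uniqP inj : uniq (in_tuple F) := uF; move=> i j; exact: inj. Qed.

Let sumF (V : nmodType) (H : G -> V) : \sum_(y <- F) H y = \sum_(i < n) H (x_ i).
Proof. by rewrite big_tnth. Qed.

(** A kernel vector extended by 0 is finitely supported and annihilated by [f]: since [F] is closed
    under right multiplication by the support of [f], the product has no terms outside [F]. *)
Lemma det_convolution_neq0 : \det M != 0.
Proof.
apply/negP => /eqP det0.
have : \det (map_mx (intr : int -> R) M) = 0 by rewrite det_map_mx det0.
move=> /eqP /det0P[v v0 vM].
pose w y := \sum_(i < n | x_ i == y) v 0 i.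
have wx i : w (x_ i) = v 0 i.
  by rewrite /w (eq_bigl (pred1 i)) ?big_pred1_eq// => j; rewrite /= (inj_eq x_inj).
have w0 y : y \notin F -> w y = 0.
  by move=> yF; apply: big1 => i /eqP E; rewrite -E xF in yF.
have fw : fsupp w.
  apply: (@sub_finite_set _ _ [set` F]) => // y /=.
  by apply: contraNT => /w0 ->.
suff wall y : w y = 0.
  case/eqP: v0; apply/rowP => i; by rewrite -wx wall mxE.
apply: (finj (v := w)) => [|g].
  exists (sqnorm w) => s us; apply: ler_sum_fsum => // [|z]; first exact: fsupp_sqr.
  exact: sqr_ge0.
rewrite convE (fsum_seq uF); last by move=> z /w0 ->; rewrite mul0r.
rewrite sumF; have [/ord_of[j ->]|gF] := boolP (g \in F).
  have := congr1 (fun A : 'rV[R]_n => A 0 j) vM; rewrite [LHS]mxE [RHS]mxE => E; rewrite -[RHS]E.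
  by apply: eq_bigr => i _; rewrite wx !mxE.
apply: big1 => i _; rewrite [f _](_ : _ = 0) ?mulr0//.
apply/eqP/negPn/negP => fi; have [+ _] := Fmul (xF i) fi.
by rewrite mulVKg (negbTE gF).
Qed.

(* [k] is read off from a column of the adjugate of the matrix [M] of convolution by [f]
   on the finite set [F]. *)
Lemma ex_integral_inverse : exists d k, [/\ d != 0, fsupp k &
  forall (a : G -> int) x, conv (conv a f) k x = a x * d].
Proof.
have [i1 E1] := ord_of F1.
pose k z := \sum_(i < n | x_ i == z^-1%g) (\adj M) i i1.
have kx i : k (x_ i)^-1%g = (\adj M) i i1.
  rewrite /k (eq_bigl (pred1 i)) ?big_pred1_eq// => j.
  by rewrite /= invgK (inj_eq x_inj).
have k0 z : z^-1%g \notin F -> k z = 0.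
  by move=> zF; apply: big1 => i /eqP E; rewrite -E xF in zF.
have fk : fsupp k.
  apply: (@sub_finite_set _ _ [set` map (fun y => y^-1%g) F]) => // z /= kz.
  apply/mapP; exists z^-1%g; rewrite ?invgK//.
  by apply: contraNT kz => /k0 ->.
exists (\det M), k; split => //; first exact: det_convolution_neq0.
have fkE z : conv f k z = if z == 1%g then \det M else 0.
  rewrite /conv -(@fsum_reindex _ _ _ (fun y => y^-1)%g (fun y => y^-1)%g);
    [|exact: invgK|exact: invgK].
  rewrite (fsum_seq uF); last by move=> y yF; rewrite k0 ?invgK// mulr0.
  rewrite sumF; under eq_bigr do rewrite kx invgK.
  have [/ord_of[l zl]|zF] := boolP (z^-1%g \in F).
    have -> : z = (x_ l)^-1%g by rewrite -zl invgK.
    transitivity ((M *m \adj M) l i1).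
      by rewrite !mxE; apply: eq_bigr => i _; rewrite !mxE.
    by rewrite mul_mx_adj !mxE invg_eq1 E1 (inj_eq x_inj); case: eqVneq.
  have -> : (z == 1%g) = false.
    by apply/negP => /eqP z1; rewrite z1 invg1 F1 in zF.
  apply: big1 => i _; rewrite [f _](_ : _ = 0) ?mul0r//.
  apply/eqP/negPn/negP => fi; have [_ +] := Fmul (xF i) fi.
  by rewrite invgM mulVKg (negbTE zF).
move=> a x; rewrite convA// /conv (fsum1 (x0 := 1%g)).
  by rewrite -/(conv f k 1%g) fkE eqxx invg1 mulg1.
by move=> y y1; rewrite -/(conv f k y) fkE (negbTE y1) mulr0.
Qed.

End FiniteSupportGroup.

Section Torsion.
Variables (G : groupType) (R : realType) (f h : G -> int).
Hypotheses (ff : fsupp f) (fh : fsupp h).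
Hypothesis finj : l2_injective (fun x => (f x)%:~R : R).
Hypothesis stab_inf : infinite_set (stab f h).

(** Since [f] times [k] is the integer [d], the quotient of [h] by [f] should be [conv h k] divided
    by [d]. Modulo [d] this product is invariant under the infinite stabiliser and finitely
    supported, so it is divisible by [d]. *)
Lemma ideal_of_integral_inverse d k : d != 0 -> fsupp k ->
  (forall (a : G -> int) x, conv (conv a f) k x = a x * d) -> ideal f h.
Proof.
move=> d0 fk inv; pose H := conv h k.
have fH : fsupp H by exact: fsupp_conv.
have HE s x : stab f h s -> exists2 a, fsupp a &
    (forall x, conv a f x = gdiff s h x) /\ gdiff s H x = a x * d.
  move=> [a fa ah]; exists a => //; split => //.
  rewrite -inv -conv_gdiff//; apply: eq_fsum => j; by rewrite ah.
have Hd x : (d %| H x)%Z.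
  have [s hs Hs] := fsupp_translates x fH stab_inf.
  have [a _ [_]] := HE s x hs; rewrite /gdiff Hs sub0r => E.
  by rewrite -[H x]opprK E -mulNr dvdz_mull.
pose b x := (H x %/ d)%Z.
have bE x : b x * d = H x by rewrite /b divzK.
have fb : fsupp b by apply: fsuppS fH _ => x; rewrite /b => ->; rewrite div0z.
exists b => // x; apply/eqP; rewrite -subr_eq0; apply/eqP.
apply: (fsupp_invariant0 (w := fun x => conv b f x - h x)) stab_inf _ x.
  by apply: fsuppB => //; exact: fsupp_conv.
move=> s x hs; apply/eqP; rewrite -subr_eq0; apply/eqP.
have [a fa [ah _]] := HE s x hs.
have aE y : gdiff s b y = a y.
  apply: (mulIf d0); rewrite /gdiff mulrBl !bE.
  have [a' fa' [a'h Ea]] := HE s y hs; rewrite -/(gdiff s H y) Ea.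
  congr (_ * _); apply/eqP; rewrite -subr_eq0; apply/eqP.
  apply: (conv_eq0 (f := f) (a := fun x => a' x - a x) ff finj); first exact: fsuppB.
  by move=> z; rewrite convB// a'h ah subrr.
have := conv_gdiff b s x ff; rewrite (_ : conv (gdiff s b) f x = conv a f x).
  by rewrite ah /gdiff; lia.
by apply: eq_fsum => j; rewrite aE.
Qed.

(** The list [S] consists of Schreier generators for the stabiliser, restricted to the support of
    [f] and its inverses. They generate a finite group, and its translates by the coset
    representatives form the finite set [F] needed for the determinant. *)
Lemma ideal_of_torsion (r : seq G) :
  (forall g, exists2 x, x \in r & stab f h (g * x^-1)%g) ->
  (forall S : seq G, (forall s, s \in S -> stab f h s) -> vcyclic (gen_type S)) ->
  (forall t, stab f h t -> exists2 n, (0 < n)%N & (t ^+ n = 1)%g) -> ideal f h.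
Proof.
move=> rP allvc tors.
have /finite_set_seqP[T0 _ T0P] := ff.
pose T := T0 ++ [seq t^-1 | t <- T0]%g.
pose r' := 1%g :: r.
pose S := [seq s <- [seq p.1 * p.2 | p <- allpairs pair
     (allpairs (fun x t => x * t)%g r' T) [seq y^-1 | y <- r']%g]%g | `[< stab f h s >]].
have Sst s : s \in S -> stab f h s by rewrite mem_filter => /andP[/asboolP].
have finK : finite_set [set: gen_type S].
  apply: vcyclic_torsion_finite; first exact: allvc.
  move=> x; have [n n0 xn] := tors (val x) (gen_stab ff Sst (gen_typeP x)).
  by exists n => //; apply: val_inj; rewrite gen_valX.
have finA : finite_set (\bigcup_(x in [set` r']) ((fun k : gen_type S => val k * x)%g @` setT)).
  by apply: bigcup_finite => // x _; exact: finite_image.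
have /finite_seqP[F0 F0E] := finA.
pose F := undup F0.
have memF y : y \in F <-> exists x k, [/\ x \in r', gen S k & y = (k * x)%g].
  rewrite mem_undup; have -> : (y \in F0) = [set` F0] y :> Prop by [].
  rewrite -F0E; split=> [[x /= xr [k _ <-]]|[x [k [xr gk ->]]]].
    by exists x, (val k); split => //; exact: gen_typeP.
  by exists x => //; exists (Gen gk).
have F1 : 1%g \in F.
  by apply/memF; exists 1%g, 1%g; split; [rewrite inE eqxx|exact: gen1|rewrite mulg1].
have step y t : y \in F -> t \in T -> (y * t)%g \in F.
  move=> /memF[x [k [xr gk ->]]] tT; apply/memF.
  have [z zr hz] := rP (x * t)%g.
  exists z, (k * (x * t * z^-1))%g; split; first by rewrite inE zr orbT.
    apply: gen_mul => //; apply: gen_in; rewrite mem_filter; apply/andP; split.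
      exact/asboolP.
    apply/mapP; exists ((x * t)%g, z^-1%g) => //; apply: allpairs_f.
      by apply: allpairs_f.
    by apply: map_f; rewrite inE zr orbT.
  by rewrite !mulgA mulgVK.
have [y t yF ft|d [k [d0 fk inv]]] :=
  @ex_integral_inverse G R f ff finj F (undup_uniq _) F1.
  split; apply: step => //; rewrite mem_cat; first by rewrite T0P.
  by apply/orP; right; apply: map_f; exact: T0P.
exact: (ideal_of_integral_inverse d0 fk inv).
Qed.

End Torsion.

(** The list [r] meets every right coset of the stabiliser, which encodes finiteness of the
    orbit. *)
Theorem ideal_of_finite_orbit (G : groupType) (R : realType) (f h : G -> int)
    (r : seq G) :
  infinite_set [set: G] -> ~ vcyclic G -> fsupp f -> fsupp h ->
  l2_injective (fun x => (f x)%:~R : R) ->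
  (forall g, exists2 x, x \in r & stab f h (g * x^-1)%g) -> ideal f h.
Proof.
move=> Ginf nvc ff fh finj rP.
have stab_inf : infinite_set (stab f h).
  move=> fin; apply: Ginf.
  have finA : finite_set (\bigcup_(x in [set` r]) ((fun k => k * x)%g @` stab f h)).
    by apply: bigcup_finite => // x _; exact: finite_image.
  apply: sub_finite_set finA => g _; have [x xr hx] := rP g.
  by exists x => //; exists (g * x^-1)%g; rewrite ?mulgVK.
have [c cP] := ex_cocycle f h.
have [[S [Sst nvcS]]|allvc] := pselect (exists S : seq G,
    (forall s, s \in S -> stab f h s) /\ ~ vcyclic (gen_type S)).
  exact: (ideal_of_non_vcyclic ff fh finj cP Sst nvcS).
have {}allvc S : (forall s, s \in S -> stab f h s) -> vcyclic (gen_type S).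
  by move=> Sst; apply: contrapT => nvcS; apply: allvc; exists S.
have [[t [ht tinf]]|tors] := pselect (exists t, stab f h t /\
    forall n, (0 < n)%N -> (t ^+ n != 1)%g).
  exact: (ideal_of_infinite_order ff fh finj cP rP nvc allvc ht tinf).
apply: (ideal_of_torsion ff fh finj stab_inf rP allvc) => t ht.
apply: contrapT => nt; apply: tors; exists t; split => // n n0.
by apply/eqP => tn; apply: nt; exists n.
Qed.

(** * Characters of abelian groups *)

Lemma unit_interval_nint (R : realType) (x : R) : 0 < x < 1 -> x \isn't a Num.int.
Proof.
move=> /andP[x0 x1]; apply/negP => /intrP[z xz].
by move: x0 x1; rewrite xz ltr0z ltrz1; lia.
Qed.

Section Characters.
Variables (V : zmodType) (R : realType) (N : set V).
Hypotheses (N0 : N 0) (NB : forall a b, N a -> N b -> N (a - b)).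

(* Graphs of homomorphisms to [R / Z], defined on a subgroup containing [N] and trivial
   on [N]. *)
Let good (W : set (V * R)) :=
  [/\ forall p q, W p -> W q -> W (p.1 - q.1, p.2 - q.2),
      forall r, W (0, r) -> r \is a Num.int &
      forall a z, N a -> z \is a Num.int -> W (a, z)].

Let good0 W : good W -> W (0, 0).
Proof. by move=> [_ _]; apply => //; exact: rpred0. Qed.

Let goodN W p : good W -> W p -> W (- p.1, - p.2).
Proof.
by move=> gW Wp; have [WB _ _] := gW; have := WB _ _ (good0 gW) Wp; rewrite /= !sub0r.
Qed.

Let goodD W p q : good W -> W p -> W q -> W (p.1 + q.1, p.2 + q.2).
Proof.
by move=> gW Wp Wq; have [WB _ _] := gW; have := WB _ _ Wp (goodN gW Wq); rewrite /= !opprK.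
Qed.

Let goodMz W p z : good W -> W p -> W (p.1 *~ z, p.2 *~ z).
Proof.
move=> gW Wp; have H n : W (p.1 *+ n, p.2 *+ n).
  elim: n => [|n IH]; first exact: good0.
  by rewrite !mulrS; exact: (goodD gW Wp IH).
by case: z => n; [exact: H|rewrite NegzE !mulrNz; exact: (goodN gW (H n.+1))].
Qed.

Lemma character_step W v : good W -> (forall r, ~ W (v, r)) ->
  exists r W', [/\ good W', W `<=` W', W' (v, r) & r \isn't a Num.int].
Proof.
move=> gW vW; have [WB Wint WN] := gW.
suff [r [rint rP]] : exists r, r \isn't a Num.int /\
    forall n s, W (v *~ n, s) -> s - r *~ n \is a Num.int.
  pose W' : set (V * R) := [set p | exists n q, W q /\ p = (v *~ n + q.1, r *~ n + q.2)].
  exists r, W'; split => //.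
  - split.
    + move=> _ _ [n [q [Wq ->]]] [n' [q' [Wq' ->]]].
      exists (n - n'), (q.1 - q'.1, q.2 - q'.2); split; first exact: WB.
      by rewrite /= !mulrzBr; congr pair; rewrite opprD addrACA.
    + move=> s [n [q [Wq [E1 ->]]]].
      have := rP (- n) q.2; rewrite !mulrNz opprK addrC; apply.
      by rewrite (_ : - _ = q.1) -?surjective_pairing//; apply/eqP; rewrite eq_sym -addr_eq0 addrC -E1.
    + move=> a z Na zint; exists 0, (a, z); split; first exact: WN.
      by rewrite !mulr0z !add0r.
  - by move=> p Wp; exists 0, p; rewrite !mulr0z !add0r -surjective_pairing.
  - by exists 1, (0, 0); split; [exact: good0|rewrite /= !mulr1z !addr0].
have [[n [n0 [s Ws]]]|nmul] := pselect (exists n : nat, (0 < n)%N /\ exists s, W (v *+ n, s)).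
  have ex : exists n : nat, (0 < n)%N && `[< exists s, W (v *+ n, s) >].
    by exists n; rewrite n0; apply/asboolP; exists s.
  have [k /andP[k0 /asboolP[rho Wrho]] kmin] := ex_minnP ex.
  have k1 : (1 < k)%N.
    case: k k0 Wrho {kmin} => [|[|k]]// _ Wrho; by case: (vW rho).
  have kn0 : k%:R != 0 :> R by rewrite pnatr_eq0 -lt0n.
  (* The candidates [rho / k] and [(rho + 1) / k] are both admissible modulo integers and differ by
     [1 / k] with [k > 1], so one of them is not an integer. *)
  have [r [rint Wr]] : exists r : R, r \isn't a Num.int /\ W (v *+ k, r *+ k).
    have Wrho1 : W (v *+ k, rho + 1).
      have W1 : W (0, 1) by apply: WN => //; exact: rpred1.
      by have := goodD gW Wrho W1; rewrite /= addr0.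
    have [rint|rint] := boolP (rho / k%:R \is a Num.int); last first.
      by exists (rho / k%:R); split => //; rewrite -(mulr_natr (rho / k%:R)) divfK.
    exists ((rho + 1) / k%:R); split; last by rewrite -(mulr_natr ((rho + 1) / k%:R)) divfK.
    apply/negP => rint1; have := rpredB rint1 rint; apply/negP.
    rewrite -mulrBl addrC addKr mul1r; apply: unit_interval_nint.
    by rewrite invr_gt0 ltr0n k0 invf_lt1 ?ltr0n// ltr1n.
  exists r; split=> // m t Wt.
  have Wm : W (v *~ (m %% k)%Z, t - r *~ ((m %/ k)%Z * k)).
    have := goodMz (m %/ k)%Z gW Wr; rewrite /= !pmulrn -!mulrzA => Wq.
    have := WB _ _ Wt Wq; rewrite /= [k%:Z * _]mulrC -mulrzBr.
    by rewrite (_ : m - (m %/ k)%Z * k = (m %% k)%Z)//; have := divz_eq m k; lia.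
  have mk0 : (0 <= m %% k)%Z by apply: modz_ge0; lia.
  have mklt : (m %% k < k)%Z by apply: ltz_pmod; lia.
  have mk : (m %% k)%Z = 0.
    apply/eqP/negPn/negP => mkn.
    have := kmin `|(m %% k)%Z|%N; rewrite absz_gt0 mkn /=.
    have -> : `[< exists s, W (v *+ `|(m %% k)%Z|%N, s) >].
      by apply/asboolP; eexists; rewrite pmulrn gez0_abs//; exact: Wm.
    by move=> /(_ isT); lia.
  have := Wm; rewrite mk mulr0z => /Wint.
  by rewrite [in X in _ -> X](divz_eq m k) mk addr0.
(* No positive multiple of [v] lies in the domain, so its value is free; one half is not an
   integer. *)
exists (2%:R^-1); split.
  by apply: unit_interval_nint; rewrite invr_gt0 ltr0n invf_lt1 ?ltr0n ?ltr1n.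
move=> m t Wt; have [m0|m0] := eqVneq m 0.
  by move: Wt; rewrite m0 !mulr0z subr0; exact: Wint.
case: nmul; exists `|m|%N; split; first by rewrite absz_gt0.
have := goodMz (sgz m) gW Wt; rewrite /= -mulrzA => Wm; eexists.
by rewrite pmulrn abszEsg mulrC; exact: Wm.
Qed.

(** Divisibility of the circle extends characters one element at a time. The element [h] is treated
    first, so that its nonintegral value is kept by the maximal extension. *)
Lemma ex_character h : ~ N h -> exists phi : V -> R,
  [/\ forall a b, phi (a + b) - (phi a + phi b) \is a Num.int,
      forall a, N a -> phi a \is a Num.int & phi h \isn't a Num.int].
Proof.
move=> Nh; pose W0 : set (V * R) := [set p | N p.1 /\ p.2 \is a Num.int].
have gW0 : good W0.
  split; [|by move=> r []|by []].
  by move=> p q [Np pi] [Nq qi]; split; [exact: NB|exact: rpredB].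
have [|r [W1 [gW1 _ W1h rint]]] := character_step (v := h) gW0; first by move=> r [].
(* Joining [W1] to the sets ordered by Zorn's lemma takes care of the empty chain. *)
have [] := @Zorn_bigcup (V * R)%type [set W | good (W `|` W1)].
  move=> F Fgood Ftot; have [WB1 Wint1 WN1] := gW1.
  have dir p q : (\bigcup_(X in F) X `|` W1) p -> (\bigcup_(X in F) X `|` W1) q ->
      exists W, [/\ good W, W p, W q & W `<=` \bigcup_(X in F) X `|` W1].
    have sub X : F X -> X `|` W1 `<=` \bigcup_(X in F) X `|` W1.
      by move=> FX y [Xy|]; [left; exists X|right].
    move=> [[X FX Xp]|W1p] [[Y FY Yq]|W1q].
    + have [XY|YX] := Ftot X Y FX FY.
        by exists (Y `|` W1); split; [exact: Fgood|left; exact: XY|left|exact: sub].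
      by exists (X `|` W1); split; [exact: Fgood|left|left; exact: YX|exact: sub].
    + by exists (X `|` W1); split; [exact: Fgood|left|right|exact: sub].
    + by exists (Y `|` W1); split; [exact: Fgood|right|left|exact: sub].
    + by exists W1; split => //; right.
  split.
  - move=> p q Up Uq; have [W [[WB _ _] Wp Wq sub]] := dir p q Up Uq.
    exact/sub/WB.
  - move=> s Us; have [W [[_ Wi _] Wp _ _]] := dir _ _ Us Us; exact: Wi.
  - by move=> a z Na zi; right; exact: WN1.
move=> W [gW Wmax].
have total v : exists s, (W `|` W1) (v, s).
  apply: contrapT => /forallNP nv.
  have [s [W' [gW' sub W'v _]]] := character_step gW nv.
  apply: (Wmax W'); last first.
    by rewrite /= (_ : W' `|` W1 = W')//; apply/setUidl => p W1p; apply: sub; right.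
  split; first by move=> p Wp; apply: sub; left.
  by move=> /(_ _ W'v) Wv; apply: (nv s); left.
have [phi phiP] := choice total.
have [WB Wint WN] := gW.
have uniq a s : (W `|` W1) (a, s) -> phi a - s \is a Num.int.
  by move=> Ws; apply: Wint; have := WB _ _ (phiP a) Ws; rewrite /= subrr.
exists phi; split.
- move=> a b; apply: uniq; exact: (goodD gW (phiP a) (phiP b)).
- move=> a Na; have := uniq a 0 (WN _ _ Na (rpred0 _)); by rewrite subr0.
- have := uniq h r (or_intror W1h) => pr; apply: contra rint => pint.
  by have := rpredB pint pr; rewrite opprB addrC subrK.
Qed.

End Characters.

(** * Trigonometric polynomials on the torus *)

Section SignIteration.
Variable R : realType.
Implicit Types t : R.

(* The iterates of this polynomial converge to the sign function on [[-1, 1]]. *)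
Definition steep t : R := 3 / 2 * t - 2^-1 * (t * (t * t)).

Lemma steep_bound t : `|t| <= 1 -> `|steep t| <= 1.
Proof.
rewrite !ler_norml /steep => /andP[t1 t2]; apply/andP; split; rewrite -subr_ge0.
  have -> : 3 / 2 * t - 2^-1 * (t * (t * t)) - -1 = 2^-1 * ((t + 1) ^+ 2 * (2 - t)) by field.
  by rewrite !mulr_ge0// ?sqr_ge0//; lra.
have -> : 1 - (3 / 2 * t - 2^-1 * (t * (t * t))) = 2^-1 * ((1 - t) ^+ 2 * (2 + t)) by field.
by rewrite !mulr_ge0// ?sqr_ge0//; lra.
Qed.

Lemma steepN t : steep (- t) = - steep t.
Proof. by rewrite /steep; ring. Qed.

Lemma iter_steepN n t : iter n steep (- t) = - iter n steep t.
Proof. by elim: n => //= n ->; exact: steepN. Qed.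

Lemma iter_steep_bound n t : `|t| <= 1 -> `|iter n steep t| <= 1.
Proof. by move=> t1; elim: n => //= n; exact: steep_bound. Qed.

(** The identity 1 - steep s = (1 - s)^2 (2 + s) / 2, with iterates staying above [t], shows that
    each step shrinks the distance to 1 by a factor of at most 1 - t/2. *)
Lemma iter_steep_gap n t : 0 < t <= 1 ->
  t <= iter n steep t <= 1 /\ 1 - iter n steep t <= (1 - t / 2) ^+ n.
Proof.
move=> /andP[t0 t1]; elim: n => [|n [/andP[l u] IH]] /=.
  by rewrite lexx t1 expr0; split => //; lra.
move: (iter n steep t) l u IH => s l u IH.
have gap : 1 - steep s <= (1 - s) * (1 - t / 2).
  have -> : 1 - steep s = (1 - s) * ((1 - s) * (2 + s) / 2) by rewrite /steep; field.
  by apply: ler_wpM2l; [lra|nra].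
have p0 : 0 <= (1 - s) * (1 - t / 2) by apply: mulr_ge0; lra.
split.
  apply/andP; split; first by rewrite /steep; nra.
  have : `|s| <= 1 by rewrite ler_norml; apply/andP; split; lra.
  by move=> /steep_bound; rewrite ler_norml => /andP[].
apply: le_trans gap _; rewrite exprSr; apply: ler_wpM2r => //; lra.
Qed.

Lemma iter_steep_cvg t : `|t| <= 1 ->
  (fun n => iter n steep t) @ \oo --> Num.sg t.
Proof.
have pos s : 0 < s <= 1 -> (fun n => iter n steep s) @ \oo --> (1 : R).
  move=> s01; apply/cvgrPdist_le => e e0.
  have q1 : `|1 - s / 2| < 1 by rewrite ltr_norml; lra.
  have /cvgrPdist_le /(_ _ e0)[N _ NP] := cvg_expr q1.
  exists N => // n /= Nn; have := NP n Nn; rewrite sub0r normrN.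
  have [/andP[_ u] g] := iter_steep_gap n s01.
  by move=> h; rewrite ger0_norm ?subr_ge0//; exact: le_trans g (le_trans (ler_norm _) h).
rewrite ler_norml => /andP[t1 t2]; have [t0|t0|->] := ltgtP t 0.
- rewrite ltr0_sg// (_ : (fun n => _) = (fun n => - iter n steep (- t))); last first.
    by apply/funext => n; rewrite iter_steepN opprK.
  by apply: cvgN; apply: pos; rewrite oppr_gt0 t0 /= lerNl.
- by rewrite gtr0_sg//; apply: pos; rewrite t0.
- rewrite sgr0 (_ : (fun n => _) = fun=> 0); first exact: cvg_cst.
  apply/funext; elim=> //= n ->; by rewrite /steep; ring.
Qed.

End SignIteration.

Section Trig.
Variable R : realType.
Implicit Types x r : R.

Lemma cosD2piMn x n : cos (x + 2 * pi * n%:R) = cos x.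
Proof.
elim: n => [|n IH]; first by rewrite mulr0 addr0.
have -> : x + 2 * pi * n.+1%:R = x + 2 * pi * n%:R + pi *+ 2.
  by rewrite -[n.+1]addn1 natrD -(mulr_natl pi); ring.
by rewrite cosD2pi.
Qed.

Lemma cosD2piMz x (z : int) : cos (x + 2 * pi * z%:~R) = cos x.
Proof.
case: z => n; first exact: cosD2piMn.
rewrite NegzE mulrNz mulrN -[LHS](cosD2piMn _ n.+1); congr cos.
by rewrite -pmulrn; ring.
Qed.

Lemma cos2pi_eq1 x : cos (2 * pi * x) = 1 -> x \is a Num.int.
Proof.
move=> c1; have fx := floor_itv x; set f := Num.floor x in fx.
have pi0 := pi_gt0 R.
have : cos (2 * pi * (x - f%:~R)) = 1.
  by rewrite -(cosD2piMz _ f) -[RHS]c1; congr cos; ring.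
have [y0|y0] := eqVneq (x - f%:~R) 0.
  by move=> _; rewrite -(subrK f%:~R x) y0 add0r intr_int.
have /andP[f0 f1] := fx; move: f1; rewrite intrD => f1.
have s0 : 0 < sin (pi * (x - f%:~R)).
  apply: sin_gt0_pi; apply/andP; split.
    by apply: mulr_gt0 => //; rewrite lt_neqAle eq_sym y0 subr_ge0.
  by rewrite gtr_pMr//; lra.
rewrite (_ : 2 * pi * _ = (pi * (x - f%:~R)) *+ 2); last by rewrite mulr2n; ring.
rewrite cos_mulr2n cos2sin2 => E; exfalso.
have : sin (pi * (x - f%:~R)) ^+ 2 = 0 by lra.
by move=> /eqP; rewrite sqrf_eq0 gt_eqF.
Qed.

Lemma cos_reflect x : cos (2 * pi * x) = cos (2 * pi * (1 - x)).
Proof. by rewrite -cosN -(cosD2piMz _ 1); congr cos; ring. Qed.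

Lemma sin_ge0_half x : 0 <= x < 1 -> (0 <= sin (2 * pi * x)) = (x <= 2^-1).
Proof.
move=> /andP[x0 x1]; have pi0 := pi_gt0 R.
have [xh|xh] := leP x 2^-1.
  apply: sin_ge0_pi; rewrite !mulr_ge0 ?(ltW pi0)//=.
  by rewrite mulrAC; rewrite ger_pMl//; lra.
apply/negbTE; rewrite -ltNge (_ : 2 * pi * x = (pi * (2 * x - 1)) + pi); last by ring.
rewrite sinDpi oppr_lt0; apply: sin_gt0_pi; apply/andP; split.
  by apply: mulr_gt0 => //; lra.
by rewrite gtr_pMr//; lra.
Qed.

Lemma cos_lt_half x r : 0 <= x <= 2^-1 -> 0 <= r <= 2^-1 ->
  (cos (2 * pi * r) < cos (2 * pi * x)) = (x < r).
Proof.
have pi0 := pi_gt0 R.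
have H y : 0 <= y <= 2^-1 -> 2 * pi * y \in `[0, (pi : R)].
  move=> /andP[y0 y1]; rewrite in_itv/= !mulr_ge0 ?(ltW pi0)//=.
  by rewrite mulrAC ger_pMl//; lra.
move=> xh rh; rewrite ltr_cos ?H//.
by rewrite ltr_pM2l// mulr_gt0.
Qed.

End Trig.

Section TrigPolynomials.
Variables (G : countType) (R : realType).
Local Notation T := (TorusSpace G R).
Implicit Types (h : G -> int) (t : R) (x : G -> R).

Definition pairing h x : R := fsum (fun g => (h g)%:~R * x g).

(** The real part of a character of the torus times a unit complex number. The phase [t] makes
    products and translates stay in this real family. *)
Definition chi h t x : R := cos (2 * pi * pairing h x + t).

Lemma fsupp_pairing h x : fsupp h -> fsupp (fun g => (h g)%:~R * x g : R).
Proof. by move=> fh; apply: fsuppS fh _ => g ->; rewrite mul0r. Qed.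

Lemma pairingD h h' x : fsupp h -> fsupp h' ->
  pairing (fun g => h g + h' g) x = pairing h x + pairing h' x.
Proof.
move=> fh fh'; rewrite -fsumD; [|exact: fsupp_pairing..].
by apply: eq_fsum => g; rewrite intrD mulrDl.
Qed.

Lemma pairingB h h' x : fsupp h -> fsupp h' ->
  pairing (fun g => h g - h' g) x = pairing h x - pairing h' x.
Proof.
move=> fh fh'; rewrite -fsumB; [|exact: fsupp_pairing..].
by apply: eq_fsum => g; rewrite intrB mulrBl.
Qed.

Lemma pairing_delta g0 x : pairing (fun g => (g == g0)%:R) x = x g0.
Proof.
rewrite /pairing (fsum1 (x0 := g0)) ?eqxx ?mul1r// => g gg0.
by rewrite (negbTE gg0) mul0r.
Qed.

Lemma fsupp_delta (g0 : G) : fsupp (fun g => (g == g0)%:R : int).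
Proof.
apply: (@sub_finite_set _ _ [set g0]) => // g /=.
by have [->|_] := eqVneq g g0; rewrite ?mulr0n ?eqxx.
Qed.

Lemma measurable_coord g : measurable_fun [set: T] (fun x : T => (x : G -> R) g).
Proof.
move=> _ B mB; rewrite setTI; apply: sub_sigma_algebra.
by exists g, B.
Qed.

Lemma measurable_pairing h : fsupp h ->
  measurable_fun [set: T] (fun x : T => pairing h x).
Proof.
move=> fh; have /fsuppP[s us sh] := fh.
rewrite (_ : (fun x : T => _) = fun x : T => \sum_(g <- s) (h g)%:~R * (x : G -> R) g).
  apply: measurable_sum => g; apply: measurable_funM => //; exact: measurable_coord.
by apply/funext => x; rewrite /pairing (fsum_seq us)// => g /sh ->; rewrite mul0r.
Qed.

Lemma measurable_chi h t : fsupp h -> measurable_fun [set: T] (fun x : T => chi h t x).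
Proof.
move=> fh; apply: (measurableT_comp (f := @cos R)).
  by apply: continuous_measurable_fun; exact: continuous_cos.
apply: measurable_funD => //; apply: measurable_funM => //; exact: measurable_pairing.
Qed.

Inductive trig : ((G -> R) -> R) -> Prop :=
| trig_chi h t : fsupp h -> trig (chi h t)
| trig_add p q : trig p -> trig q -> trig (fun x => p x + q x)
| trig_scale a p : trig p -> trig (fun x => a * p x).

Lemma trig_ext p q : (forall x, p x = q x) -> trig p -> trig q.
Proof. by move=> /funext ->. Qed.

Lemma trig_cst a : trig (fun=> a).
Proof.
have f0 : fsupp (fun _ : G => 0 : int).
  by apply: (@sub_finite_set _ _ set0) => // x /=; rewrite eqxx.
apply: trig_ext (trig_scale a (trig_chi 0 f0)) => x.
rewrite /chi /pairing (eq_fsum (G := fun=> 0)) => [|g]; last by rewrite mul0r.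
by rewrite fsum0 mulr0 addr0 cos0 mulr1.
Qed.

Lemma trig_mul p q : trig p -> trig q -> trig (fun x => p x * q x).
Proof.
elim=> [h t fh|p1 p2 _ IH1 _ IH2|a p1 _ IH] tq.
- elim: tq => [h' t' fh'|q1 q2 _ IH1 _ IH2|a q1 _ IH].
  + have fD : fsupp (fun g => h g + h' g) by exact: fsuppD.
    have fB : fsupp (fun g => h g - h' g) by exact: fsuppB.
    apply: trig_ext (trig_scale 2^-1 (trig_add (trig_chi (t + t') fD)
      (trig_chi (t - t') fB))) => x.
    rewrite /chi pairingD// pairingB//.
    rewrite (_ : 2 * pi * (pairing h x + pairing h' x) + (t + t') =
      (2 * pi * pairing h x + t) + (2 * pi * pairing h' x + t')); last by ring.
    rewrite (_ : 2 * pi * (pairing h x - pairing h' x) + (t - t') =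
      (2 * pi * pairing h x + t) - (2 * pi * pairing h' x + t')); last by ring.
    by rewrite cosD cosB; field.
  + by apply: trig_ext (trig_add IH1 IH2) => x; rewrite mulrDr.
  + by apply: trig_ext (trig_scale a IH) => x; rewrite mulrCA.
- by apply: trig_ext (trig_add (IH1 tq) (IH2 tq)) => x; rewrite mulrDl.
- by apply: trig_ext (trig_scale a (IH tq)) => x; rewrite mulrA.
Qed.

Lemma trig_iter_steep n p : trig p -> trig (fun x => iter n (@steep R) (p x)).
Proof.
move=> tp; elim: n => //= n IH.
apply: trig_ext (trig_add (trig_scale (3 / 2) IH)
  (trig_scale (- 2^-1) (trig_mul IH (trig_mul IH IH)))) => x.
by rewrite /steep mulNr.
Qed.

Lemma trig_measurable p : trig p -> measurable_fun [set: T] (fun x : T => p x).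
Proof.
elim=> [h t fh|p1 p2 _ IH1 _ IH2|a p1 _ IH].
- exact: measurable_chi.
- exact: measurable_funD.
- exact: measurable_funM.
Qed.

Lemma chi_bound h t x : `|chi h t x| <= 1. Proof. exact: cos_max. Qed.

Lemma trig_bound p : trig p -> exists M, forall x, `|p x| <= M.
Proof.
elim=> [h t fh|p1 p2 _ [M1 H1] _ [M2 H2]|a p1 _ [M H]].
- by exists 1 => x; exact: chi_bound.
- by exists (M1 + M2) => x; apply: le_trans (ler_normD _ _) (lerD (H1 x) (H2 x)).
- by exists (`|a| * M) => x; rewrite normrM ler_wpM2l.
Qed.

Definition torus : set T := [set x : T | torus_pt (x : G -> R)].

Lemma measurable_torus : measurable torus.
Proof.
have -> : torus = \bigcap_(n in [set: nat])
    (if unpickle n is Some g then [set x : T | 0 <= (x : G -> R) g < 1] else setT).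
  apply/seteqP; split=> x.
    by move=> tx n _; case: (unpickle n) => // g; exact: tx.
  by move=> tx g; have := tx (pickle g) I; rewrite pickleK.
apply: bigcapT_measurable => n; case: (unpickle n) => // g.
rewrite (_ : [set x : T | _] = [set: T] `&` (fun x : T => (x : G -> R) g) @^-1` `[0, 1[%classic).
  by apply: measurable_coord.
by rewrite setTI; apply/seteqP; split => x /=; rewrite in_itv.
Qed.

Definition bounded_by (M : R) (p : T -> R) := forall x, `|p x| <= M.

(** Captures what the uniqueness theorem needs of an integral without positivity, so that it applies
    to differences of two means. *)
Definition dominated_functional (E : (T -> R) -> R) : Prop :=
  [/\ forall (p q : T -> R) M, measurable_fun [set: T] p -> measurable_fun [set: T] q ->
        bounded_by M p -> bounded_by M q -> E (fun x => p x + q x) = E p + E q,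
      forall a (p : T -> R) M, measurable_fun [set: T] p -> bounded_by M p ->
        E (fun x => a * p x) = a * E p &
      forall (p_ : nat -> T -> R) (p : T -> R) M, (forall n, measurable_fun [set: T] (p_ n)) ->
        measurable_fun [set: T] p -> (forall n, bounded_by M (p_ n)) ->
        (forall x, torus x -> (fun n => p_ n x) @ \oo --> p x) ->
        (fun n => E (p_ n)) @ \oo --> E p].

(* Convergence is only required on the torus, so that the measurable subsets of its
   complement qualify and cylinders over arbitrary reals are generated. *)
Definition trig_approximable (B : set T) := measurable B /\
  exists (p_ : nat -> (G -> R) -> R) M, [/\ forall n, trig (p_ n),
    forall n x, `|p_ n x| <= M &
    forall x, torus x -> (fun n => p_ n x) @ \oo --> (\1_B x : R)].

Lemma trig_approximableI : setI_closed trig_approximable.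
Proof.
move=> A B [mA [p [M [tp pM pA]]]] [mB [q [N [tq qN qB]]]].
split; first exact: measurableI.
exists (fun n x => p n x * q n x), (M * N); split.
- by move=> n; exact: trig_mul.
- by move=> n x; rewrite normrM; apply: ler_pM.
- by move=> x tx; rewrite indicI; apply: cvgM; [exact: pA|exact: qB].
Qed.

Lemma trig_approximableT : trig_approximable setT.
Proof.
split=> //; exists (fun=> fun=> 1), 1; split.
- by move=> n; exact: trig_cst.
- by move=> n x; rewrite normr1.
- by move=> x _; rewrite indicT; exact: cvg_cst.
Qed.

Lemma trig_approximable_off_torus B : measurable B -> B `<=` ~` torus -> trig_approximable B.
Proof.
move=> mB Bt; split=> //; exists (fun=> fun=> 0), 0; split.
- by move=> n; exact: trig_cst.
- by move=> n x; rewrite normr0.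
- move=> x tx; rewrite indicE (memNset _); first exact: cvg_cst.
  by move=> Bx; exact: Bt Bx tx.
Qed.

(** With s the sign of [p x], the indicator is (s + s^2) / 2, and s is the limit of the iterates of
    [steep], which are trigonometric polynomials. *)
Lemma trig_approximable_pos p : trig p -> (forall x, `|p x| <= 1) ->
  trig_approximable [set x : T | 0 < p x].
Proof.
move=> tp p1; split.
  rewrite -[X in measurable X]setTI; have := trig_measurable tp.
  move=> /(_ measurableT `]0, +oo[%classic (measurable_itv _)).
  congr (measurable (_ `&` _)); apply/seteqP; split => x /=; by rewrite in_itv/= andbT.
exists (fun n x => 2^-1 * (iter n (@steep R) (p x) + iter n (@steep R) (p x) * iter n (@steep R) (p x))), 1; split.
- move=> n; have ts := trig_iter_steep n tp.
  exact: trig_scale (trig_add ts (trig_mul ts ts)).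
- move=> n x; have := iter_steep_bound n (p1 x); move: (iter _ _ _) => s.
  by rewrite !ler_norml => /andP[? ?]; apply/andP; split; nra.
- move=> x _; have c := iter_steep_cvg (p1 x).
  have -> : \1_[set x : T | 0 < p x] x = 2^-1 * (Num.sg (p x) + Num.sg (p x) * Num.sg (p x)) :> R.
    rewrite indicE; have [p0|p0|p0] := ltgtP (p x) 0.
    - rewrite ltr0_sg// memNset /=; last by rewrite ltNge (ltW p0).
      by rewrite mulrNN mulr1 addNr mulr0.
    - by rewrite gtr0_sg// mem_set//= mulr1; field.
    - rewrite p0 sgr0 memNset /=; last by rewrite p0 ltxx.
      by rewrite mulr0 addr0 mulr0.
  apply: cvgM; first exact: cvg_cst.
  by apply: cvgD => //; apply: cvgM.
Qed.

Let generated := <<s trig_approximable >>.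

(** The cosine of a coordinate determines it only up to reflection; the sign of the sine tells the
    two halves of the circle apart. *)
Lemma generated_ray g r : generated [set x : T | (x : G -> R) g < r].
Proof.
have sub : trig_approximable `<=` generated by exact: sub_sigma_algebra.
have [SC SI SU] : [/\ forall A, generated A -> generated (~` A),
    forall A B, generated A -> generated B -> generated (A `&` B) &
    forall A B, generated A -> generated B -> generated (A `|` B)].
  pose GT := g_sigma_algebraType trig_approximable.
  split=> [A|A B|A B].
  - exact: (@measurableC _ GT).
  - exact: (@measurableI _ GT).
  - exact: (@measurableU _ GT).
pose c t (x : G -> R) := cos (2 * pi * x g + t).
have tc t : trig (c t).
  apply: trig_ext (trig_chi t (fsupp_delta g)) => x.
  by rewrite /chi pairing_delta.
have gpos s t a : `|a| <= 1 -> `|s| <= 1 -> generated [set x : T | 0 < a * (c t x - s)].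
  move=> a1 s1; rewrite (_ : [set x : T | _] =
      [set x : T | 0 < a * 2^-1 * (c t x) + - (a * 2^-1 * s)]); last first.
    apply/seteqP; split => x /=; rewrite (_ : a * 2^-1 * c t x + - _ = a * (c t x - s) / 2).
    - by move=> h; rewrite divr_gt0.
    - by field.
    - by rewrite pmulr_lgt0// invr_gt0.
    - by field.
  apply: sub; apply: (@trig_approximable_pos (fun x => a * 2^-1 * c t x + - (a * 2^-1 * s))).
    exact: (trig_add (trig_scale (a * 2^-1) (tc t)) (trig_cst (- (a * 2^-1 * s)))).
  move=> x; rewrite (_ : a * 2^-1 * c t x + - _ = a * ((c t x - s) / 2)); last by field.
  rewrite normrM mulr_ile1//.
  have := cos_max (2 * pi * x g + t); rewrite -/(c t x) => c1.
  by move: c1 s1; rewrite !ler_norml => /andP[? ?] /andP[? ?]; apply/andP; split; lra.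
have mZ : @measurable _ T (~` torus) by exact: (measurableC measurable_torus).
have gZ : generated (~` torus) by apply: sub; exact: trig_approximable_off_torus.
have gT : generated torus by rewrite -(setCK torus); exact: SC.
have mray : measurable [set x : T | (x : G -> R) g < r].
  rewrite -[X in measurable X]setTI.
  have := @measurable_coord g measurableT `]-oo, r[%classic (measurable_itv _).
  by congr (measurable (_ `&` _)); apply/seteqP; split => x /=; rewrite in_itv.
suff [P gP PE] : exists2 P : set T, generated P &
    forall x, torus x -> (P x <-> (x : G -> R) g < r).
  rewrite (_ : [set x : T | _] =
    ([set x : T | (x : G -> R) g < r] `&` ~` torus) `|` (torus `&` P)).
    apply: SU; last exact: SI.
    apply: sub; apply: trig_approximable_off_torus; last by move=> x [].
    exact: measurableI.
  apply/seteqP; split=> x /=.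
    have [tx|tx] := pselect (torus x); last by left.
    by move=> xr; right; split => //; apply/PE.
  by case=> [[]//|[tx /(PE _ tx)]].
have gset0 : generated set0 by rewrite -setCT; apply: SC; apply: sub; exact: trig_approximableT.
have [r0|r0] := leP r 0.
  exists set0 => // x tx; split=> // xr.
  by have /andP[x0 _] := tx g; have := lt_le_trans xr r0; rewrite ltNge x0.
have [r1|r1] := leP 1 r.
  exists setT; first by rewrite -setC0; exact: SC.
  by move=> x tx; split => // _; have /andP[_ x1] := tx g; exact: lt_le_trans r1.
(* With phase [- (pi / 2)] the cosine becomes a sine, so on the torus [S] is the half where the
   coordinate is at most 1/2. *)
pose S : set T := ~` [set x : T | 0 < -1 * (c (- (pi / 2)) x - 0)].
have gS : generated S by apply: SC; apply: gpos; rewrite ?normrN ?normr1 ?normr0.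
have SE x : torus x -> (S x <-> (x : G -> R) g <= 2^-1).
  move=> tx; rewrite -(sin_ge0_half (tx g)) /S /= /c cosBpihalf subr0 mulN1r oppr_gt0.
  by rewrite leNgt; split=> [/negP|/negP].
have cr1 : `|cos (2 * pi * r)| <= 1 by exact: cos_max.
have [rh|rh] := leP r 2^-1.
  exists (S `&` [set x : T | 0 < 1 * (c 0 x - cos (2 * pi * r))]).
    by apply: SI => //; apply: gpos; rewrite ?normr1.
  move=> x tx; have /andP[x0 x1] := tx g.
  rewrite /= mul1r subr_gt0 /c addr0; split.
    move=> [/(SE _ tx) xh]; rewrite cos_lt_half ?xh ?x0 ?rh ?(ltW r0)//.
  move=> xr; have xh : (x : G -> R) g <= 2^-1 by apply: le_trans (ltW xr) rh.
  split; first exact/SE.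
  by rewrite cos_lt_half ?xh ?x0 ?rh ?(ltW r0).
exists (S `|` [set x : T | 0 < -1 * (c 0 x - cos (2 * pi * r))]).
  by apply: SU => //; apply: gpos; rewrite ?normrN ?normr1.
move=> x tx; have /andP[x0 x1] := tx g.
rewrite /= mulN1r opprB subr_gt0 /c addr0.
have [xh|xh] := leP ((x : G -> R) g) 2^-1.
  by split=> [_|_]; [exact: le_lt_trans rh|left; apply/SE].
rewrite (cos_reflect (_ g)) (cos_reflect r) cos_lt_half; [|apply/andP; split; lra..].
rewrite (_ : (1 - r < 1 - _) = ((x : G -> R) g < r)); last by apply/idP/idP; lra.
split=> [[/(SE _ tx)|//]|]; last by right.
by rewrite leNgt xh.
Qed.

Lemma measurable_generated : @measurable _ T = generated.
Proof.
apply/seteqP; split; last first.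
  apply: smallest_sub; last by move=> B [].
  exact: sigma_algebra_measurable.
apply: smallest_sub; first exact: smallest_sigma_algebra.
move=> _ [g [B [mB ->]]].
pose GT := g_sigma_algebraType trig_approximable.
have : measurable_fun [set: GT] (fun x : GT => (x : G -> R) g).
  apply: (measurability (@RGenInftyO.G R)); first exact: RGenInftyO.measurableE.
  move=> _ [_ [r ->] <-]; rewrite setTI.
  rewrite (_ : _ @^-1` _ = [set x : T | (x : G -> R) g < r]); first exact: generated_ray.
  by apply/seteqP; split => x /=; rewrite in_itv.
by move=> /(_ measurableT B mB); rewrite setTI.
Qed.

Lemma functional_trig0 E : dominated_functional E ->
  (forall h t, fsupp h -> E (fun x : T => chi h t x) = 0) ->
  forall p, trig p -> E (fun x : T => p x) = 0.
Proof.
move=> [ED EZ _] E0 p; elim=> [h t fh|p1 p2 tp1 IH1 tp2 IH2|a p1 tp1 IH].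
- exact: E0.
- have [M1 H1] := trig_bound tp1; have [M2 H2] := trig_bound tp2.
  rewrite (ED (fun x : T => p1 x) (fun x : T => p2 x) (Num.max M1 M2)).
  + by rewrite IH1 IH2 addr0.
  + exact: trig_measurable.
  + exact: trig_measurable.
  + by move=> x; rewrite le_max H1.
  + by move=> x; rewrite le_max H2 orbT.
- have [M1 H1] := trig_bound tp1.
  by rewrite (EZ a (fun x : T => p1 x) M1) ?IH ?mulr0//; exact: trig_measurable.
Qed.

(** Fourier uniqueness through Dynkin's theorem: approximable sets are closed under intersection and
    generate the sigma-algebra, and the sets on which [E] vanishes form a Dynkin system. *)
Theorem functional_indic0 E : dominated_functional E ->
  (forall h t, fsupp h -> E (fun x : T => chi h t x) = 0) ->
  forall B, measurable B -> E (\1_B : T -> R) = 0.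
Proof.
move=> dE E0 B mB; have Etrig := functional_trig0 dE E0; have [ED EZ EL] := dE.
have b1 (A : set T) : bounded_by 1 (\1_A : T -> R).
  by move=> x; rewrite indicE; case: (_ \in _); rewrite ?normr1 ?normr0.
have mI (A : set T) : measurable A -> measurable_fun [set: T] (\1_A : T -> R).
  by move=> mA; exact: measurable_indic.
apply: (dynkin_induction (G := trig_approximable) (P := fun B => E (\1_B : T -> R) = 0)).
- exact: measurable_generated.
- exact: trig_approximableI.
- by rewrite indicT; apply: (Etrig (fun=> 1)); exact: trig_cst.
- move=> A [mA [p [M [tp pM pA]]]].
  have c1 := EL (fun n x => p n x) (\1_A : T -> R) M (fun n => trig_measurable (tp n))
    (mI _ mA) pM pA.
  apply: (cvg_unique (@Rhausdorff R) c1).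
  rewrite (_ : (fun n => _) = fun=> 0); first exact: cvg_cst.
  by apply/funext => n; exact: Etrig.
- move=> A mA EA.
  have ET : E (\1_[set: T] : T -> R) = 0.
    by rewrite indicT; apply: (Etrig (fun=> 1)); exact: trig_cst.
  have := ED (\1_A : T -> R) (\1_(~` A) : T -> R) 1 (mI _ mA) (mI _ (measurableC mA)) (b1 _) (b1 _).
  rewrite EA add0r => <-; rewrite -[RHS]ET; congr E; apply/funext => x.
  by rewrite !indicE in_setC in_setT; case: (x \in A); rewrite ?addr0 ?add0r.
- move=> F mF tF EF.
  pose U n := \big[setU/set0]_(k < n) F k.
  have mU n : measurable (U n) by exact: bigsetU_measurable.
  have EU n : E (\1_(U n) : T -> R) = 0.
    elim: n => [|n IH].
      rewrite /U big_ord0 indic0; apply: (Etrig (fun=> 0)); exact: trig_cst.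
    rewrite -[RHS]addr0 -{1}IH -(EF n).
    rewrite -(ED _ _ 1 (mI _ (mU n)) (mI _ (mF n)) (b1 _) (b1 _)); congr E; apply/funext => x.
    rewrite !indicE /U big_ord_recr /= in_setU.
    have [xU|xU] := boolP (x \in \big[setU/set0]_(k < n) F k); last by rewrite add0r.
    rewrite memNset ?addr0// => xF; move: xU; rewrite inE -bigcup_mkord => -[k /= kn xk].
    have /trivIsetP/(_ k n I I) := tF; rewrite neq_ltn kn => /(_ isT).
    by move=> /seteqP[/(_ x (conj xk xF))].
  have c1 := EL (fun n => \1_(U n) : T -> R) (\1_(\bigcup_k F k) : T -> R) 1
    (fun n => mI _ (mU n)) (mI _ (bigcupT_measurable _ mF)) (fun n => b1 _).
  apply: (cvg_unique (@Rhausdorff R) (c1 _)).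
    move=> x _; have [[k _ Fk]|nF] := pselect ((\bigcup_k F k) x).
      rewrite indicE mem_set; last by exists k.
      apply: cvg_near_cst; exists k.+1 => // n /= kn.
      by rewrite indicE mem_set// /U -bigcup_mkord; exists k.
    rewrite indicE memNset//; apply: cvg_near_cst; apply: nearW => n.
    rewrite indicE memNset// /U -bigcup_mkord => -[k _ Fk].
    by apply: nF; exists k.
  rewrite (_ : (fun n => _) = fun=> 0); first exact: cvg_cst.
  by apply/funext => n; exact: EU.
- by rewrite -/generated -measurable_generated.
Qed.

End TrigPolynomials.

(** * The given group law and the duality between X_f and the ideal *)

Lemma mulrz_fct (T : Type) (V : zmodType) (F : T -> V) (z : int) x : (F *~ z) x = F x *~ z.
Proof.
have H n : (F *+ n) x = F x *+ n by elim: n => [|n IH]; rewrite ?mulr0n// !mulrS -IH.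
by case: z => n; [exact: H|rewrite NegzE !mulrNz -[in RHS]pmulrn -H].
Qed.

(** An alias that remembers [L], so that the group structure can be attached to it canonically. *)
Definition law_type (G : countType) (L : group_law G) : Type := G.

Section LawGroup.
Variables (G : countType) (L : group_law G).

HB.instance Definition _ := Countable.copy (law_type L) G.

Lemma law_mulgV (x : law_type L) : gmul L x (ginv L x) = gone L.
Proof.
rewrite -[LHS](gmul1g L) -{1}(gmulVg L (ginv L x)) -gmulA.
by rewrite [gmul L (ginv L x) _](gmulA L) gmulVg gmul1g gmulVg.
Qed.

Lemma law_mulg1 (x : law_type L) : gmul L x (gone L) = x.
Proof. by rewrite -(gmulVg L x) gmulA law_mulgV gmul1g. Qed.

HB.instance Definition _ := isGroup.Build (law_type L)
  (gmulA L) (gmul1g L) law_mulg1 (gmulVg L) law_mulgV.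

Local Notation K := (law_type L).

Lemma law_mulE (x y : K) : gmul L x y = (x * y)%g. Proof. by []. Qed.
Lemma law_invE (x : K) : ginv L x = (x^-1)%g. Proof. by []. Qed.

Lemma gpown_expg (x : K) n : gpown L x n = (x ^+ n)%g.
Proof. by elim: n => //= n ->; rewrite expgS. Qed.

Lemma gpowz_zpow (x : K) z : gpowz L x z = zpow x z.
Proof. by case: z => n; rewrite /gpowz gpown_expg. Qed.

Lemma vcyclic_virtually_cyclic : vcyclic K -> virtually_cyclic L.
Proof.
move=> [c [D [/finite_set_seqP[s _ sD] H]]].
exists c, [seq d^-1 | d <- s]%g => x.
have [m [n [d [Dd E]]]] := H ((x : K)^-1)%g.
exists (d^-1)%g; first by apply: map_f; exact: sD.
exists (m%:Z - n%:Z); rewrite gpowz_zpow zpow_subn law_mulE.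
by rewrite -[x in LHS](invgK (x : K)) E !invgM invgK.
Qed.

Variable R : realType.

Lemma gconv_conv (v : K -> R) (f : K -> int) g : fsupp f ->
  gconv L v f g = conv v (fun x => (f x)%:~R) g.
Proof.
move=> ff; rewrite convE; apply: fsbig_widen => // k /= [_ nk].
have -> : f ((k : K)^-1 * g)%g = 0 by apply/eqP/negPn/negP.
by rewrite mulr0.
Qed.

Lemma bounded_in_l2 (v : K -> R) C :
  (forall s, uniq s -> \sum_(x <- s) v x ^+ 2 <= C) -> in_l2 v.
Proof.
move=> H; rewrite /in_l2; apply: (@le_lt_trans _ _ C%:E); last exact: ltry.
apply: ge_ereal_sup => _ [A [finA _] <-].
by rewrite sumEFin lee_fin; apply: H; exact: finite_support_uniq.
Qed.

Lemma l2_injective_of_gconv (f : K -> int) : fsupp f ->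
  [set v : K -> R | in_l2 v /\ gconv L v f = (fun=> 0)] = [set (fun=> 0)] ->
  l2_injective (fun x => (f x)%:~R : R).
Proof.
move=> ff E v [C vC] v0 x.
have : [set v : K -> R | in_l2 v /\ gconv L v f = (fun=> 0)] v.
  split; first exact: bounded_in_l2 vC.
  by apply/funext => g; rewrite gconv_conv.
by rewrite E => ->.
Qed.

Lemma tfrac_eq0 (r : R) : tfrac r = 0 <-> r \is a Num.int.
Proof.
rewrite /tfrac; split=> [/eqP|rint]; last by rewrite -{1}(floorK rint) subrr.
by rewrite subr_eq0 => /eqP ->; rewrite intr_int.
Qed.

Lemma tfrac_bounds (r : R) : 0 <= tfrac r < 1.
Proof.
rewrite /tfrac; have := floor_itv r; rewrite intrD => /andP[? ?].
by apply/andP; split; lra.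
Qed.

Lemma tfracB_int (r : R) : tfrac r - r \is a Num.int.
Proof. by rewrite /tfrac addrC addKr rpredN intr_int. Qed.

Lemma XfP (f : K -> int) (x : K -> R) : fsupp f ->
  Xf L f x <-> torus_pt x /\
    forall g : K, pairing (fun k : K => f (g^-1 * k)%g) x \is a Num.int.
Proof.
move=> ff.
have E (g : K) : pairing (fun k : K => f (g^-1 * k)%g) x =
    \sum_(k \in Defs.support f) (f k)%:~R * rho L k x g.
  transitivity (fsum (fun k : K => (f k)%:~R * x (g * k)%g)).
    rewrite /pairing -(@fsum_reindex _ _ _ (fun k : K => g * k)%g (fun k : K => g^-1 * k)%g).
    - by apply: eq_fsum => k; rewrite mulKg.
    - by move=> k; rewrite mulKg.
    - by move=> k; rewrite mulVKg.
  apply/esym/fsbig_widen => // k /= [_ nk].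
  have -> : f k = 0 by apply/eqP/negPn/negP.
  by rewrite mul0r.
split=> -[tx H]; split=> //.
  by move=> g; rewrite E; apply/tfrac_eq0; exact: (congr1 (fun p => p g) H).
by apply/funext => g; apply/tfrac_eq0; rewrite -E.
Qed.

Lemma pairing_ideal (f h : K -> int) (x : K -> R) : fsupp f -> ideal f h -> Xf L f x ->
  pairing h x \is a Num.int.
Proof.
move=> ff [a fa ah] /(XfP _ ff)[_ Hx].
have fh : fsupp h by rewrite (_ : h = conv a f); [exact: fsupp_conv|apply/funext => y].
have /fsuppP[s us sa] := fa.
have {}ah y : h y = \sum_(k <- s) a k * f (k^-1 * y)%g.
  by rewrite -ah convE (fsum_seq us)// => k /sa ->; rewrite mul0r.
have ffk k : fsupp (fun y => f (k^-1 * y)%g) by apply: fsupp_comp ff; exact: mulgI.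
suff -> : pairing h x = \sum_(k <- s) (a k)%:~R * pairing (fun y => f (k^-1 * y)%g) x.
  by apply: rpred_sum => k _; apply: rpredM; [exact: intr_int|exact: Hx].
rewrite /pairing (eq_fsum (G := fun y => \sum_(k <- s) (a k)%:~R * ((f (k^-1 * y)%g)%:~R * x y))).
  elim: s {us sa ah} => [|k s IH].
    by rewrite big_nil -[RHS](fsum0 K R); apply: eq_fsum => y; rewrite big_nil.
  rewrite big_cons -IH -fsumZl; last exact: fsupp_pairing.
  rewrite -fsumD; first by apply: eq_fsum => y; rewrite big_cons.
    by apply: fsuppMr; exact: fsupp_pairing.
  elim: s {IH} => [|j s IH].
    by apply: (@sub_finite_set _ _ set0) => // y /=; rewrite big_nil eqxx.
  rewrite (_ : (fun y => _) = fun y => (a j)%:~R * ((f (j^-1 * y)%g)%:~R * x y) +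
     \sum_(k <- s) (a k)%:~R * ((f (k^-1 * y)%g)%:~R * x y)); last first.
    by apply/funext => y; rewrite big_cons.
  by apply: fsuppD => //; apply: fsuppMr; exact: fsupp_pairing.
move=> y; rewrite ah rmorph_sum mulr_suml; apply: eq_bigr => k _.
by rewrite rmorphM mulrA.
Qed.

(** A character trivial on the ideal but not at [h] is, on finitely supported functions, the pairing
    with the point whose coordinates are its values at the delta functions. *)
Lemma ex_separating_point (f h : K -> int) : fsupp f -> fsupp h -> ~ ideal f h ->
  exists2 x : K -> R, Xf L f x & pairing h x \isn't a Num.int.
Proof.
move=> ff fh nh.
have [phi [phiD phif phih]] := @ex_character (K -> int) R (ideal f)
  (ideal0 f) (fun a b ia ib => idealB ff ia ib) h nh.
pose delta (g : K) : K -> int := fun k => (k == g)%:R.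
pose x g := tfrac (phi (delta g)).
have phi0 : phi 0 \is a Num.int.
  by have := phiD 0 0; rewrite addr0 opprD addrA subrr sub0r rpredN.
have phiM a z : phi (a *~ z) - z%:~R * phi a \is a Num.int.
  have H n : phi (a *+ n) - n%:R * phi a \is a Num.int.
    elim: n => [|n IH]; first by rewrite mulr0n mul0r subr0.
    have := rpredD (phiD a (a *+ n)) IH; rewrite -mulrS; congr (_ \is a Num.int).
    by rewrite -natr1; ring.
  case: z => n; first exact: H.
  rewrite NegzE mulrNz; have := phiD (a *+ n.+1) (a *- n.+1); rewrite subrr => D.
  have := rpredB (rpredB phi0 D) (H n.+1); congr (_ \is a Num.int).
  by rewrite mulrNz -pmulrn; ring.
have key (w : K -> int) : fsupp w -> pairing w x - phi w \is a Num.int.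
  move=> fw; have /fsuppP[s us sw] := fw.
  have -> : pairing w x = \sum_(g <- s) (w g)%:~R * x g.
    by rewrite /pairing (fsum_seq us)// => g /sw ->; rewrite mul0r.
  have wE : w = \sum_(g <- s) delta g *~ w g.
    apply/funext => k; rewrite fct_sumE.
    have [ks|ks] := boolP (k \in s).
      rewrite (bigD1_seq k)//= big1_seq ?addr0.
        by rewrite mulrz_fct /delta eqxx intz.
      by move=> g /andP[gk _]; rewrite mulrz_fct /delta eq_sym (negbTE gk) mul0rz.
    rewrite (sw _ ks) big1_seq// => g /andP[_ gs].
    rewrite mulrz_fct /delta (_ : k == g = false) ?mul0rz//.
    by apply: contraNF ks => /eqP ->.
  rewrite {2}wE; elim: s {us sw wE} => [|g s IH].
    by rewrite !big_nil sub0r rpredN.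
  rewrite !big_cons.
  have D := phiD (delta g *~ w g) (\sum_(j <- s) delta j *~ w j).
  have M := phiM (delta g) (w g).
  have F : (w g)%:~R * (x g - phi (delta g)) \is a Num.int.
    by apply: rpredM; [exact: intr_int|exact: tfracB_int].
  have := rpredB (rpredB (rpredD F IH) M) D; congr (_ \is a Num.int).
  by ring.
exists x.
  apply/XfP => //; split; first by move=> g; exact: tfrac_bounds.
  move=> g; have ffg : fsupp (fun k => f (g^-1 * k)%g) by apply: fsupp_comp ff; exact: mulgI.
  have If : ideal f f.
    exists (fun k => (k == 1%g)%:R); first exact: fsupp_delta.
    move=> y; rewrite convE (fsum1 (x0 := 1%g)) ?eqxx ?mul1r ?invg1 ?mul1g//.
    by move=> k /negbTE ->; rewrite mul0r.
  by have := rpredD (key _ ffg) (phif _ (ideal_shift g^-1%g If)); rewrite subrK.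
apply: contra phih => hint.
by have := rpredB hint (key _ fh); rewrite opprB addrC subrK.
Qed.

End LawGroup.

(** * Ergodicity *)

Lemma measurable_tfrac (R : realType) : measurable_fun [set: R] (@tfrac R).
Proof.
apply: measurable_funB => //; apply: nondecreasing_measurable => // r s rs.
by rewrite ler_int; exact: le_floor.
Qed.

Section TorusMeasure.
Variables (G : countType) (R : realType).
Local Notation T := (TorusSpace G R).

Lemma measurable_into_torus d (S : measurableType d) (X : S -> T) :
  (forall g, measurable_fun [set: S] (fun x => (X x : G -> R) g)) ->
  measurable_fun [set: S] X.
Proof.
move=> mX; apply: (@measurability _ _ S T [set: S] X (@cylinders G R) erefl).
move=> _ [_ [g [B [mB ->]]] <-].
have := mX g measurableT B mB; congr (measurable (_ `&` _)).
Qed.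

Variables (mu : probability T R) (Om : set T).
Hypotheses (mOm : measurable Om) (muOm : mu Om = 1%E) (OmT : Om `<=` @torus G R).

Definition mean (p : T -> R) : R := (\int[mu]_x p x)%R.

Lemma bounded_integrable (p : T -> R) M :
  measurable_fun [set: T] p -> bounded_by M p -> mu.-integrable [set: T] (EFin \o p).
Proof.
move=> mp pM; apply: measurable_bounded_integrable => //.
  by apply: le_lt_trans (probability_le1 _ _) _; rewrite ?ltry.
exists M; split; first exact: num_real.
by move=> N MN x _; apply: le_trans (pM x) (ltW MN).
Qed.

Lemma mu_setC : mu (~` Om) = 0%E.
Proof. by rewrite probability_setC// muOm subee. Qed.

Lemma mean_ae (p q : T -> R) : measurable_fun [set: T] p -> measurable_fun [set: T] q ->
  (forall x, Om x -> p x = q x) -> mean p = mean q.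
Proof.
move=> mp mq pq; congr fine; apply: ae_eq_integral => //; [exact/measurable_EFinP..|].
exists (~` Om); split; [exact: measurableC|exact: mu_setC|].
by move=> x /= npq Ox; apply: npq => _; rewrite pq.
Qed.

Lemma mean_dominated : dominated_functional mean.
Proof.
split.
- move=> p q M mp mq pM qM; apply: RintegralD => //; exact: bounded_integrable.
- by move=> a p M mp pM; apply: RintegralZl => //; exact: bounded_integrable.
move=> p_ p M mp_ mp pM lim; apply: fine_cvg.
have ip : mu.-integrable [set: T] (fun x => (Num.max M 0)%:E).
  apply: (@bounded_integrable (fun=> Num.max M 0) (Num.max M 0)) => // x.
  by rewrite ger0_norm// le_max lexx orbT.
have [|||||iP _] := @dominated_convergence _ T R mu [set: T] measurableT
  (fun n x => (p_ n x)%:E) (fun x => (p x)%:E) (fun=> (Num.max M 0)%:E).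
- by move=> n; exact/measurable_EFinP.
- exact/measurable_EFinP.
- exists (~` Om); split; [exact: measurableC|exact: mu_setC|].
  move=> x /= nl Ox; apply: nl => _; apply: cvg_EFin; first exact: nearW.
  by apply: lim; exact: OmT.
- exact: ip.
- by apply: aeW => x n _; rewrite lee_fin le_max pM.
rewrite fineK//; exact: integrable_fin_num.
Qed.

Lemma mean_le (p q : T -> R) M : measurable_fun [set: T] p -> measurable_fun [set: T] q ->
  bounded_by M p -> bounded_by M q -> (forall x, p x <= q x) -> mean p <= mean q.
Proof.
by move=> mp mq pM qM pq; apply: le_Rintegral => //; exact: bounded_integrable.
Qed.

Lemma mean_cst (a : R) : mean (fun=> a) = a.
Proof.
transitivity (a * fine (mu [set: T])); first exact: Rintegral_cst.
by rewrite (probability_setT mu) mulr1.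
Qed.

Lemma mean_indic (B : set T) : measurable B -> mean (\1_B : T -> R) = fine (mu B).
Proof. by move=> mB; rewrite /mean /Rintegral integral_indic// setIT. Qed.

Lemma mean_invariant (X : T -> T) (p : T -> R) M : measurable_fun [set: T] X ->
  (forall B : set T, measurable B -> mu (X @^-1` B) = mu B) ->
  measurable_fun [set: T] p -> bounded_by M p -> mean (fun x => p (X x)) = mean p.
Proof.
move=> mX inv mp pM; congr fine.
have := @integral_pushforward _ _ T T R X mX mu [set: T] (fun x => (p x)%:E).
rewrite preimage_setT => /(_ _ _ measurableT) <-.
- by apply: eq_measure_integral => B mB _; rewrite /pushforward; exact: inv.
- exact/measurable_EFinP.
- apply: (@bounded_integrable (fun x => p (X x)) M); last by move=> x; exact: pM.
  exact: measurableT_comp.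
Qed.

Lemma indic_bounded (B : set T) : bounded_by 1 (\1_B : T -> R).
Proof. by move=> x; rewrite indicE; case: (_ \in _); rewrite ?normr1 ?normr0. Qed.

Lemma dominated_weight (E : (T -> R) -> R) (w : T -> R) N : dominated_functional E ->
  measurable_fun [set: T] w -> bounded_by N w ->
  dominated_functional (fun p : T -> R => E (fun x => w x * p x)).
Proof.
move=> [ED EZ EL] mw wN.
have b (p : T -> R) M : bounded_by M p -> bounded_by (N * M) (fun x => w x * p x).
  by move=> pM x; rewrite normrM; apply: ler_pM.
split.
- move=> p q M mp mq pM qM.
  rewrite -(ED _ _ (N * M)); [|exact: measurable_funM..|exact: b|exact: b].
  by congr E; apply/funext => x; rewrite mulrDr.
- move=> a p M mp pM.
  rewrite -(EZ _ _ (N * M)); [|exact: measurable_funM|exact: b].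
  by congr E; apply/funext => x; rewrite mulrCA.
- move=> p_ p M mp_ mp pM lim.
  apply: (EL (fun n x => w x * p_ n x) (fun x => w x * p x) (N * M)).
  + by move=> n; exact: measurable_funM.
  + exact: measurable_funM.
  + by move=> n; exact: b.
  + by move=> x tx; apply: cvgM; [exact: cvg_cst|exact: lim].
Qed.

Lemma dominated_comp (E : (T -> R) -> R) (X : T -> T) : dominated_functional E ->
  measurable_fun [set: T] X -> (forall x, @torus G R x -> @torus G R (X x)) ->
  dominated_functional (fun p : T -> R => E (fun x => p (X x))).
Proof.
move=> [ED EZ EL] mX tX; have m (p : T -> R) : measurable_fun [set: T] p ->
  measurable_fun [set: T] (fun x => p (X x)) by move=> mp; exact: measurableT_comp.
split.
- by move=> p q M mp mq pM qM; apply: (ED _ _ M); [exact: m|exact: m|move=> x; exact: pM|move=> x; exact: qM].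
- by move=> a p M mp pM; apply: (EZ _ _ M); [exact: m|move=> x; exact: pM].
- move=> p_ p M mp_ mp pM lim; apply: (EL (fun n x => p_ n (X x)) (fun x => p (X x)) M).
  + by move=> n; exact: m.
  + exact: m.
  + by move=> n x; exact: pM.
  + by move=> x tx; apply: lim; exact: tX.
Qed.

Lemma dominated_subZ (E E' : (T -> R) -> R) (a : R) : dominated_functional E -> dominated_functional E' ->
  dominated_functional (fun p : T -> R => E p - a * E' p).
Proof.
move=> [ED EZ EL] [ED' EZ' EL']; split.
- move=> p q M mp mq pM qM; rewrite (ED _ _ M)// (ED' _ _ M)//; ring.
- move=> b p M mp pM; rewrite (EZ _ _ M)// (EZ' _ _ M)//; ring.
- move=> p_ p M mp_ mp pM lim; apply: cvgB; first exact: EL pM lim.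
  by apply: cvgM; [exact: cvg_cst|exact: EL' pM lim].
Qed.

End TorusMeasure.

Section Ergodic.
Variables (G : countType) (L : group_law G) (R : realType).
Local Notation K := (law_type L).
Local Notation T := (TorusSpace K R).
Implicit Types (h : K -> int) (g : K) (t : R).

Lemma pairing_lambda h g (x : K -> R) :
  pairing h (lambda L g x) = pairing (fun k : K => h (g * k)%g) x.
Proof.
rewrite /pairing -(@fsum_reindex _ _ _ (fun k : K => g * k)%g (fun k : K => g^-1 * k)%g).
- apply: eq_fsum => k; rewrite /lambda law_mulE law_invE.
  by rewrite (mulKg (g : K)).
- by move=> k; rewrite mulKg.
- by move=> k; rewrite mulVKg.
Qed.

Lemma chi_lambda h t g (x : K -> R) :
  chi h t (lambda L g x) = chi (fun k : K => h (g * k)%g) t x.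
Proof. by rewrite /chi pairing_lambda. Qed.

Lemma measurable_lambda g : measurable_fun [set: T] (lambda L g : T -> T).
Proof. by apply: measurable_into_torus => k; exact: measurable_coord. Qed.

Lemma torus_lambda g (x : T) : @torus K R x -> @torus K R (lambda L g x).
Proof. by move=> tx k; exact: tx. Qed.

Lemma measurable_tadd (y : K -> R) : measurable_fun [set: T] (fun x : T => tadd x y : T).
Proof.
apply: measurable_into_torus => k; apply: measurableT_comp; first exact: measurable_tfrac.
by apply: measurable_funD => //; exact: measurable_coord.
Qed.

Lemma chi_tadd h t (x y : K -> R) : fsupp h ->
  chi h t (tadd x y) = chi h (t + 2 * pi * pairing h y) x.
Proof.
move=> fh; have /fsuppP[s us sh] := fh.
have E (z : K -> R) : pairing h z = \sum_(k <- s) (h k)%:~R * z k.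
  by rewrite /pairing (fsum_seq us)// => k /sh ->; rewrite mul0r.
have /intrP[z zE] : pairing h (tadd x y) - (pairing h x + pairing h y) \is a Num.int.
  rewrite !E -big_split -sumrB /=; apply: rpred_sum => k _.
  by rewrite -mulrDr -mulrBr; apply: rpredM; [exact: intr_int|exact: tfracB_int].
have {}zE : pairing h (tadd x y) = pairing h x + pairing h y + z%:~R.
  by rewrite -zE addrC subrK.
rewrite /chi zE -[RHS](cosD2piMz _ z); congr cos; ring.
Qed.

Variable f : K -> int.
Hypothesis ff : fsupp f.
Local Notation Om := (Xf L f : set T).

Lemma Xf_torus : Om `<=` @torus K R.
Proof. by move=> x []. Qed.

Lemma measurable_Xf : measurable Om.
Proof.
have -> : Om = @torus K R `&` \bigcap_(n in [set: nat])
    (if (unpickle n : option K) is Some g then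
       (fun x : T => tfrac (pairing (fun k : K => f (g^-1 * k)%g) x)) @^-1` [set 0]
     else setT).
  apply/seteqP; split=> x.
    move=> /(XfP _ ff)[tx Hx]; split=> // n _; case: (unpickle n) => // g.
    by apply/tfrac_eq0; exact: Hx.
  move=> [tx Hx]; apply/XfP => //; split=> // g.
  by apply/tfrac_eq0; have := Hx (pickle g) I; rewrite pickleK.
apply: measurableI; first exact: measurable_torus.
apply: bigcapT_measurable => n; case: (unpickle n) => // g.
rewrite -[X in measurable X]setTI.
have ffg : fsupp (fun k : K => f (g^-1 * k)%g) by apply: fsupp_comp ff; exact: mulgI.
have mt := measurableT_comp (@measurable_tfrac R) (measurable_pairing (R := R) ffg).
exact: (mt measurableT [set 0] (measurable_set1 _)).
Qed.

Variable mu : probability T R.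
Hypothesis muX : mu Om = 1%E.
Hypothesis haar : forall y, Xf L f y -> forall A : set T, measurable A ->
  mu ((fun x : T => tadd x y : T) @^-1` A) = mu A.

Local Notation M := (mean mu).
Let mean_ext := mean_ae measurable_Xf muX.
Let domM := mean_dominated measurable_Xf muX Xf_torus.

Let MD (p q : T -> R) B (mp : measurable_fun [set: T] p) (mq : measurable_fun [set: T] q)
  (pB : bounded_by B p) (qB : bounded_by B q) : M (fun x => p x + q x) = M p + M q.
Proof. by have [H _ _] := domM; exact: H pB qB. Qed.

Let MZ a (p : T -> R) B (mp : measurable_fun [set: T] p) (pB : bounded_by B p) :
  M (fun x => a * p x) = a * M p.
Proof. by have [_ H _] := domM; exact: H pB. Qed.

Let chiB h t : bounded_by 1 (fun x : T => chi h t x).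
Proof. by move=> x; exact: chi_bound. Qed.

Lemma chi_ideal h t (x : T) : ideal f h -> Om x -> chi h t x = cos t.
Proof.
move=> ih Ox; have /intrP[z E] := pairing_ideal ff ih Ox.
by rewrite /chi E addrC cosD2piMz.
Qed.

Lemma mean_chi_ideal h t : ideal f h -> M (fun x : T => chi h t x) = cos t.
Proof.
move=> ih; rewrite -[RHS](mean_cst mu); apply: mean_ext => //.
  by apply: measurable_chi; exact: fsupp_ideal ih.
by move=> x; exact: chi_ideal.
Qed.

(** Translation by a separating point shifts the phase by [tau] without changing the mean. Adding
    the phases [t + tau] and [t - tau] gives [2 * J = 2 * cos tau * J], and [cos tau] is not 1. *)
Lemma mean_chi_nonideal h t : fsupp h -> ~ ideal f h -> M (fun x : T => chi h t x) = 0.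
Proof.
move=> fh nh; have [y Xy ny] := ex_separating_point R ff fh nh.
pose tau := 2 * pi * pairing h y.
have mc s : measurable_fun [set: T] (fun x : T => chi h s x) by exact: measurable_chi.
have per s : M (fun x : T => chi h (s + tau) x) = M (fun x : T => chi h s x).
  rewrite -(mean_invariant (measurable_tadd y) (haar Xy) (mc s) (chiB h s)).
  by congr (M _); apply/funext => x; rewrite chi_tadd.
have pm : M (fun x : T => chi h t x) = M (fun x : T => chi h (t - tau) x).
  by rewrite -[in RHS](per (t - tau)) subrK.
have : M (fun x : T => chi h (t + tau) x) + M (fun x : T => chi h (t - tau) x) =
    2 * cos tau * M (fun x : T => chi h t x).
  rewrite -(MD (mc _) (mc _) (chiB h _) (chiB h _)) -(MZ _ (mc t) (chiB h t)).
  congr (M _); apply/funext => x; rewrite /chi.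
  by rewrite addrA addrA cosD cosB; ring.
rewrite per -pm; set J := M _ => E.
have : (1 - cos tau) * J = 0 by lra.
move=> /eqP; rewrite mulf_eq0 => /orP[/eqP c1|/eqP//].
by case/negP: ny; apply: cos2pi_eq1; rewrite -/tau; lra.
Qed.

(** A function and its translate lie in the ideal simultaneously, so the measure and its image have
    the same Fourier coefficients. *)
Lemma lambda_invariant g (B : set T) : measurable B ->
  mu ((lambda L g : T -> T) @^-1` B) = mu B.
Proof.
move=> mB.
have dE := dominated_subZ 1 (dominated_comp domM (measurable_lambda g) (@torus_lambda g)) domM.
have E0 h t : fsupp h -> M (fun x : T => chi h t (lambda L g x)) -
    1 * M (fun x : T => chi h t x) = 0.
  move=> fh; under [X in M X]eq_fun do rewrite chi_lambda.
  have [ih|nh] := pselect (ideal f h).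
    by rewrite !mean_chi_ideal//; [rewrite mul1r subrr|exact: ideal_shift].
  rewrite !mean_chi_nonideal//; first by rewrite mulr0 subrr.
    by apply: fsupp_comp fh; exact: mulgI.
  by move=> /ideal_shiftE.
have := functional_indic0 dE E0 mB; rewrite mul1r.
have mgB : measurable ((lambda L g : T -> T) @^-1` B).
  by rewrite -[X in measurable X]setTI; exact: measurable_lambda.
rewrite (_ : (fun x => \1_B (lambda L g x)) = \1_((lambda L g : T -> T) @^-1` B)); last first.
  by apply/funext => x; rewrite !indicE.
rewrite !mean_indic// => /eqP; rewrite subr_eq0 => /eqP E.
by apply/eqP; rewrite -eqe -[in X in X == _](fineK (fin_num_measure mu _ mgB)) E fineK// fin_num_measure.
Qed.

Lemma mean_sum (s : seq K) (p : K -> T -> R) B : (forall g, measurable_fun [set: T] (p g)) ->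
  (forall g, bounded_by B (p g)) ->
  [/\ measurable_fun [set: T] (fun x => \sum_(g <- s) p g x),
      exists B', bounded_by B' (fun x => \sum_(g <- s) p g x) &
      M (fun x => \sum_(g <- s) p g x) = \sum_(g <- s) M (p g)].
Proof.
move=> mp pB; elim: s => [|g s [IH1 [B' IH2] IH3]].
  rewrite (_ : (fun x => _) = fun=> 0); last by apply/funext => x; rewrite big_nil.
  split; first exact: measurable_cst.
    by exists 0 => x; rewrite normr0.
  by rewrite mean_cst big_nil.
rewrite (_ : (fun x => _) = fun x => p g x + \sum_(k <- s) p k x); last first.
  by apply/funext => x; rewrite big_cons.
split; first exact: measurable_funD.
  by exists (B + B') => x; apply: le_trans (ler_normD _ _) (lerD (pB g x) (IH2 x)).
rewrite big_cons -IH3; apply: (MD (B := Num.max B B')) => // x; rewrite le_max.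
  by rewrite pB.
by rewrite IH2 orbT.
Qed.

Section InvariantSet.
Variable A : set T.
Hypotheses (mA : measurable A).
Hypothesis Ainv : forall g (x : K -> R), Xf L f x -> (A (lambda L g x) <-> A x).

Let a h t := M (fun x => \1_A x * chi h t x).

Let mIA : measurable_fun [set: T] (\1_A : T -> R).
Proof. exact: measurable_indic. Qed.

Let mIchi h t : fsupp h -> measurable_fun [set: T] (fun x : T => \1_A x * chi h t x).
Proof. by move=> fh; apply: measurable_funM => //; exact: measurable_chi. Qed.

Let bI (p : T -> R) B : bounded_by B p -> bounded_by B (fun x : T => \1_A x * p x).
Proof.
move=> pB x; rewrite indicE; case: (_ \in _); rewrite ?mul1r// mul0r normr0.
exact: le_trans (normr_ge0 _) (pB x).
Qed.

Lemma coefficient_shift h t g : fsupp h -> a (fun k : K => h (g * k)%g) t = a h t.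
Proof.
move=> fh; rewrite /a.
rewrite -[RHS](mean_invariant (measurable_lambda g) (lambda_invariant g)
  (mIchi t fh) (bI (chiB h t))).
have fhg : fsupp (fun k : K => h (g * k)%g) by apply: fsupp_comp fh; exact: mulgI.
apply: mean_ext; first exact: mIchi.
  by apply: (measurableT_comp (mIchi t fh)); exact: measurable_lambda.
move=> x Ox; rewrite chi_lambda; congr (_ * _); rewrite !indicE.
rewrite (_ : (lambda L g x \in A) = (x \in A))//.
by apply/idP/idP => /set_mem/(Ainv g Ox) H; apply: mem_set.
Qed.

(* [C ^+ 2 + S ^+ 2] is the squared modulus of a sum of [size s] orthonormal complex
   characters; compare [2 c C] with [c ^+ 2 + C ^+ 2 + S ^+ 2] on [A]. *)
Lemma coefficient_bound h t (s : seq K) (c : R) : fsupp h -> uniq s ->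
  {in s &, forall x y, x != y -> ~ stab f h (x * y^-1)%g} ->
  2 * c * ((size s)%:R * a h t) <= c ^+ 2 + (size s)%:R.
Proof.
move=> fh us sfree; pose hx g := fun k : K => h (g * k)%g.
have fhx g : fsupp (hx g) by apply: fsupp_comp fh; exact: mulgI.
pose p r g := fun x : T => chi (hx g) r x.
have mp r g : measurable_fun [set: T] (p r g) by exact: measurable_chi.
have pB r g : bounded_by 1 (p r g) by exact: chiB.
pose C r (x : T) := \sum_(g <- s) p r g x.
have [mC [B CB] _] := mean_sum s (mp t) (pB t).
(* The phase shift turns cosines into sines, so [C S] is the imaginary part of the sum whose real
   part is [C t]. *)
pose S := t - pi / 2.
have [mS [B' SB] _] := mean_sum s (mp S) (pB S).
have sumA : M (fun x => \1_A x * C t x) = (size s)%:R * a h t.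
  have [_ _ E] := mean_sum s (p := fun g x => \1_A x * p t g x) (B := 1)
    (fun g => mIchi t (fhx g)) (fun g => bI (pB t g)).
  transitivity (M (fun x => \sum_(g <- s) \1_A x * p t g x)).
    by congr (M _); apply/funext => x; rewrite mulr_sumr.
  rewrite E (eq_bigr (fun=> a h t)) => [|g _]; last exact: coefficient_shift.
  by rewrite big_const_seq count_predT iter_addr addr0 mulr_natl.
pose q g g' := fun x : T => chi (fun k => hx g k - hx g' k) 0 x.
have fq g g' : fsupp (fun k => hx g k - hx g' k) by exact: fsuppB.
have CSE x : C t x ^+ 2 + C S x ^+ 2 = \sum_(g <- s) \sum_(g' <- s) q g g' x.
  rewrite /C !expr2 !big_distrlr -big_split; apply: eq_bigr => g _ /=.
  rewrite -big_split; apply: eq_bigr => g' _ /=.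
  rewrite /p /q /chi pairingB// /S !addrA !cosBpihalf -cosB; congr cos; ring.
have MCS : M (fun x => C t x ^+ 2 + C S x ^+ 2) = (size s)%:R.
  transitivity (M (fun x => \sum_(g <- s) \sum_(g' <- s) q g g' x)).
    by congr (M _); apply/funext => x; exact: CSE.
  have inner g := mean_sum s (p := q g) (B := 1)
    (fun g' => measurable_chi 0 (fq g g')) (fun g' => chiB _ 0).
  have innerB g : bounded_by (size s)%:R (fun x => \sum_(g' <- s) q g g' x).
    move=> x; apply: le_trans (ler_norm_sum _ _ _) _.
    apply: le_trans (_ : \sum_(g' <- s) 1 <= _); first by apply: ler_sum => g' _; exact: chi_bound.
    by rewrite big_const_seq count_predT iter_addr addr0.
  have [_ _ ->] := mean_sum s (fun g => let: And3 m _ _ := inner g in m) innerB.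
  rewrite (eq_big_seq (fun=> 1)); first by rewrite big_const_seq count_predT iter_addr addr0.
  move=> g gs; have [_ _ ->] := inner g.
  rewrite (bigD1_seq g)//= big1_seq ?addr0 /q.
    rewrite mean_chi_ideal ?cos0//.
    rewrite (_ : (fun k => _) = fun=> 0); first exact: ideal0.
    by apply/funext => k; rewrite subrr.
  move=> g' /andP[g'g g's]; apply: mean_chi_nonideal => // i.
  apply: (sfree g g' gs g's); first by rewrite eq_sym.
  apply: (proj1 (@ideal_shiftE _ f (gdiff (g * g'^-1)%g h) g')).
  rewrite (_ : (fun k => _) = fun k => hx g k - hx g' k)//.
  by apply/funext => k; rewrite /gdiff /hx mulgA mulgVK.
have mC2 : measurable_fun [set: T] (fun x => C t x ^+ 2 + C S x ^+ 2).
  by apply: measurable_funD; exact: measurable_funX.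
rewrite -sumA -MCS.
have absB x : `|C t x| <= B by exact: CB.
have absB' x : `|C S x| <= B' by exact: SB.
have B0 : 0 <= B by apply: le_trans (normr_ge0 _) (absB (fun=> 0)).
have B0' : 0 <= B' by apply: le_trans (normr_ge0 _) (absB' (fun=> 0)).
have sqB (y b : R) : `|y| <= b -> y ^+ 2 <= b ^+ 2.
  by rewrite ler_norml => /andP[? ?]; nra.
have mAC : measurable_fun [set: T] (fun x => \1_A x * C t x) by exact: measurable_funM.
have bCS : bounded_by (B ^+ 2 + B' ^+ 2) (fun x => C t x ^+ 2 + C S x ^+ 2).
  by move=> x; rewrite ger0_norm ?addr_ge0 ?sqr_ge0// lerD// sqB.
rewrite -(MZ (2 * c) mAC (bI CB)) -(mean_cst mu (c ^+ 2)).
have bcst : bounded_by (c ^+ 2 + (B ^+ 2 + B' ^+ 2)) (fun _ : T => c ^+ 2).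
  by move=> x; rewrite ger0_norm ?sqr_ge0// lerDl addr_ge0 ?sqr_ge0.
have bCS' : bounded_by (c ^+ 2 + (B ^+ 2 + B' ^+ 2)) (fun x => C t x ^+ 2 + C S x ^+ 2).
  by move=> x; apply: le_trans (bCS x) _; rewrite lerDr sqr_ge0.
rewrite -(MD (measurable_cst _) mC2 bcst bCS').
apply: (@mean_le K R mu _ _ (`|2 * c| * B + (c ^+ 2 + (B ^+ 2 + B' ^+ 2)))).
- exact: measurable_funM.
- by apply: measurable_funD => //; exact: measurable_cst.
- move=> x; rewrite normrM; apply: le_trans (_ : `|2 * c| * B <= _).
    by apply: ler_wpM2l => //; exact: (bI CB x).
  by rewrite lerDl !addr_ge0 ?sqr_ge0.
- move=> x; rewrite ger0_norm ?addr_ge0 ?sqr_ge0//.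
  apply: le_trans (_ : c ^+ 2 + (B ^+ 2 + B' ^+ 2) <= _); last by rewrite lerDr mulr_ge0.
  by rewrite lerD2l lerD// sqB.
move=> x /=; rewrite indicE; move: (C t x) (C S x) => u v.
have := sqr_ge0 (c - u); have := sqr_ge0 v; have := sqr_ge0 u; have := sqr_ge0 c.
by case: (_ \in _); rewrite ?mul1r ?mul0r ?mulr0 => *; nra.
Qed.

(** An infinite orbit always has an element outside the classes already chosen, so translates of [h]
    that are distinct modulo the ideal are picked one by one. *)
Lemma ex_free_translates h n :
  (forall r : seq K, exists g, forall x, x \in r -> ~ stab f h (g * x^-1)%g) ->
  exists2 s : seq K, size s = n & uniq s /\
    {in s &, forall x y, x != y -> ~ stab f h (x * y^-1)%g}.
Proof.
move=> inforb; elim: n => [|n [s ss [us sfree]]]; first by exists [::].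
have [g gP] := inforb s; exists (g :: s); rewrite /= ?ss//; split.
  rewrite us andbT; apply/negP => /gP; apply.
  by rewrite mulgV; exact: stab1.
move=> x y; rewrite !inE => /predU1P[->|xs] /predU1P[->|ys]; rewrite ?eqxx// => xy.
- exact: gP.
- move=> /(stabV ff); rewrite invgM invgK; exact: gP.
- exact: sfree.
Qed.

(** Infinitely many orthogonal characters share this Fourier coefficient of the indicator of [A], as
    in Bessel's inequality. It suffices to show that it is never positive, because the phase shift
    by pi changes its sign. *)
Lemma coefficient_nonideal h t : fsupp h ->
  (forall r : seq K, exists g, forall x, x \in r -> ~ stab f h (g * x^-1)%g) ->
  a h t = 0.
Proof.
move=> fh inforb.
have le0 r : a h r <= 0.
  rewrite leNgt; apply/negP => ap.
  (* With [m * m] translates and [c = m], [coefficient_bound] reads [m * a h r <= 1], while [m]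
     exceeds the inverse of [a h r]. *)
  pose m := (Num.bound (a h r)^-1).+1.
  have [s ss [us sfree]] := ex_free_translates (m * m) inforb.
  have := coefficient_bound r m%:R fh us sfree; rewrite ss natrM.
  have m0 : 0 < m%:R :> R by rewrite ltr0n.
  have : (a h r)^-1 < m%:R.
    apply: lt_le_trans (archi_boundP _) _; first by rewrite invr_ge0 ltW.
    by rewrite ler_nat.
  rewrite -(ltr_pM2r ap) mulVf ?gt_eqF// => lt le.
  have {}le : m%:R * m%:R * (m%:R * a h r) <= m%:R * m%:R by move: le; nra.
  by move: le; rewrite ger_pMr ?mulr_gt0// leNgt lt.
apply/eqP; rewrite eq_le le0 /= -oppr_le0.
have -> : - a h t = a h (t + pi).
  rewrite /a -mulN1r -(MZ (-1) (mIchi t fh) (bI (chiB h t))).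
  by congr (M _); apply/funext => x; rewrite /chi addrA cosDpi; ring.
exact: le0.
Qed.

(** The restriction of the measure to [A] and its multiple by [c = mu A] have the same Fourier
    coefficients, so they agree; on [A] itself this says [c = c * c]. *)
Lemma invariant_trivial :
  (forall h, fsupp h -> ~ ideal f h ->
    forall r : seq K, exists g, forall x, x \in r -> ~ stab f h (g * x^-1)%g) ->
  mu A = 0%E \/ mu A = 1%E.
Proof.
move=> inforb; pose c := fine (mu A).
have dE := dominated_subZ c (dominated_weight domM mIA (@indic_bounded K R A)) domM.
have E0 h t : fsupp h ->
    M (fun x : T => \1_A x * chi h t x) - c * M (fun x : T => chi h t x) = 0.
  move=> fh; have [ih|nh] := pselect (ideal f h); last first.
    rewrite mean_chi_nonideal// mulr0 subr0.
    exact: coefficient_nonideal (inforb h fh nh).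
  rewrite mean_chi_ideal// (_ : M (fun x => \1_A x * chi h t x) = M (fun x => cos t * \1_A x)).
    by rewrite (MZ (cos t) mIA (@indic_bounded K R A)) mean_indic// mulrC subrr.
  apply: mean_ext; first exact: mIchi.
    by apply: measurable_funM.
  by move=> x Ox; rewrite (chi_ideal t ih Ox) mulrC.
have := functional_indic0 dE E0 mA.
rewrite (_ : (fun x => \1_A x * \1_A x) = \1_A); last first.
  by apply/funext => x; rewrite indicE; case: (_ \in _); rewrite ?mulr1 ?mulr0.
rewrite mean_indic// -/c.
have -> : c - c * c = c * (1 - c) by ring.
have muE : mu A = c%:E by rewrite /c fineK// fin_num_measure.
move=> /eqP; rewrite mulf_eq0 => /orP[/eqP c0|]; first by left; rewrite muE c0.
by rewrite subr_eq0 => /eqP c1; right; rewrite muE -c1.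
Qed.

End InvariantSet.

End Ergodic.

Theorem theorem1p3 (G : countType) (L : group_law G) (R : realType)
    (f : G -> int) :
  infinite_set [set: G] ->
  ~ virtually_cyclic L ->
  in_group_ring f ->
  [set v : G -> R | in_l2 v /\ gconv L v f = (fun=> 0)] = [set (fun=> 0)] ->
  forall mu : probability (TorusSpace G R) R,
    is_haar_Xf L f mu -> ergodic_alpha L f mu.
Proof.
move=> Ginf nvc ff inj mu [muX haar] A mA _ Ainv.
have finj := @l2_injective_of_gconv G L R f ff inj.
apply: (@invariant_trivial G L R f ff mu muX haar A mA Ainv) => h fh nh r.
apply: contrapT => /forallNP nex; apply: nh.
apply: (@ideal_of_finite_orbit (law_type L) R f h r Ginf _ ff fh finj).
  by move=> /vcyclic_virtually_cyclic.
move=> g; apply: contrapT => ng; apply: (nex g) => x xr sx.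
by apply: ng; exists x.
Qed.
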